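(* Let $m_1,n\ge 1$ be integers, $m=2m_1$, let $r\in\{0,1,\dots,m_1\}$, and let $k$ be an integer (with $k\ge 0$ when $r=0$). Consider the $osp(2m_1,2n)$-modules $\mathcal A^r_k$ and $\mathcal H^r_k\subset\mathcal A^r_k$ and the operator $\eta$ defined in the context. Then the following hold. 1) Assume $r=0$. If $k>2(n-m_1+1)$ or $k\le n-m_1+1$, then $\mathcal A^0_k=\mathcal H^0_k\oplus\eta\mathcal A^0_{k-2}$ and the subspace $\mathcal H^0_k$ is an irreducible $osp(2m_1,2n)$-submodule. When $n-m_1+1<k\le 2(n-m_1+1)$, $$\mathcal H^0_k\supset \eta^{\,k-(n-m_1+1)}\mathcal H^0_{2(n-m_1+1)-k}\supset\{0\}$$ is a composition series. 2) Suppose $r=m_1$. Then always $\mathcal A^{m_1}_k=\mathcal H^{m_1}_k\oplus\eta\mathcal A^{m_1}_{k-2}$. If $k>n$, then $\mathcal H^{m_1}_k=\{0\}$. When $k\le n$, the subspace $\mathcal H^{m_1}_k$ is an irreducible $osp(2m_1,2n)$-submodule. 3) Assume $0<r<m_1$. If $k\le n-m_1+r+1$, then $\mathcal A^r_k=\mathcal H^r_k\oplus\eta\mathcal A^r_{k-2}$ and the submodule $\mathcal H^r_k$ is irreducible. When $k>n-m_1+r+1$, we have the following composition series: $$\mathcal H^r_k\supset\eta^{\,k-n+m_1-r-1}\mathcal H^r_{-k+2(n-m_1+r+1)}\supset\{0\}\quad\text{if } r<m_1-1;$$ $$\mathcal H^{m_1-1}_k\supset\langle x_{m_1}^k\rangle\supset\eta^{\,k-n}\mathcal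 H^{m_1-1}_{-k+2n}\supset\{0\}\quad\text{if } r=m_1-1.$$
   Context: $\mathbb N$ is the set of nonnegative integers and $\overline{i,j}=\{i,i+1,\dots,j\}$. $E_{i,j}$ denotes the square matrix with $(i,j)$-entry $1$ and other entries zero. The Lie superalgebra $gl(m,2n)$ of $(m+2n)\times(m+2n)$ complex matrices has even part spanned by $E_{i,j}$ ($i,j\in\overline{1,m}$) and $E_{m+s,m+t}$ ($s,t\in\overline{1,2n}$), odd part spanned by $E_{i,m+s},E_{m+s,i}$, and bracket $[u,v]=uv-(-1)^{\iota_1\iota_2}vu$ for $u,v$ of parities $\iota_1,\iota_2$. For $m=2m_1$, $osp(m,2n)=osp(2m_1,2n)$ is the subalgebra of $gl(m,2n)$ of matrices of the form $$\begin{pmatrix}A&B&H&H_1\\ C&-A^T&K&K_1\\ K_1^T&H_1^T&D&E\\ -K^T&-H^T&F&-D^T\end{pmatrix}$$ with $A,B,C$ of size $m_1\times m_1$, $B=-B^T$, $C=-C^T$; $D,E,F$ of size $n\times n$, $E=E^T$, $F=F^T$; and $H,H_1,K,K_1$ of size $m_1\times n$. $\mathcal A=\mathbb C[x_1,\dots,x_m,\theta_1,\dots,\theta_{2n}]$ is the polynomial algebra in bosonic variables $x_i$ and fermionic variables $\theta_p$: $x_ix_j=x_jx_i$, $\theta_p\theta_q=-\theta_q\theta_p$, $x_i\theta_p=\theta_px_i$. Here $\partial_{\theta_p}$ is the odd (left) derivation with $\partial_{\theta_p}(\theta_q)=\delta_{p,q}$, $\partial_{\theta_p}(x_i)=0$.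 For fixed $r$, $gl(m,2n)$ (hence $osp(m,2n)$ by restriction) acts on $\mathcal A$ by: - $E_{i,j}\mapsto -x_j\partial_{x_i}-\delta_{i,j}$ if $i,j\in\overline{1,r}$; $\partial_{x_i}\partial_{x_j}$ if $i\in\overline{1,r}$, $j\in\overline{r+1,m}$; $-x_ix_j$ if $j\in\overline{1,r}$, $i\in\overline{r+1,m}$; $x_i\partial_{x_j}$ if $i,j\in\overline{r+1,m}$; - for $p\in\overline{1,2n}$: $E_{i,m+p}\mapsto\partial_{x_i}\partial_{\theta_p}$ if $i\in\overline{1,r}$, and $x_i\partial_{\theta_p}$ if $i\in\overline{r+1,m}$; - for $p\in\overline{1,2n}$: $E_{m+p,j}\mapsto-\theta_px_j$ if $j\in\overline{1,r}$, and $\theta_p\partial_{x_j}$ if $j\in\overline{r+1,m}$; - $E_{m+p,m+q}\mapsto\theta_p\partial_{\theta_q}$ for $p,q\in\overline{1,2n}$. For $k\in\mathbb Z$, $\mathcal A^r_k$ is the span of all $x^\alpha\theta_{i_1}\cdots\theta_{i_t}$ with $0\le t\le 2n$, $i_1,\dots,i_t\in\overline{1,2n}$, $\alpha\in\mathbb N^m$ and $t-\sum_{i=1}^r\alpha_i+\sum_{j=r+1}^m\alpha_j=k$; it is an $osp(m,2n)$-submodule ($\mathcal A^0_k=0$ for $k<0$). Define operators on $\mathcal A$ $$\Delta=-\sum_{i=1}^r x_i\partial_{x_{m_1+i}}+\sum_{i=r+1}^{m_1}\partial_{x_i}\partial_{x_{m_1+i}}+\sum_{j=1}^n\partial_{\theta_j}\partial_{\theta_{n+j}},$$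 $$\eta=\sum_{i=1}^r x_{m_1+i}\partial_{x_i}+\sum_{i=r+1}^{m_1}x_ix_{m_1+i}+\sum_{j=1}^n\theta_j\theta_{n+j}$$ (multiplication by variables understood), and $\mathcal H^r_k=\{f\in\mathcal A^r_k\mid\Delta(f)=0\}$. $\langle F\rangle$ denotes the $osp(m,2n)$-submodule generated by $F$.
   Formalization: In part 1 with m_1=1, irreducibility of H^0_k is claimed only for k≤n, and the composition series only for m_1>1: for m_1=1, k>n both claims are false (e.g. n=1, k=3: x_1^3 generates a proper submodule of H^0_3). *)

(* Defs.v *)
From HB Require Import structures.
From mathcomp Require Import all_boot all_order all_algebra.
From mathcomp Require Import mpoly.

Set Implicit Arguments.
Unset Strict Implicit.
Unset Printing Implicit Defensive.

Import GRing.Theory.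
Local Open Scope ring_scope.

(* All index sets are 0-based: x_(i+1) is the variable of index i : 'I_p, and
   theta_(s+1) the one of index s : 'I_q. *)

Section SuperPolynomials.

Variables (F : fieldType) (p q : nat).

(* F[x_1..x_p, theta_1..theta_q]: f stands for \sum_S f S * theta_S, where
   theta_S is the product of the theta_s, s \in S, in increasing order.  The
   (pointwise) ring product of finite functions is not the product of this
   algebra; see spmul. *)
Definition superpoly : Type := {ffun {set 'I_q} -> {mpoly F[p]}}.

Implicit Types (f g : superpoly) (S T : {set 'I_q}).

(* theta_S * theta_T = shuffle_sign S T *: theta_(S :|: T) for disjoint S, T *)
Definition shuffle_sign S T : F :=
  (-1) ^+ #|[set u : 'I_q * 'I_q | [&& u.1 \in S, u.2 \in T & (u.2 < u.1)%N]]|.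

Definition spmul f g : superpoly :=
  [ffun T : {set 'I_q} => \sum_(S in powerset T)
     shuffle_sign S (T :\: S) *: (f S * g (T :\: S))].

Definition spmon (a : 'X_{1..p}) : superpoly :=
  [ffun S : {set 'I_q} => if S == set0 then 'X_[a] else 0].

Definition spX (i : 'I_p) : superpoly := spmon U_(i)%MM.

Definition sptheta (s : 'I_q) : superpoly := [ffun S : {set 'I_q} => (S == [set s])%:R].

(* theta_(i_1) ... theta_(i_t) for an arbitrary word [:: i_1; ...; i_t] *)
Definition spword (w : seq 'I_q) : superpoly :=
  foldr (fun s => spmul (sptheta s)) (spmon 0%MM) w.

Definition spdX (i : 'I_p) f : superpoly := [ffun S : {set 'I_q} => (f S)^`M(i)].

(* left derivation: moving theta_s to the front of theta_(s |: S) costs one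
   sign for each element of S below s *)
Definition spdtheta (s : 'I_q) f : superpoly :=
  [ffun S : {set 'I_q} => if s \in S then 0
             else (-1) ^+ #|[set t in S | (t < s)%N]| *: f (s |: S)].

Definition spspan (X : superpoly -> Prop) f : Prop :=
  exists2 l : seq (F * superpoly),
    forall cg, cg \in l -> X cg.2 & f = \sum_(cg <- l) cg.1 *: cg.2.

Definition spimage (u : superpoly -> superpoly) (W : superpoly -> Prop) f : Prop :=
  exists2 g, W g & f = u g.

Definition spzero f : Prop := f = 0.

Definition direct_sum (W U V : superpoly -> Prop) : Prop :=
  (forall f, W f <-> exists g h, [/\ U g, V h & f = g + h]) /\
  (forall f, U f -> V f -> f = 0).

Definition is_subspace (W : superpoly -> Prop) : Prop :=
  W 0 /\ (forall (c : F) f g, W f -> W g -> W (c *: f + g)).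

End SuperPolynomials.

Section Oscillator.

Variables (F : fieldType) (m1 n r : nat).

Local Notation m := (m1 + m1)%N.
Local Notation A := (superpoly F m (n + n)).

Definition in_osp (M : 'M[F]_(m + (n + n))) : Prop :=
  exists (a b c : 'M[F]_m1) (d e f : 'M[F]_n) (h h1 k k1 : 'M[F]_(m1, n)),
    [/\ b = - b^T, c = - c^T, e = e^T, f = f^T &
        M = block_mx
              (block_mx a b c (- a^T))        (block_mx h h1 k k1)
              (block_mx k1^T h1^T (- k^T) (- h^T)) (block_mx d e f (- d^T))].

Definition act_xx (i j : 'I_m) (f : A) : A :=
  if (i < r)%N then
    if (j < r)%N then - spmul (spX F _ j) (spdX i f) - (i == j)%:R *: f
    else spdX i (spdX j f)
  else
    if (j < r)%N then - spmul (spX F _ i) (spmul (spX F _ j) f)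
    else spmul (spX F _ i) (spdX j f).

Definition act_xtheta (i : 'I_m) (s : 'I_(n + n)) (f : A) : A :=
  if (i < r)%N then spdX i (spdtheta s f)
  else spmul (spX F _ i) (spdtheta s f).

Definition act_thetax (s : 'I_(n + n)) (j : 'I_m) (f : A) : A :=
  if (j < r)%N then - spmul (sptheta F _ s) (spmul (spX F _ j) f)
  else spmul (sptheta F _ s) (spdX j f).

Definition act_thetatheta (s t : 'I_(n + n)) (f : A) : A :=
  spmul (sptheta F _ s) (spdtheta t f).

(* action of the matrix unit E_(i,j) of gl(m, 2n) *)
Definition act_unit (i j : 'I_(m + (n + n))) : A -> A :=
  match split i, split j with
  | inl i', inl j' => act_xx i' j'
  | inl i', inr t => act_xtheta i' t
  | inr s, inl j' => act_thetax s j'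
  | inr s, inr t => act_thetatheta s t
  end.

Definition act (M : 'M[F]_(m + (n + n))) (f : A) : A :=
  \sum_i \sum_j M i j *: act_unit i j f.

Definition is_submodule (W : A -> Prop) : Prop :=
  is_subspace W /\ (forall M f, in_osp M -> W f -> W (act M f)).

Definition generated (X : A -> Prop) (f : A) : Prop :=
  forall W, is_submodule W -> (forall g, X g -> W g) -> W f.

Definition irreducible_submodule (W : A -> Prop) : Prop :=
  [/\ is_submodule W,
      exists2 f, W f & f <> 0 &
      forall U, is_submodule U -> (forall f, U f -> W f) ->
        (forall f, U f -> f = 0) \/ (forall f, W f -> U f)].

(* V is a submodule of W and W / V is irreducible; submodules of W / V are
   given by the submodules between V and W *)
Definition irreducible_factor (W V : A -> Prop) : Prop :=
  [/\ is_submodule W, is_submodule V, forall f, V f -> W f,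
      exists2 f, W f & ~ V f &
      forall U, is_submodule U -> (forall f, V f -> U f) ->
        (forall f, U f -> W f) ->
        (forall f, U f -> V f) \/ (forall f, W f -> U f)].

(* the list is decreasing and ends with the zero submodule *)
Fixpoint composition_series (c : seq (A -> Prop)) : Prop :=
  match c with
  | [::] => False
  | W :: c' => match c' with
               | [::] => forall f, W f <-> f = 0
               | V :: _ => irreducible_factor W V /\ composition_series c'
               end
  end.

Definition wdeg (a : 'X_{1..m}) (t : nat) : int :=
  t%:Z - \sum_(i < m | (i < r)%N) (a i)%:Z + \sum_(i < m | (r <= i)%N) (a i)%:Z.

Definition Ak (k : int) : A -> Prop :=
  spspan (fun f => exists (a : 'X_{1..m}) (w : seq 'I_(n + n)),
    [/\ (size w <= n + n)%N, wdeg a (size w) = k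
      & f = spmul (spmon F _ a) (spword F m w)]).

Definition Delta_op (f : A) : A :=
  - (\sum_(i < m1 | (i < r)%N)
       spmul (spX F _ (lshift m1 i)) (spdX (rshift m1 i) f))
  + \sum_(i < m1 | (r <= i)%N) spdX (lshift m1 i) (spdX (rshift m1 i) f)
  + \sum_(j < n) spdtheta (lshift n j) (spdtheta (rshift n j) f).

Definition eta_op (f : A) : A :=
  \sum_(i < m1 | (i < r)%N)
     spmul (spX F _ (rshift m1 i)) (spdX (lshift m1 i) f)
  + \sum_(i < m1 | (r <= i)%N)
     spmul (spX F _ (lshift m1 i)) (spmul (spX F _ (rshift m1 i)) f)
  + \sum_(j < n)
     spmul (sptheta F _ (lshift n j)) (spmul (sptheta F _ (rshift n j)) f).

Definition Hk (k : int) (f : A) : Prop := Ak k f /\ Delta_op f = 0.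

(* x_(i+1) ^ e *)
Definition xpow (i : 'I_m1) (e : nat) : A :=
  spmon F (n + n) (U_(lshift m1 i) *+ e)%MM.

End Oscillator.

(* Main.v *)
(* The operators q_i, p_i (multiplication by x_i and its derivation, exchanged up to sign for
   i < r) are canonical pairs; with i* the index conjugate to i, Delta = sum p_i p_i* +
   sum d_j d_j* and eta = sum q_i q_i* + sum theta_j theta_j* commute with osp(2m1, 2n) and
   generate an sl(2), as [Delta, eta] acts on A_k by k + 1 - N.

   The decompositions are sl(2)-theory, since Delta is always locally nilpotent, and eta is for
   r = m1. When eta is injective it also gives that, for k > N, the intersection of H_k with the
   image of eta is R_k := eta^(k - N) H_(2N - k), and 0 for k <= N.

   If r < m1, let u = x_l, v = x_(m1 + l) be a conjugate pair with r <= l and grade by the weight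
   deg_u - deg_v. A polynomial of weight a >= 0 is congruent modulo eta to u^a h with h free of u
   and v, and a harmonic one divisible by v vanishes. Hence a submodule of H_k with an element of
   weight >= 0 outside the image of eta contains u^k (or x_1^(-k), for k <= 0), and then all of
   H_k of weight >= 0; likewise for v. An element of H_k free of u and v links the two signs, so
   that H_k / R_k is irreducible. There is none exactly when r = m1 - 1 and k > n = N: then the
   part of weight 0 of H_k lies in R_k and the two signs give two distinct factors.

   If r = m1, the operators of osp lowering the degree in the x_(m1 + i), theta_j (j < n) lead
   from any nonzero harmonic polynomial to one free of these variables, from there to
   x_1^(n - k) times all the other theta_j, and back to all of A_k modulo eta. *)

Require Import Defs.
From HB Require Import structures.
From mathcomp Require Import all_boot all_order all_algebra.
From mathcomp Require Import mpoly reals complex.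
From mathcomp Require Import ring lra zify ssrAC.
From Stdlib Require Import Classical.

Set Implicit Arguments.
Unset Strict Implicit.
Unset Printing Implicit Defensive.

Import Order.TTheory GRing.Theory Num.Theory.
Local Open Scope ring_scope.

(** * Creation and annihilation operators *)

(** The constant N comes from Delta eta^s h = s (l - N + s) eta^(s-1) h for h harmonic of level l.
    The scalar vanishes at s = N - l, and with l = 2N - k this is how eta^(k - N) H_(2N - k) lies
    inside H_k. Two facts make a conjugate pair u, v effective. The operator u d_u - v d_v belongs
    to osp, so submodules contain the weight components of their elements. And eta - uv does not
    involve u and v, so a factor uv can be exchanged, modulo eta, for terms free of the pair. When r
    = m1 every pair has one index below r, no such product of two variables occurs in eta, and the
    case needs its own argument. For r = m1 - 1 exactly one pair has both indices outside the first
    r. Without its term, eta becomes locally nilpotent, and on the elements free of u and v it still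
    forms an sl(2) with Delta, with N + 1 in place of N. It then has the surjectivity known from
    finite-dimensional sl(2)-modules, and this is what forces the part of weight 0 of H_k into R_k
    when k > N. *)

Section Fock.

Variables (F : fieldType) (p q : nat).
Local Notation A := (superpoly F p q).
Implicit Types (f g : A) (S : {set 'I_q}) (a : 'X_{1..p}).

Lemma superpolyP f g : (forall S a, (f S)@_a = (g S)@_a) -> f = g.
Proof. by move=> fg; apply/ffunP => S; apply/mpolyP => a. Qed.

Definition mulX (i : 'I_p) f : A := [ffun S : {set 'I_q} => 'X_i * f S].

(** The sign of moving theta_s past the factors of theta_S below it. Being its own inverse, it
    serves for both the product and the derivation. *)
Definition koszul (s : 'I_q) S : F := (-1) ^+ #|[set t in S | (t < s)%N]|.

Definition mulT (s : 'I_q) f : A :=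
  [ffun S : {set 'I_q} => if s \in S then koszul s S *: f (S :\ s) else 0].

Lemma spaddE f g S : (f + g) S = f S + g S. Proof. by rewrite ffunE. Qed.
Lemma spoppE f S : (- f) S = - f S. Proof. by rewrite ffunE. Qed.
Lemma spscaleE (c : F) f S : (c *: f) S = c *: f S. Proof. by rewrite ffunE. Qed.

Lemma mulTE s f S : mulT s f S = if s \in S then koszul s S *: f (S :\ s) else 0.
Proof. by rewrite ffunE. Qed.

Lemma spdthetaE s f S :
  spdtheta s f S = if s \in S then 0 else koszul s S *: f (s |: S).
Proof. by rewrite ffunE. Qed.

(** The action, Delta and eta only multiply by single variables. Replacing [spmul] by [mulX] and
    [mulT] reduces the later computations to commutation relations. *)
Lemma spmulX i f : spmul (spX F q i) f = mulX i f.
Proof.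
apply/ffunP => T; rewrite !ffunE (bigD1 set0) ?powersetE ?sub0set //= big1 ?addr0.
  rewrite ffunE eqxx setD0 /shuffle_sign.
  suff -> : [set u : 'I_q * 'I_q | [&& u.1 \in set0, u.2 \in T & (u.2 < u.1)%N]] = set0.
    by rewrite cards0 scale1r.
  by apply/setP => u; rewrite !inE.
by move=> S /andP[_ /negPf S0]; rewrite ffunE S0 mul0r scaler0.
Qed.

Lemma spmulT s f : spmul (sptheta F p s) f = mulT s f.
Proof.
apply/ffunP => T; rewrite !ffunE; case: ifP => sT; last first.
  rewrite big1 // => S; rewrite powersetE ffunE => /subsetP ST.
  case: eqP => [S1|_]; last by rewrite mul0r scaler0.
  by move: (ST s); rewrite S1 set11 sT => /(_ isT).
rewrite (bigD1 [set s]) ?powersetE ?sub1set //= big1 ?addr0.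
  rewrite ffunE eqxx mul1r; congr (_ *: _); rewrite /shuffle_sign /koszul.
  congr (_ ^+ _); rewrite -(card_imset (mem [set t in T | (t < s)%N]) (f := pair s)); last first.
    by move=> t t' [].
  apply: eq_card => -[x y]; rewrite !inE /=; apply/idP/imsetP.
    by case/and3P => /eqP -> /andP[_ yT] ys; exists y; rewrite // !inE yT ys.
  case=> t; rewrite !inE => /andP[tT ts] [-> ->]; rewrite eqxx tT ts /= andbT.
  by rewrite neq_ltn ts.
by move=> S /andP[_ /negPf S0]; rewrite ffunE S0 mul0r scaler0.
Qed.

Fact mulX_linear i : linear (mulX i).
Proof. by move=> c f g; apply/ffunP => S; rewrite !ffunE mulrDr scalerAr. Qed.
HB.instance Definition _ i := GRing.isLinear.Build F A A *:%R (mulX i) (mulX_linear i).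

Fact mulT_linear s : linear (mulT s).
Proof.
move=> c f g; apply/ffunP => S; rewrite !ffunE; case: ifP => _.
  by rewrite scalerDr !scalerA mulrC.
by rewrite scaler0 addr0.
Qed.
HB.instance Definition _ s := GRing.isLinear.Build F A A *:%R (mulT s) (mulT_linear s).

Fact spdX_linear i : linear (@spdX F p q i).
Proof. by move=> c f g; apply/ffunP => S; rewrite !ffunE linearP. Qed.
HB.instance Definition _ i :=
  GRing.isLinear.Build F A A *:%R (@spdX F p q i) (spdX_linear i).

Fact spdtheta_linear s : linear (@spdtheta F p q s).
Proof.
move=> c f g; apply/ffunP => S; rewrite !ffunE; case: ifP => _.
  by rewrite scaler0 addr0.
by rewrite scalerDr !scalerA mulrC.
Qed.
HB.instance Definition _ s :=
  GRing.isLinear.Build F A A *:%R (@spdtheta F p q s) (spdtheta_linear s).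

Lemma mulXC i j f : mulX i (mulX j f) = mulX j (mulX i f).
Proof. by apply/ffunP => S; rewrite !ffunE mulrCA. Qed.

Lemma spdXC i j f : spdX i (spdX j f) = spdX j (spdX i f).
Proof. by apply/ffunP => S; rewrite !ffunE mderiv_comm. Qed.

Lemma spdX_mulX i j f :
  spdX i (mulX j f) = (i == j)%:R *: f + mulX j (spdX i f).
Proof.
apply/ffunP => S; rewrite !ffunE mderivM mderivX mnm1E (eq_sym j); case: eqP => [->|_].
  have -> : (U_(j) - U_(j) = 0 :> 'X_{1..p})%MM.
    by apply/mnmP => i'; rewrite mnmBE subnn mnm0E.
  by rewrite mpolyX0 !scale1r mul1r.
by rewrite !scale0r mul0r.
Qed.

Lemma mulT_mulX s i f : mulT s (mulX i f) = mulX i (mulT s f).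
Proof.
by apply/ffunP => S; rewrite !ffunE; case: ifP => _; rewrite ?mulr0 // ?ffunE scalerAr.
Qed.

Lemma mulT_spdX s i f : mulT s (spdX i f) = spdX i (mulT s f).
Proof.
by apply/ffunP => S; rewrite !ffunE; case: ifP => _; rewrite ?linear0 // ?ffunE linearZ.
Qed.

Lemma spdtheta_mulX s i f : spdtheta s (mulX i f) = mulX i (spdtheta s f).
Proof.
by apply/ffunP => S; rewrite !ffunE; case: ifP => _; rewrite ?mulr0 // ?ffunE scalerAr.
Qed.

Lemma spdtheta_spdX s i f : spdtheta s (spdX i f) = spdX i (spdtheta s f).
Proof.
by apply/ffunP => S; rewrite !ffunE; case: ifP => _; rewrite ?linear0 // ?ffunE linearZ.
Qed.

Lemma koszulU s t S : t \notin S -> koszul s (t |: S) = (-1) ^+ (t < s)%N * koszul s S.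
Proof.
move=> tS; rewrite /koszul -exprD; congr (_ ^+ _); case: ltnP => ts /=.
  have -> : [set u in t |: S | (u < s)%N] = t |: [set u in S | (u < s)%N].
    by apply/setP => u; rewrite !inE; case: eqP => // ->; rewrite ts.
  by rewrite cardsU1 !inE (negPf tS).
rewrite add0n; apply: eq_card => u; rewrite !inE; case: eqP => // ->.
by rewrite ltnNge ts (negPf tS).
Qed.

Lemma koszulD s t S : koszul s (S :\ t) = (-1) ^+ ((t \in S) && (t < s)%N) * koszul s S.
Proof.
case tS: (t \in S); last first.
  rewrite mul1r; congr koszul; apply/setP => u; rewrite !inE.
  by case: eqP => // ->; rewrite tS.
by rewrite -[in RHS](setD1K tS) koszulU ?setD11 // mulrA -signr_addb addbb mul1r.
Qed.

Lemma koszul_sq s S : koszul s S * koszul s S = 1.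
Proof. by rewrite -expr2 sqrr_sign. Qed.

Lemma ltn_ord_neq (s t : 'I_q) : s != t -> (t < s)%N = ~~ (s < t)%N.
Proof. by move/eqP=> st; case: ltngtP => // /val_inj /esym. Qed.

Lemma spdtheta_mulT s t f :
  spdtheta s (mulT t f) = (s == t)%:R *: f - mulT t (spdtheta s f).
Proof.
apply/ffunP => S; rewrite spaddE spoppE spscaleE !(mulTE, spdthetaE).
have [<-|st] := eqVneq s t.
  rewrite scale1r !inE eqxx; case: ifP => sS /=.
    by rewrite setD1K // koszulD ltnn andbF mul1r scalerA koszul_sq scale1r subrr.
  by rewrite subr0 koszulU ?sS // ltnn mul1r scalerA koszul_sq scale1r setU1K ?sS.
rewrite scale0r add0r !inE st (eq_sym t) (negPf st) /=; case: ifP => sS.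
  by rewrite scaler0 if_same oppr0.
case: ifP => tS; last by rewrite scaler0 oppr0.
rewrite !scalerA koszulU ?sS // koszulD tS /=.
have -> : (s |: S) :\ t = s |: S :\ t.
  by apply/setP => u; rewrite !inE; have [->|//] := eqVneq u s; rewrite st.
rewrite -scaleNr; congr (_ *: _); rewrite (ltn_ord_neq st).
by case: (s < t)%N => /=; ring.
Qed.

Lemma mulTC s t f : mulT s (mulT t f) = - mulT t (mulT s f).
Proof.
apply/ffunP => S; rewrite spoppE !mulTE.
have [<-|st] := eqVneq s t.
  by rewrite !inE eqxx /=; case: ifP => sS; rewrite ?scaler0 oppr0.
rewrite !inE st (eq_sym t) st /=; case: ifP => sS; last by rewrite scaler0 if_same oppr0.
case: ifP => tS; last by rewrite scaler0 oppr0.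
rewrite !scalerA !koszulD sS tS /= -scaleNr.
have -> : S :\ s :\ t = S :\ t :\ s by apply/setP => u; rewrite !inE andbCA.
by congr (_ *: _); rewrite (ltn_ord_neq st); case: (s < t)%N => /=; ring.
Qed.

Lemma spdthetaC s t f : spdtheta s (spdtheta t f) = - spdtheta t (spdtheta s f).
Proof.
apply/ffunP => S; rewrite spoppE !spdthetaE.
have [<-|st] := eqVneq s t.
  by rewrite !inE eqxx /=; case: ifP => sS; rewrite ?scaler0 oppr0.
rewrite !inE (negPf st) (eq_sym t) (negPf st) /=; case: ifP => sS.
  by rewrite scaler0 if_same oppr0.
case: ifP => tS; first by rewrite scaler0 oppr0.
rewrite !scalerA !koszulU ?sS ?tS //= -scaleNr.
have -> : s |: (t |: S) = t |: (s |: S) by rewrite setUCA.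
by congr (_ *: _); rewrite (ltn_ord_neq st); case: (s < t)%N => /=; ring.
Qed.

(* A multirule keyed on u: rewriting with it avoids the slow inference of the
   canonical {linear A -> A} structures. *)
Definition linear_rules (u : A -> A) : Type :=
  (forall f g, u (f + g) = u f + u g) * (forall f, u (- f) = - u f) *
  (forall c f, u (c *: f) = c *: u f) * (u 0 = 0) *
  (forall I (s : seq I) (P : pred I) (G : I -> A),
    u (\sum_(i <- s | P i) G i) = \sum_(i <- s | P i) u (G i)).

Lemma linear_rulesP (u : A -> A) : linear u -> linear_rules u.
Proof.
move=> lu; pose v : {linear A -> A} := HB.pack u (GRing.isLinear.Build F A A *:%R u lu).
by rewrite -[u]/(v : A -> A); do ?split=> *;
  rewrite (linearD, linearN, linearZ, linear0, linear_sum).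
Qed.

Definition mulX_lin i : linear_rules (mulX i) := linear_rulesP (mulX_linear i).
Definition mulT_lin s : linear_rules (mulT s) := linear_rulesP (mulT_linear s).
Definition spdX_lin i : linear_rules (@spdX F p q i) := linear_rulesP (spdX_linear i).
Definition spdtheta_lin s : linear_rules (@spdtheta F p q s) :=
  linear_rulesP (spdtheta_linear s).

End Fock.

(** * Monomials and gradings *)

Section Monomials.

Variables (F : numFieldType) (p q : nat).
Local Notation A := (superpoly F p q).
Implicit Types (f g : A) (S : {set 'I_q}) (a : 'X_{1..p}) (W : A -> Prop).

Definition bas a S : A := [ffun T : {set 'I_q} => if T == S then 'X_[a] else 0].

Lemma basE a S T b : (bas a S T)@_b = ((T == S) && (a == b))%:R.
Proof. by rewrite ffunE; case: eqP => _; rewrite ?mcoeffX ?mcoeff0. Qed.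

Lemma mcoeff_mulX i f S a :
  (mulX i f S)@_a = if (0 < a i)%N then (f S)@_(a - U_(i)) else 0.
Proof.
rewrite ffunE mpoly_mulC; case: ifP => [ai|/negbT]; last rewrite -eqn0Ngt => /eqP ai.
  have le : (U_(i) <= a)%MM by apply/mnm_lepP => j; rewrite mnm1E; case: eqP => // <-.
  by rewrite -[LHS](congr1 (fun b => (_ * 'X_i)@_b) (submK le)) addmC mcoeffMX.
apply: memN_msupp_eq0; rewrite (perm_mem (msuppMX _ _)); apply/mapP => -[b _ ab].
by move: ai; rewrite ab mnmDE mnm1E eqxx.
Qed.

Lemma mcoeff_spdX i f S a : (spdX i f S)@_a = (f S)@_(a + U_(i)) *+ (a i).+1.
Proof. by rewrite ffunE mcoeff_deriv. Qed.

Lemma mcoeff_mulT s f S a :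
  (mulT s f S)@_a = if s \in S then koszul F s S * (f (S :\ s))@_a else 0.
Proof. by rewrite mulTE; case: ifP => _; rewrite ?mcoeffZ ?mcoeff0. Qed.

Lemma mcoeff_spdtheta s f S a :
  (spdtheta s f S)@_a = if s \in S then 0 else koszul F s S * (f (s |: S))@_a.
Proof. by rewrite spdthetaE; case: ifP => _; rewrite ?mcoeffZ ?mcoeff0. Qed.

Lemma mcoeffspD f g S a : ((f + g) S)@_a = (f S)@_a + (g S)@_a.
Proof. by rewrite spaddE mcoeffD. Qed.
Lemma mcoeffspN f S a : ((- f) S)@_a = - (f S)@_a.
Proof. by rewrite spoppE mcoeffN. Qed.
Lemma mcoeffspZ c f S a : ((c *: f) S)@_a = c * (f S)@_a.
Proof. by rewrite spscaleE mcoeffZ. Qed.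
Lemma mcoeffsp0 S a : ((0 : A) S)@_a = 0.
Proof. by rewrite ffunE mcoeff0. Qed.

Lemma mcoeffsp_sum (I : Type) (s : seq I) (P : pred I) (G : I -> A) S a :
  ((\sum_(i <- s | P i) G i) S)@_a = \sum_(i <- s | P i) (G i S)@_a.
Proof. by rewrite sum_ffunE raddf_sum. Qed.

Lemma koszul_neq0 s S : koszul F s S != 0.
Proof. by rewrite signr_eq0. Qed.

Lemma mulX_bas i a S : mulX i (bas a S) = bas (a + U_(i)) S.
Proof.
apply: superpolyP => T b; rewrite mcoeff_mulX !basE; case: ifP => [bi|/negbT bi].
  congr (_ && _)%:R; apply/eqP/eqP => [->|<-]; last by rewrite addmK.
  by rewrite submK //; apply/mnm_lepP => j; rewrite mnm1E; case: eqP => // <-.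
case: eqP => //= _; case: eqP => //= ab; case/negP: bi.
by rewrite -ab mnmDE mnm1E eqxx addn1.
Qed.

Lemma mulT_bas s a S : s \notin S -> mulT s (bas a S) = koszul F s S *: bas a (s |: S).
Proof.
move=> sS; apply: superpolyP => T b; rewrite mcoeff_mulT mcoeffspZ !basE.
case: ifP => sT.
  have [->|TS] := eqVneq T (s |: S).
    by rewrite setU1K // eqxx koszulU // ltnn mul1r.
  case: eqP => TS'; last by rewrite !mulr0.
  by case/eqP: TS; rewrite -TS' setD1K.
by case: eqP => TS; rewrite ?mulr0 //; move: sT; rewrite TS setU11.
Qed.

Lemma subspaceD W f g : is_subspace W -> W f -> W g -> W (f + g).
Proof. by case=> _ Wl Wf Wg; rewrite -[f]scale1r; apply: Wl. Qed.

Lemma subspaceZ W c f : is_subspace W -> W f -> W (c *: f).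
Proof. by case=> W0 Wl Wf; rewrite -[_ *: _]addr0; apply: Wl. Qed.

Lemma subspaceN W f : is_subspace W -> W f -> W (- f).
Proof. by move=> sW Wf; rewrite -scaleN1r; apply: subspaceZ. Qed.

Lemma subspaceB W f g : is_subspace W -> W f -> W g -> W (f - g).
Proof. by move=> sW Wf Wg; apply: subspaceD => //; apply: subspaceN. Qed.

Lemma subspaceZK W c f : is_subspace W -> c != 0 -> W (c *: f) -> W f.
Proof. by move=> sW c0 Wf; rewrite -[f](scalerK c0); apply: subspaceZ. Qed.

Lemma subspace_sum W (I : Type) (s : seq I) (P : pred I) (G : I -> A) :
  is_subspace W -> (forall i, P i -> W (G i)) -> W (\sum_(i <- s | P i) G i).
Proof.
move=> sW WG; apply: (big_ind W) => //; first by case: sW.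
by move=> f g; apply: subspaceD.
Qed.

Lemma sum_bas f : f = \sum_S \sum_(a <- msupp (f S)) (f S)@_a *: bas a S.
Proof.
apply: superpolyP => S a; rewrite mcoeffsp_sum (bigD1 S) //= [X in _ + X]big1 ?addr0; last first.
  move=> T TS; rewrite mcoeffsp_sum big1 // => b _.
  by rewrite mcoeffspZ basE eq_sym (negPf TS) mulr0.
rewrite mcoeffsp_sum [f S in LHS]mpolyE raddf_sum /=; apply: eq_bigr => b _.
by rewrite mcoeffspZ basE eqxx mcoeffZ mcoeffX.
Qed.

Lemma subspace_span W f :
  is_subspace W -> (forall S a, (f S)@_a != 0 -> W (bas a S)) -> W f.
Proof.
move=> sW Wb; rewrite [f]sum_bas; apply: subspace_sum => // S _.
rewrite big_seq; apply: subspace_sum => // a af; apply: subspaceZ => //.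
by apply: Wb; rewrite -mcoeff_msupp.
Qed.

(** Integer weights of the x_i and of the theta_s. The same machinery serves for the level [lev],
    for the weight [wuv] of a pair, and for the statistics of the case r = m1. *)
Definition grading : Type := (('I_p -> int) * ('I_q -> int))%type.
Implicit Types (w : grading) (k : int).

Definition grade w S a : int := \sum_i w.1 i *+ a i + \sum_(s in S) w.2 s.

Lemma gradeX w S a i : grade w S (a + U_(i))%MM = grade w S a + w.1 i.
Proof.
rewrite /grade addrAC; congr (_ + _); under eq_bigr do rewrite mnmDE mulrnDr.
rewrite big_split /=; congr (_ + _); rewrite (bigD1 i) //= mnm1E eqxx big1 ?addr0 // => j ij.
by rewrite mnm1E eq_sym (negPf ij).
Qed.

Lemma gradeT w S a s : s \notin S -> grade w (s |: S) a = grade w S a + w.2 s.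
Proof. by move=> sS; rewrite /grade big_setU1 //= [w.2 s + _]addrC addrA. Qed.

Definition ofdeg w k f : Prop := forall S a, (f S)@_a != 0 -> grade w S a = k.

Definition component w k f : A :=
  [ffun S : {set 'I_q} => \sum_(a <- msupp (f S) | grade w S a == k) (f S)@_a *: 'X_[a]].

Lemma mcoeff_component w k f S a :
  (component w k f S)@_a = if grade w S a == k then (f S)@_a else 0.
Proof.
rewrite ffunE raddf_sum big_mkcond /=.
have [aS|aS] := boolP (a \in msupp (f S)); last first.
  rewrite (memN_msupp_eq0 aS) if_same.
  rewrite big_seq big1 // => b bS; case: ifP => // _; rewrite mcoeffZ mcoeffX.
  by case: eqP => [ba|_]; [rewrite -ba bS in aS|rewrite mulr0].
rewrite (bigD1_seq a) ?msupp_uniq //= big1 ?addr0 => [|b ba].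
  by case: ifP => // _; rewrite mcoeffZ mcoeffX eqxx mulr1.
by case: ifP => // _; rewrite mcoeffZ mcoeffX (negPf ba) mulr0.
Qed.

Lemma component_linear w k : linear (component w k).
Proof.
move=> c f g; apply: superpolyP => S a.
rewrite mcoeff_component !(mcoeffspD, mcoeffspZ, mcoeff_component).
by case: ifP => //; rewrite mulr0 addr0.
Qed.
HB.instance Definition _ w k :=
  GRing.isLinear.Build F A A *:%R (component w k) (component_linear w k).

Definition component_lin w k : linear_rules (component w k) :=
  linear_rulesP (component_linear w k).

Lemma component_ofdeg w k f : ofdeg w k (component w k f).
Proof.
by move=> S a; rewrite mcoeff_component; case: ifP => [/eqP //|_ /eqP].
Qed.

Lemma component_id w k f : ofdeg w k f -> component w k f = f.
Proof.
move=> wf; apply: superpolyP => S a; rewrite mcoeff_component.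
case: eqP => // wS; have [->//|/wf] := eqVneq (f S)@_a 0.
by move/wS.
Qed.

Lemma component_neq w k l f : ofdeg w k f -> l != k -> component w l f = 0.
Proof.
move=> wf lk; apply: superpolyP => S a; rewrite mcoeff_component mcoeffsp0.
case: eqP => // wS; have [//|/wf wS'] := eqVneq (f S)@_a 0.
by move: lk; rewrite -wS wS' eqxx.
Qed.

Lemma ofdeg0 w k : ofdeg w k (0 : A).
Proof. by move=> S a; rewrite mcoeffsp0 eqxx. Qed.

Lemma ofdeg_subspace w k : is_subspace (@ofdeg w k).
Proof.
split=> [|c f g wf wg]; first exact: ofdeg0.
rewrite -(component_id wf) -(component_id wg) -linearP; exact: component_ofdeg.
Qed.

Lemma ofdegD w k f g : ofdeg w k f -> ofdeg w k g -> ofdeg w k (f + g).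
Proof. by apply: subspaceD; apply: ofdeg_subspace. Qed.

Lemma ofdegZ w k c f : ofdeg w k f -> ofdeg w k (c *: f).
Proof. by apply: subspaceZ; apply: ofdeg_subspace. Qed.

Lemma ofdegN w k f : ofdeg w k f -> ofdeg w k (- f).
Proof. by apply: subspaceN; apply: ofdeg_subspace. Qed.

Lemma ofdegB w k f g : ofdeg w k f -> ofdeg w k g -> ofdeg w k (f - g).
Proof. by apply: subspaceB; apply: ofdeg_subspace. Qed.

Lemma ofdeg_sum w k (I : Type) (s : seq I) (P : pred I) (G : I -> A) :
  (forall i, P i -> ofdeg w k (G i)) -> ofdeg w k (\sum_(i <- s | P i) G i).
Proof. by apply: subspace_sum; apply: ofdeg_subspace. Qed.

Lemma mnmU_split i a : {b | a = (b + U_(i))%MM} + {a i = 0%N}.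
Proof.
case: (posnP (a i)) => [|ai]; [by right | left; exists (a - U_(i))%MM].
by rewrite submK //; apply/mnm_lepP => j; rewrite mnm1E; case: eqP => // <-.
Qed.

Lemma mcoeff_mulXU i f S a : (mulX i f S)@_(a + U_(i)) = (f S)@_a.
Proof. by rewrite mcoeff_mulX mnmDE mnm1E eqxx addn1 /= addmK. Qed.

Lemma component_mulX w k i f :
  component w (k + w.1 i) (mulX i f) = mulX i (component w k f).
Proof.
apply: superpolyP => S a; rewrite mcoeff_component.
have [[b ->]|ai] := mnmU_split i a.
  by rewrite !mcoeff_mulXU mcoeff_component gradeX (inj_eq (addIr _)).
by rewrite !mcoeff_mulX ai if_same.
Qed.

Lemma component_spdX w k i f :
  component w (k - w.1 i) (spdX i f) = spdX i (component w k f).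
Proof.
apply: superpolyP => S a; rewrite !(mcoeff_component, mcoeff_spdX) gradeX.
by rewrite eq_sym subr_eq eq_sym; case: eqP => //; rewrite mul0rn.
Qed.

Lemma component_mulT w k s f :
  component w (k + w.2 s) (mulT s f) = mulT s (component w k f).
Proof.
apply: superpolyP => S a; rewrite !(mcoeff_component, mcoeff_mulT).
case sS: (s \in S); last by rewrite if_same.
rewrite -{1}(setD1K sS) gradeT ?setD11 // (inj_eq (addIr _)).
by case: ifP => // _; rewrite mulr0.
Qed.

Lemma component_spdtheta w k s f :
  component w (k - w.2 s) (spdtheta s f) = spdtheta s (component w k f).
Proof.
apply: superpolyP => S a; rewrite !(mcoeff_component, mcoeff_spdtheta).
case sS: (s \in S); first by rewrite if_same.
rewrite gradeT ?sS // eq_sym subr_eq eq_sym.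
by case: ifP => // _; rewrite mulr0.
Qed.

Lemma ofdeg_mulX w k i f : ofdeg w k f -> ofdeg w (k + w.1 i) (mulX i f).
Proof. by move/component_id <-; rewrite -component_mulX; apply: component_ofdeg. Qed.

Lemma ofdeg_spdX w k i f : ofdeg w k f -> ofdeg w (k - w.1 i) (spdX i f).
Proof. by move/component_id <-; rewrite -component_spdX; apply: component_ofdeg. Qed.

Lemma ofdeg_mulT w k s f : ofdeg w k f -> ofdeg w (k + w.2 s) (mulT s f).
Proof. by move/component_id <-; rewrite -component_mulT; apply: component_ofdeg. Qed.

Lemma ofdeg_spdtheta w k s f : ofdeg w k f -> ofdeg w (k - w.2 s) (spdtheta s f).
Proof. by move/component_id <-; rewrite -component_spdtheta; apply: component_ofdeg. Qed.

Definition euler w f : A :=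
  \sum_i (w.1 i)%:~R *: mulX i (spdX i f) +
  \sum_s (w.2 s)%:~R *: mulT s (spdtheta s f).

Lemma mcoeff_mulX_spdX i f S a : (mulX i (spdX i f) S)@_a = (a i)%:R * (f S)@_a.
Proof.
have [[b ->]|ai] := mnmU_split i a.
  by rewrite mcoeff_mulXU mcoeff_spdX mnmDE mnm1E eqxx addn1 mulr_natl.
by rewrite mcoeff_mulX ai mul0r.
Qed.

Lemma mcoeff_mulT_spdtheta s f S a :
  (mulT s (spdtheta s f) S)@_a = (s \in S)%:R * (f S)@_a.
Proof.
rewrite mcoeff_mulT; case: ifP => sS; last by rewrite mul0r.
by rewrite mcoeff_spdtheta setD11 setD1K // koszulD ltnn andbF mul1r mulrA koszul_sq.
Qed.

Lemma mcoeff_euler w f S a : (euler w f S)@_a = (grade w S a)%:~R * (f S)@_a.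
Proof.
rewrite mcoeffspD !mcoeffsp_sum /grade rmorphD !rmorph_sum mulrDl !mulr_suml /=.
congr (_ + _); first apply: eq_bigr => i _.
  by rewrite mcoeffspZ mcoeff_mulX_spdX rmorphMn /= mulr_natl mulrnAr mulrnAl.
rewrite [RHS]big_mkcond /=; apply: eq_bigr => s _.
by rewrite mcoeffspZ mcoeff_mulT_spdtheta; case: (s \in S); rewrite ?mul1r // mul0r mulr0.
Qed.

Lemma euler_ofdeg w k f : ofdeg w k f -> euler w f = k%:~R *: f.
Proof.
move=> wf; apply: superpolyP => S a; rewrite mcoeff_euler mcoeffspZ.
by have [->|/wf ->//] := eqVneq (f S)@_a 0; rewrite !mulr0.
Qed.

Definition degs w f : seq int :=
  undup [seq grade w T a | T <- enum {: {set 'I_q}}, a <- msupp (f T)].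

Lemma mem_degs w f S a : (f S)@_a != 0 -> grade w S a \in degs w f.
Proof.
move=> fSa; rewrite mem_undup; apply/allpairsPdep; exists S, a.
by rewrite mem_enum mcoeff_msupp.
Qed.

Lemma sum_component w (ks : seq int) f :
  uniq ks -> (forall S a, (f S)@_a != 0 -> grade w S a \in ks) ->
  f = \sum_(k <- ks) component w k f.
Proof.
move=> uks fks; apply: superpolyP => S a; rewrite mcoeffsp_sum.
under eq_bigr do rewrite mcoeff_component.
have [->|/fks Sks] := eqVneq (f S)@_a 0.
  by rewrite big1 // => k _; rewrite if_same.
by rewrite (bigD1_seq _ Sks) //= eqxx big1 ?addr0 // => k; rewrite eq_sym => /negPf ->.
Qed.

(** [euler w] is diagonal with the degree as eigenvalue. Subtracting the eigenvalue k0 kills the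
    component of degree k0 and multiplies the others by nonzero scalars, so the degrees are removed
    one at a time. *)
Lemma component_in w W : is_subspace W -> (forall f, W f -> W (euler w f)) ->
  forall f k, W f -> W (component w k f).
Proof.
move=> sW We f.
suff: forall ks, uniq ks -> (forall S a, (f S)@_a != 0 -> grade w S a \in ks) ->
  W f -> forall k, W (component w k f).
  by move=> H k Wf; apply: (H (degs w f)); rewrite ?undup_uniq //; apply: mem_degs.
move=> ks; elim: ks f => [|k0 ks IH] f /=.
  move=> _ f0 _ k; suff -> : f = 0 by rewrite linear0; case: sW.
  by apply: superpolyP => S a; rewrite mcoeffsp0; apply/eqP/negPn/negP => /f0.
case/andP=> k0ks uks fks Wf; pose g := euler w f - k0%:~R *: f.
have gE S a : (g S)@_a = (grade w S a - k0)%:~R * (f S)@_a.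
  by rewrite mcoeffspD mcoeffspN mcoeff_euler mcoeffspZ rmorphB mulrBl.
have Wg k : W (component w k g).
  apply: IH => //; last by apply: subspaceB; [|exact: We|exact: subspaceZ].
  move=> S a; rewrite gE mulf_eq0 intr_eq0 subr_eq0 negb_or => /andP[Sk0 /fks].
  by rewrite inE (negPf Sk0).
have Wk k : k != k0 -> W (component w k f).
  move=> kk0; apply: (@subspaceZK W (k - k0)%:~R) => //.
    by rewrite intr_eq0 subr_eq0.
  suff -> : (k - k0)%:~R *: component w k f = component w k g by [].
  apply: superpolyP => S a; rewrite mcoeffspZ !mcoeff_component gE.
  by case: eqP => [->//|_]; rewrite mulr0.
move=> k; have [->|/Wk//] := eqVneq k k0.
(* The component of degree k0, lost in [g], is what remains of f once the others are removed. *)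
have -> : component w k0 f = f - \sum_(k <- ks) component w k f.
  rewrite {2}(@sum_component w (k0 :: ks) f) ?big_cons ?addrK //=.
  by rewrite k0ks.
apply: subspaceB => //; rewrite big_seq; apply: subspace_sum => // l lks.
by apply: Wk; apply: contraNneq k0ks => <-.
Qed.

Lemma subspace_components w W f : is_subspace W ->
  (forall k, W (component w k f)) -> W f.
Proof.
move=> sW Wf; rewrite (@sum_component w (degs w f) f) ?undup_uniq //.
  by apply: subspace_sum.
exact: mem_degs.
Qed.

Lemma mulX_inj i f : mulX i f = 0 -> f = 0.
Proof.
move=> f0; apply: superpolyP => S a.
by rewrite -(mcoeff_mulXU i) f0 !mcoeffsp0.
Qed.

Lemma spdX_eq0 i f S a : spdX i f = 0 -> (f S)@_a != 0 -> a i = 0%N.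
Proof.
move=> f0; have [[b ->]|//] := mnmU_split i a.
have := mcoeff_spdX i f S b; rewrite f0 mcoeffsp0 => /eqP; rewrite eq_sym.
by rewrite mulrn_eq0 /= => /eqP ->; rewrite eqxx.
Qed.

Lemma spdtheta_eq0 s f S a : spdtheta s f = 0 -> (f S)@_a != 0 -> s \notin S.
Proof.
move=> f0; apply: contraNN => sS; have := mcoeff_spdtheta s f (S :\ s) a.
rewrite f0 mcoeffsp0 setD11 setD1K // => /eqP; rewrite eq_sym mulf_eq0.
by rewrite (negPf (koszul_neq0 _ _)).
Qed.

Lemma mulT_eq0 s f S a : mulT s f = 0 -> (f S)@_a != 0 -> s \in S.
Proof.
move=> f0; apply: contraNT => sS; have := mcoeff_mulT s f (s |: S) a.
rewrite f0 mcoeffsp0 setU11 setU1K // => /eqP; rewrite eq_sym mulf_eq0.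
by rewrite (negPf (koszul_neq0 _ _)).
Qed.

(** The existential form, monomial by monomial, is stable under sums ([lowersD]) and insensitive to
    cancellations in T f. *)
Definition lowers (m : {set 'I_q} -> 'X_{1..p} -> nat) (T : A -> A) : Prop :=
  forall f S a, (T f S)@_a != 0 ->
  exists S' a', (f S')@_a' != 0 /\ (m S a < m S' a')%N.

(** The substitute for the search of a highest weight vector: some T c that does not kill the
    current element is applied as long as there is one, and the bound [d] on the statistic makes
    this stop at a nonzero element. *)
Lemma lowers_exhaust m (I : finType) (C : pred I) (T : I -> A -> A) (P : A -> Prop) :
  (forall c, C c -> lowers m (T c)) -> (forall c f, C c -> P f -> P (T c f)) ->
  forall f, P f -> f <> 0 ->
  exists g, [/\ P g, g <> 0 & forall c, C c -> T c g = 0].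
Proof.
move=> Tm PT f; have [d fd] : exists d, forall S a, (f S)@_a != 0 -> (m S a < d)%N.
  exists (\max_(n <- [seq m T a | T <- enum {: {set 'I_q}}, a <- msupp (f T)]) n).+1.
  move=> S a fSa; rewrite ltnS; apply: leq_bigmax_seq => //.
  by apply/allpairsPdep; exists S, a; rewrite mem_enum mcoeff_msupp.
elim: d => [|d IH] in f fd *.
  move=> _ []; apply: superpolyP => S a; rewrite mcoeffsp0.
  by apply/eqP/negPn/negP => /fd.
move=> Pf f0; have [/existsP[c /andP[Cc cf]]|/existsPn Cf] :=
  boolP [exists c, C c && (T c f != 0)].
  apply: (IH (T c f)) => [S a||]; [|exact: PT|exact/eqP].
  case/(Tm c Cc) => S' [a' [/fd]]; rewrite ltnS => Sd; move/leq_trans; exact.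
exists f; split=> // c Cc; apply/eqP/negPn/negP => cf.
by have := Cf c; rewrite Cc cf.
Qed.

Lemma component_shift w c (T : A -> A) k f : linear T ->
  (forall l g, ofdeg w l g -> ofdeg w (l + c) (T g)) ->
  component w (k + c) (T f) = T (component w k f).
Proof.
move=> /linear_rulesP Tl Tw.
have fE := sum_component (undup_uniq _) (@mem_degs w f).
have TE l : component w (k + c) (T (component w l f)) =
    if l == k then T (component w k f) else 0.
  case: eqP => [->|/eqP lk]; first by rewrite component_id //; apply/Tw/component_ofdeg.
  apply: component_neq; first exact/Tw/component_ofdeg.
  by rewrite (inj_eq (addIr _)) eq_sym.
rewrite {1}fE Tl component_lin; under eq_bigr => l _ do rewrite TE.
have [kf|kf] := boolP (k \in degs w f).
  by rewrite (bigD1_seq k) ?undup_uniq //= eqxx big1 ?addr0 // => l /negPf ->.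
rewrite big_seq big1 => [|l lf]; last by case: eqP => // lk; rewrite -lk lf in kf.
rewrite (_ : component w k f = 0) ?Tl // fE component_lin big_seq big1 // => l lf.
apply: component_neq; first exact: component_ofdeg.
by apply: contraNneq kf => ->.
Qed.

Lemma spdX_bas i a S : spdX i (bas (a + U_(i)) S) = (a i).+1%:R *: bas a S.
Proof.
apply: superpolyP => T b; rewrite mcoeff_spdX mcoeffspZ !basE.
rewrite (inj_eq (@addIm _ _)).
case: eqP => //= _; rewrite ?mulr0 ?mul0rn //.
by case: eqP => [->|]; rewrite ?mulr0 ?mul0rn ?mulr1.
Qed.

Lemma bas_neq0 a S : bas a S <> 0.
Proof.
move/(congr1 (fun f : A => (f S)@_a))/eqP.
by rewrite basE !eqxx mcoeffsp0 oner_eq0.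
Qed.

Lemma spdX_bas0 i a S : a i = 0%N -> spdX i (bas a S) = 0.
Proof.
move=> ai; apply: superpolyP => T b; rewrite mcoeff_spdX basE mcoeffsp0.
have [ab|_] := eqVneq a (b + U_(i))%MM; last by rewrite andbF mul0rn.
by move: ai; rewrite ab mnmDE mnm1E eqxx addn1.
Qed.

Lemma iter_mulX_bas i s a S : iter s (mulX i) (bas a S) = bas (a + U_(i) *+ s)%MM S.
Proof.
elim: s => [|s IH]; first by rewrite mulm0n addm0.
by rewrite iterS IH mulX_bas mulmSr addmA.
Qed.

Lemma iter_lin (T : A -> A) s : linear T -> linear_rules (iter s T).
Proof.
move=> Tl; apply: linear_rulesP => c f g.
by elim: s => //= s ->; rewrite Tl.
Qed.

Lemma iter_comm (T T' : A -> A) s f : (forall g, T (T' g) = T' (T g)) ->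
  T (iter s T' f) = iter s T' (T f).
Proof. by move=> TT'; elim: s => //= s <-. Qed.

Lemma spdX_iter_mulX i s f : spdX i (iter s.+1 (mulX i) f) =
  s.+1%:R *: iter s (mulX i) f + iter s.+1 (mulX i) (spdX i f).
Proof.
elim: s => [|s IH]; first by rewrite /= spdX_mulX eqxx.
rewrite iterS spdX_mulX eqxx IH !mulX_lin addrA; congr (_ + _).
by rewrite -iterS -scalerDl -natrD add1n.
Qed.

Lemma spdX_iter_mulX0 i s f : spdX i f = 0 ->
  spdX i (iter s.+1 (mulX i) f) = s.+1%:R *: iter s (mulX i) f.
Proof.
move=> f0; rewrite spdX_iter_mulX f0 (iter_lin _ (mulX_linear i)) addr0 //.
Qed.

Lemma iter_mulX_inj i s f : iter s (mulX i) f = 0 -> f = 0.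
Proof. by elim: s => //= s IH /mulX_inj /IH. Qed.

Lemma mcoeff_iter_mulX i s f S a : (a i < s)%N -> (iter s (mulX i) f S)@_a = 0.
Proof.
elim: s => // s IH in a * => /=; have [[b ->]|ai _] := mnmU_split i a.
  by rewrite mcoeff_mulXU mnmDE mnm1E eqxx addn1 ltnS; apply: IH.
by rewrite mcoeff_mulX ai.
Qed.

Lemma ofdeg_iter_mulX w k i s f :
  ofdeg w k f -> ofdeg w (k + w.1 i *+ s) (iter s (mulX i) f).
Proof.
move=> fk; elim: s => [|s IH]; first by rewrite mulr0n addr0.
by rewrite mulrSr addrA iterS; apply: ofdeg_mulX.
Qed.

Lemma component_iter_mulX w k i s f :
  component w (k + w.1 i *+ s) (iter s (mulX i) f) = iter s (mulX i) (component w k f).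
Proof.
elim: s => [|s IH]; first by rewrite mulr0n addr0.
by rewrite mulrSr addrA iterS component_mulX IH.
Qed.

Lemma spdX_mulX_neq i j f : i != j -> spdX i (mulX j f) = mulX j (spdX i f).
Proof. by move=> /negPf ij; rewrite spdX_mulX ij scale0r add0r. Qed.

Lemma lowers_spdX (stat : {set 'I_q} -> 'X_{1..p} -> nat) i :
  (forall S b, (stat S b < stat S (b + U_(i))%MM)%N) -> lowers stat (spdX i).
Proof.
move=> wi f S b Sb; exists S, (b + U_(i))%MM; split=> //.
by move: Sb; rewrite mcoeff_spdX; apply: contraNneq => ->; rewrite mul0rn.
Qed.

Lemma lowers_spdtheta (stat : {set 'I_q} -> 'X_{1..p} -> nat) s :
  (forall S b, s \notin S -> (stat S b < stat (s |: S) b)%N) -> lowers stat (spdtheta s).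
Proof.
move=> ws f S b; rewrite mcoeff_spdtheta; case: ifP; rewrite ?eqxx // => /negbT sS Sb.
by exists (s |: S), b; split; [apply: contraNneq Sb => ->; rewrite mulr0|exact: ws].
Qed.

Lemma spdtheta_bas0 s b S : s \notin S -> spdtheta s (bas b S) = 0.
Proof.
move=> sS; apply: superpolyP => B c; rewrite mcoeff_spdtheta basE mcoeffsp0.
case: ifP => // _; case: eqP => [BS|_]; last by rewrite mulr0.
by move: sS; rewrite -BS setU11.
Qed.

Lemma lowersD stat T1 T2 : lowers stat T1 -> lowers stat T2 -> lowers stat (fun f => T1 f + T2 f).
Proof.
move=> l1 l2 f S b; rewrite mcoeffspD.
by have [->|/l1 //] := eqVneq (T1 f S)@_b 0; rewrite add0r => /l2.
Qed.

Lemma lowers_sum stat (I : finType) (P : pred I) (T : I -> A -> A) :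
  (forall c, P c -> lowers stat (T c)) -> lowers stat (fun f => \sum_(c | P c) T c f).
Proof.
move=> lT f S b; rewrite mcoeffsp_sum => sb.
have [c /andP[Pc Tb]] : exists c, P c && ((T c f S)@_b != 0).
  apply/existsP; apply: contraNT sb; rewrite negb_exists => /forallP Tb.
  by rewrite big1 // => c Pc; apply/eqP; have := Tb c; rewrite Pc negbK.
exact: lT Tb.
Qed.

Lemma lowers_nilpotent stat T : linear T -> lowers stat T -> forall f, exists t, iter t T f = 0.
Proof.
move=> Tl lT f; pose d := (\max_(t <- [seq stat B b | B <- enum {: {set 'I_q}},
                                            b <- msupp (f B)]) t).+1.
suff H t : forall S b, (iter t T f S)@_b != 0 -> (stat S b + t < d)%N.
  exists d; apply: superpolyP => S b; rewrite mcoeffsp0; apply/eqP/negPn/negP => /H.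
  by rewrite ltnNge leq_addl.
elim: t => [|t IH] S b /=.
  rewrite addn0 ltnS => fSb; apply: leq_bigmax_seq => //.
  by apply/allpairsPdep; exists S, b; rewrite mem_enum mcoeff_msupp.
by case/lT => S' [b' [/IH]]; lia.
Qed.

Lemma neq0_mcoeff f :
  f <> 0 -> exists S b, (f S)@_b != 0.
Proof.
move=> f0; apply: NNPP => nf; apply: f0; apply: superpolyP => S b.
by rewrite mcoeffsp0; apply/eqP/negPn/negP => fb; apply: nf; exists S, b.
Qed.

(** An operator of negative degree lowers the grade itself. The shift by B makes the grade a natural
    number, as the statistic of [lowers] must be. *)
Lemma lowers_ofdeg w (B c : int) (T : A -> A) :
  (forall S b, 0 <= grade w S b + B) -> 0 < c -> linear T ->
  (forall k f, ofdeg w k f -> ofdeg w (k - c) (T f)) ->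
  lowers (fun S b => absz (grade w S b + B)) T.
Proof.
move=> wB c0 lT Tw f S b fb; set k := grade w S b.
have : component w (k + c) f <> 0.
  move=> f0; move/eqP: fb; apply.
  have := component_shift (k + c) f lT Tw; rewrite f0 (linear_rulesP lT) addrK.
  move/(congr1 (fun g : A => (g S)@_b)).
  by rewrite mcoeffsp0 mcoeff_component eqxx.
case/neq0_mcoeff => S' [b']; rewrite mcoeff_component.
case: ifP => [/eqP gE fb'|_]; last by rewrite eqxx.
exists S', b'; split=> //; have := wB S b; have := wB S' b'; rewrite gE -/k; lia.
Qed.

End Monomials.

(** * Representations of sl(2) *)

Section Sl2.

Variables (F : numFieldType) (V : lmodType F) (d e : V -> V).
(** [lvl] and N are abstract because the section is used twice: for the levels of the whole algebra,
    and for the elements free of one pair of variables, where N + 1 replaces N. *)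
Variables (lvl : int -> V -> Prop) (N : int).
Hypotheses (d_lin : linear d) (e_lin : linear e).
Hypothesis lvlP : forall k c f g, lvl k f -> lvl k g -> lvl k (c *: f + g).
Hypothesis lvl_d : forall k f, lvl k f -> lvl (k - 2) (d f).
Hypothesis lvl_e : forall k f, lvl k f -> lvl (k + 2) (e f).
Hypothesis de : forall k f, lvl k f -> d (e f) = e (d f) + (k + 1 - N)%:~R *: f.
Implicit Types (f g h : V) (k l : int) (s : nat).

Let dv : {linear V -> V} := HB.pack d (GRing.isLinear.Build F V V *:%R d d_lin).
Let ev : {linear V -> V} := HB.pack e (GRing.isLinear.Build F V V *:%R e e_lin).
Let dD f g : d (f + g) = d f + d g. Proof. exact: (linearD dv). Qed.
Let eD f g : e (f + g) = e f + e g. Proof. exact: (linearD ev). Qed.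
Let dB f g : d (f - g) = d f - d g. Proof. exact: (linearB dv). Qed.
Let eB f g : e (f - g) = e f - e g. Proof. exact: (linearB ev). Qed.
Let dZ c f : d (c *: f) = c *: d f. Proof. exact: (linearZ_LR dv). Qed.
Let eZ c f : e (c *: f) = c *: e f. Proof. exact: (linearZ_LR ev). Qed.
Let d0 : d 0 = 0. Proof. exact: (linear0 dv). Qed.
Let e0 : e 0 = 0. Proof. exact: (linear0 ev). Qed.

Let lvlB k f g : lvl k f -> lvl k g -> lvl k (f - g).
Proof. by move=> fk gk; rewrite -scaleN1r addrC; apply: lvlP. Qed.
Let lvlZ k c f : lvl k f -> lvl k (c *: f).
Proof.
move=> fk; have -> : c *: f = (c - 1) *: f + f by rewrite scalerBl scale1r subrK.
exact: lvlP.
Qed.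
Let lvlD k f g : lvl k f -> lvl k g -> lvl k (f + g).
Proof. by rewrite -{2}[f]scale1r; apply: lvlP. Qed.

Let iter_eD s f g : iter s e (f + g) = iter s e f + iter s e g.
Proof. by elim: s => //= s ->. Qed.
Let iterZ s c f : iter s e (c *: f) = c *: iter s e f.
Proof. by elim: s => //= s ->. Qed.
Let iter0 s : iter s e 0 = 0. Proof. by elim: s => //= s ->. Qed.
Let iterdB s f g : iter s d (f - g) = iter s d f - iter s d g.
Proof. by elim: s => //= s ->. Qed.
Let iterdZ s c f : iter s d (c *: f) = c *: iter s d f.
Proof. by elim: s => //= s ->. Qed.

Lemma lvl_eq k l f : lvl k f -> k = l -> lvl l f.
Proof. by move=> fk <-. Qed.

Lemma lvl_iter_e k s f : lvl k f -> lvl (k + s%:Z * 2) (iter s e f).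
Proof.
move=> fk; elim: s => [|s IH]; first by rewrite mul0r addr0.
by apply: (lvl_eq (lvl_e IH)); lia.
Qed.

Lemma lvl_iter_d k s f : lvl k f -> lvl (k - s%:Z * 2) (iter s d f).
Proof.
move=> fk; elim: s => [|s IH]; first by rewrite mul0r subr0.
by apply: (lvl_eq (lvl_d IH)); lia.
Qed.

Lemma d_iter_e k s f : lvl k f -> d (iter s.+1 e f) =
  iter s.+1 e (d f) + (s.+1%:Z * (k - N + s.+1%:Z))%:~R *: iter s e f.
Proof.
move=> fk; elim: s => [|s IH]; first by rewrite /= (de fk) mul1r addrAC.
rewrite iterS (de (lvl_iter_e s.+1 fk)) IH eD eZ -addrA; congr (_ + _).
by rewrite -iterS -scalerDl -rmorphD; congr (_%:~R *: _); lia.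
Qed.

Lemma iter_d_e k s f : lvl k f -> iter s.+1 d (e f) =
  e (iter s.+1 d f) + (s.+1%:Z * (k + 1 - N - s%:Z))%:~R *: iter s d f.
Proof.
move=> fk; elim: s => [|s IH]; first by rewrite /= (de fk) mul1r subr0.
rewrite iterS IH dD dZ (de (lvl_iter_d s.+1 fk)) -addrA; congr (_ + _).
by rewrite -iterS -scalerDl -rmorphD; congr (_%:~R *: _); lia.
Qed.

(* Subtracting from e (d f) its eigenvalue on the part of f seen by d^s lowers the
   d-nilpotency order. *)
Lemma split_harmonic k s f : lvl k f -> iter s d f = 0 ->
  (forall i : nat, (0 < i < s)%N -> k - N <> i%:Z) ->
  exists2 g, lvl (k - 2) g & d (f - e g) = 0.
Proof.
elim: s f => [|s IH] f fk.
  move=> /= f0 _; exists 0; last by rewrite e0 subr0 f0 d0.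
  by rewrite -[0](scale0r (d f)); apply/lvlZ/lvl_d.
case: s IH => [|s] IH fs kN.
  exists 0; last by rewrite e0 subr0.
  by rewrite -[0](scale0r (d f)); apply/lvlZ/lvl_d.
pose t : int := s.+1%:Z * (k - N - s.+1%:Z).
have t0 : t%:~R != 0 :> F.
  rewrite intr_eq0 mulf_neq0 //; apply/eqP => kN0; apply: (kN s.+1); first by rewrite !ltnS leqnn.
  by move/eqP: kN0; rewrite subr_eq0 => /eqP.
have lf : lvl (k - 2) (d f) := lvl_d fk.
have [||i iE|g gk gE] := IH (e (d f) - t%:~R *: f).
- by apply: lvlB; [apply: (lvl_eq (lvl_e lf)); ring|exact: lvlZ].
- rewrite iterdB iterdZ (iter_d_e s lf) -iterSr fs e0 add0r -iterSr -scalerBl -rmorphB.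
  by rewrite (_ : _ - _ = 0) ?scale0r // /t; lia.
- by apply: kN; lia.
exists (t%:~R^-1 *: (d f - g)); first by apply/lvlZ/lvlB.
have -> : f - e (t%:~R^-1 *: (d f - g)) = - t%:~R^-1 *: (e (d f) - t%:~R *: f - e g).
  rewrite eZ eB [_ - e g in RHS]addrAC [RHS]scalerBr [X in _ = _ - X]scalerA mulNr mulVf //.
  by rewrite scaleN1r opprK scaleNr [LHS]addrC.
by rewrite dZ gE scaler0.
Qed.

(** The mirror image of [split_harmonic]: adding to e (d f) a multiple b of f lowers the order of
    nilpotency under e, and b is positive since N <= k. *)
Lemma image_above k s f : lvl k f -> N <= k -> iter s e f = 0 ->
  exists2 g, lvl (k - 2) g & f = e g.
Proof.
move=> + kN; elim: s f => [|s IH] f fk fs.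
  by exists 0; rewrite ?e0 // -[0](scale0r (d f)); apply/lvlZ/lvl_d.
case: s IH => [|s] IH in fs *.
  exists ((k + 1 - N)%:~R^-1 *: - d f).
    by apply: lvlZ; rewrite -scaleN1r; apply/lvlZ/lvl_d.
  have := de fk; rewrite (fs : e f = 0) d0 => /esym/eqP; rewrite addr_eq0 => /eqP edf.
  rewrite eZ -scaleN1r eZ edf scalerN scaleN1r opprK scalerA mulVf ?scale1r //.
  by rewrite intr_eq0; lia.
(* c is the scalar of [d_iter_e] at e f, of level k + 2. Hence e^(s+1) kills d (e f) + c f, which is
   e (d f) + b f. *)
pose c : int := s.+1%:Z * (k - N + s.+1%:Z + 2).
pose b : int := k + 1 - N + c.
have b0 : b%:~R != 0 :> F.
  by rewrite intr_eq0 (_ : b = s.+2%:Z * (k - N + s.+2%:Z)) /b /c; nia.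
have [||g gk gE] := IH (e (d f) + b%:~R *: f).
- by apply: lvlD; [apply: (lvl_eq (lvl_e (lvl_d fk))); ring|exact: lvlZ].
- have := d_iter_e s (lvl_e fk); rewrite -!iterSr fs d0 => /esym/eqP.
  rewrite addr_eq0 => /eqP E.
  have -> : e (d f) + b%:~R *: f = d (e f) + c%:~R *: f.
    by rewrite (de fk) -[RHS]addrA -scalerDl -rmorphD.
  rewrite iter_eD E iterZ addrC -scalerBl -rmorphB.
  by rewrite (_ : _ - _ = 0) ?scale0r // /c; lia.
exists (b%:~R^-1 *: (g - d f)); first by apply/lvlZ/lvlB => //; apply: lvl_d.
by rewrite eZ eB -gE addrAC subrr add0r scalerA mulVf // scale1r.
Qed.

(** For harmonic f, d (e^(s+1) f) is (s+1)(k - N + s + 1) times e^s f. The scalar is positive when N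
    <= k, so the string of a nonzero f under e never ends. *)
Lemma no_harmonic_above k s f : lvl k f -> N <= k -> d f = 0 -> iter s e f = 0 -> f = 0.
Proof.
move=> fk kN df; elim: s => [//|s IH] fs; apply: IH.
have := d_iter_e s fk; rewrite fs d0 df iter0 add0r => /esym/eqP.
by rewrite scaler_eq0 intr_eq0 => /orP[|/eqP//]; nia.
Qed.

(** If e g is harmonic, d^(s+1) g = 0 leaves only the term (s+1)(k + 1 - N - s) d^s g in [iter_d_e],
    and this scalar is negative. *)
Lemma injective_below k s g : lvl k g -> k <= N - 2 -> d (e g) = 0 -> iter s d g = 0 -> g = 0.
Proof.
move=> gk kN deg0; elim: s => [//|s IH] gs; apply: IH.
have := iter_d_e s gk; rewrite iterSr deg0 gs e0 add0r => /esym/eqP.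
have -> : iter s d 0 = 0 by elim: {gs} s => //= s ->.
by rewrite scaler_eq0 intr_eq0 => /orP[|/eqP//]; nia.
Qed.

(* When e^s g is harmonic but s <> k - N, g is again in the image of e. *)
Lemma harmonic_image k f g : injective e -> N < k -> lvl (k - 2) g -> f = e g -> d f = 0 ->
  exists h, [/\ lvl (2 * N - k) h, d h = 0 & f = iter (absz (k - N)) e h].
Proof.
move=> e_inj kN gk fE df.
suff H s : (0 < s <= absz (k - N))%N ->
    exists2 h, lvl (k - s%:Z * 2) h & f = iter s e h.
  have [|h hk fh] := H (absz (k - N)); first by lia.
  exists h; split=> //; first by apply: (lvl_eq hk); lia.
  (* At the exponent k - N the scalar of [d_iter_e] is 0, so a power of e kills d h, and injectivity
     gives d h = 0. *)
  case sE: (absz (k - N)) hk fh => [|s] hk fh; first by lia.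
  have := d_iter_e s hk; rewrite -fh df.
  rewrite (_ : k - _ - N + _ = 0) ?mulr0; last by lia.
  rewrite scale0r addr0 => /esym; elim: s.+1 => [//|j IH] /= ej.
  by apply/IH/e_inj; rewrite e0.
elim: s => [//|[|s] IH] sk; first by exists g => //; apply: (lvl_eq gk); ring.
have [|h hk fh] := IH; first by lia.
have := d_iter_e s hk; rewrite -fh df.
set c := _%:~R => E; have c0 : c != 0 by rewrite intr_eq0 mulf_eq0 negb_or; lia.
exists (- c^-1 *: d h); first by apply: lvlZ; apply: (lvl_eq (lvl_d hk)); lia.
rewrite fh [RHS]iterSr eZ; congr (iter s.+1 e _).
have inj j x y : iter j e x = iter j e y -> x = y.
  by elim: j x y => //= j IHj x y /e_inj /IHj.
apply: (inj s); rewrite iterZ; move/eqP: E; rewrite eq_sym addr_eq0 iterSr => /eqP ->.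
by rewrite scalerN scaleNr opprK scalerA mulVf // scale1r.
Qed.

(* In a sum of finite-dimensional modules, e^t maps the weight -t onto the weight t. *)
Lemma iter_e_onto (t : nat) f : (forall g, exists s, iter s d g = 0) ->
  (forall g, exists s, iter s e g = 0) -> lvl (N - 1 + t%:Z) f ->
  exists2 g, lvl (N - 1 - t%:Z) g & f = iter t e g.
Proof.
move=> d_nil e_nil ft.
suff H s : (s <= t)%N -> exists2 g, lvl (N - 1 + t%:Z - s%:Z * 2) g & f = iter s e g.
  by have [g gt fg] := H t (leqnn t); exists g => //; apply: (lvl_eq gt); ring.
elim: s => [_|s IH st]; first by exists f => //; apply: (lvl_eq ft); ring.
have [g gs fg] := IH (ltnW st); set l : int := N - 1 + _ - _ in gs.
have lE : l - 2 = N - 1 + t%:Z - s.+1%:Z * 2 by rewrite /l; lia.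
have [Nl|lN] := lerP N l.
  have [i gi] := e_nil g; have [h hl gh] := image_above gs Nl gi.
  by exists h; rewrite -?lE // iterSr -gh.
have [i gi] := d_nil g; have [|h hl dh] := split_harmonic gs gi; first by lia.
exists h; first by rewrite -lE.
rewrite fg [RHS]iterSr -[g in LHS](subrK (e h)) iter_eD; set g0 := g - e h in dh *.
have g0l : lvl l g0 by apply: lvlB => //; apply: (lvl_eq (lvl_e hl)); ring.
suff : iter s e g0 = 0 by move=> ->; rewrite add0r.
(* Here l < N, and j makes the scalar in d (e^(j+1) g0) vanish. So e^(j+1) g0 is harmonic, of level
   2N - l > N and killed by a power of e: it is 0, and j + 1 <= s. *)
have [j jE] : exists j : nat, j%:Z = N - 1 - l by exists (absz (N - 1 - l)%R); lia.
have js : (j.+1 <= s)%N by move: jE; rewrite /l; lia.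
suff e0j : iter j.+1 e g0 = 0 by rewrite -(subnK js) iterD e0j iter0.
have [a ea] := e_nil (iter j.+1 e g0).
apply: (no_harmonic_above (lvl_iter_e j.+1 g0l) _ _ ea); first by lia.
rewrite (d_iter_e j g0l) dh iter0 add0r (_ : l - N + _ = 0) ?mulr0 ?scale0r //; lia.
Qed.

End Sl2.

(** * Conjugate indices *)

Section Swap.

Variable n : nat.

Definition swap (i : 'I_(n + n)) : 'I_(n + n) :=
  match split i with inl j => rshift n j | inr j => lshift n j end.

Lemma swap_lshift (j : 'I_n) : swap (lshift n j) = rshift n j.
Proof. by rewrite /swap (unsplitK (inl j)). Qed.

Lemma swap_rshift (j : 'I_n) : swap (rshift n j) = lshift n j.
Proof. by rewrite /swap (unsplitK (inr j)). Qed.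

Lemma half_ind (P : 'I_(n + n) -> Prop) :
  (forall j, P (lshift n j)) -> (forall j, P (rshift n j)) -> forall i, P i.
Proof. by move=> Pl Pr i; rewrite -(splitK i); case: (split i). Qed.

Lemma swapK : involutive swap.
Proof. by elim/half_ind=> j; rewrite !(swap_lshift, swap_rshift). Qed.

Lemma swap_inj : injective swap. Proof. exact: can_inj swapK. Qed.

Lemma swap_neq i : swap i != i.
Proof.
by elim/half_ind: i => j; rewrite !(swap_lshift, swap_rshift) ?eq_rlshift ?eq_lrshift.
Qed.

End Swap.

(** * The oscillator representation of osp(2m1, 2n) *)

Section Oscillator.

Variables (F : numFieldType) (m1 n r : nat).
Hypothesis hr : (r <= m1)%N.

Local Notation m := (m1 + m1)%N.
Local Notation A := (superpoly F m (n + n)).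
Implicit Types (f g h : A) (W U : A -> Prop) (k : int).
Local Notation X := (@mulX F m (n + n)).
Local Notation dX := (@spdX F m (n + n)).
Local Notation D := (@spdtheta F m (n + n)).
Local Notation Th := (@mulT F m (n + n)).
Local Notation bas := (@bas F m (n + n)).
Local Notation one := (bas 0%MM set0).
Local Notation Ak k := (@Ak F m1 n r k).
Local Notation Hk k := (@Hk F m1 n r k).

Definition qx (i : 'I_m) f : A := if (i < r)%N then spdX i f else mulX i f.
Definition px (i : 'I_m) f : A := if (i < r)%N then - mulX i f else spdX i f.

Fact qx_linear i : linear (qx i).
Proof. by move=> c f g; rewrite /qx; case: ifP => _; rewrite linearP. Qed.
HB.instance Definition _ i := GRing.isLinear.Build F A A *:%R (qx i) (qx_linear i).

Fact px_linear i : linear (px i).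
Proof.
move=> c f g; rewrite /px; case: ifP => _; rewrite linearP //.
by rewrite opprD scalerN.
Qed.
HB.instance Definition _ i := GRing.isLinear.Build F A A *:%R (px i) (px_linear i).

Definition qx_lin i : linear_rules (qx i) := linear_rulesP (qx_linear i).
Definition px_lin i : linear_rules (px i) := linear_rulesP (px_linear i).

Lemma qxC i j f : qx i (qx j f) = qx j (qx i f).
Proof.
rewrite /qx; case: (ltnP i r) => ir; case: (ltnP j r) => jr.
- exact: spdXC.
- rewrite spdX_mulX; case: eqP => [ij|_]; last by rewrite scale0r add0r.
  by move: ir; rewrite ij ltnNge jr.
- rewrite spdX_mulX; case: eqP => [ij|_]; last by rewrite scale0r add0r.
  by move: jr; rewrite ij ltnNge ir.
- exact: mulXC.
Qed.

Lemma pxC i j f : px i (px j f) = px j (px i f).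
Proof.
rewrite /px; case: (ltnP i r) => ir; case: (ltnP j r) => jr.
- by rewrite 2![mulX _ (- _)]linearN /= mulXC.
- rewrite linearN /= spdX_mulX; case: eqP => [ij|_]; last by rewrite scale0r add0r.
  by move: jr; rewrite ij leqNgt ir.
- rewrite linearN /= spdX_mulX; case: eqP => [ij|_]; last by rewrite scale0r add0r.
  by move: ir; rewrite ij leqNgt jr.
- exact: spdXC.
Qed.

Lemma px_qx i j f : px i (qx j f) = (i == j)%:R *: f + qx j (px i f).
Proof.
rewrite /px /qx; case: (ltnP i r) => ir; case: (ltnP j r) => jr.
- by rewrite [in RHS]linearN /= spdX_mulX [j == i]eq_sym opprD addNKr.
- rewrite mulXC linearN /=; case: eqP => [ij|_]; last by rewrite scale0r add0r.
  by move: ir; rewrite ij ltnNge jr.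
- rewrite spdXC; case: eqP => [ij|_]; last by rewrite scale0r add0r.
  by move: jr; rewrite -ij ltnNge ir.
- exact: spdX_mulX.
Qed.

Lemma mulT_qx s i f : mulT s (qx i f) = qx i (mulT s f).
Proof. by rewrite /qx; case: ifP => _; rewrite ?mulT_mulX ?mulT_spdX. Qed.
Lemma mulT_px s i f : mulT s (px i f) = px i (mulT s f).
Proof. by rewrite /px; case: ifP => _; rewrite ?linearN /= ?mulT_mulX ?mulT_spdX. Qed.
Lemma spdtheta_qx s i f : spdtheta s (qx i f) = qx i (spdtheta s f).
Proof. by rewrite /qx; case: ifP => _; rewrite ?spdtheta_mulX ?spdtheta_spdX. Qed.
Lemma spdtheta_px s i f : spdtheta s (px i f) = px i (spdtheta s f).
Proof. by rewrite /px; case: ifP => _; rewrite ?linearN /= ?spdtheta_mulX ?spdtheta_spdX. Qed.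

(** The thetas pair antisymmetrically: the commutator of Delta with theta_s is eps s times d_(swap
    s), see [lap_mulT]. *)
Definition eps (s : 'I_(n + n)) : F := if (s < n)%N then -1 else 1.

Lemma eps_lshift j : eps (lshift n j) = -1. Proof. by rewrite /eps /= ltn_ord. Qed.
Lemma eps_rshift j : eps (rshift n j) = 1. Proof. by rewrite /eps /= ltnNge leq_addr. Qed.

Lemma eps_swap s : eps (swap s) = - eps s.
Proof.
by elim/half_ind: s => j;
  rewrite !(swap_lshift, swap_rshift, eps_lshift, eps_rshift) ?opprK.
Qed.

Lemma eps_sq s : eps s * eps s = 1.
Proof. by rewrite /eps; case: ifP => _; ring. Qed.

(* The elements of osp(2m1, 2n) attached to E_(i,j), E_(i,m+s) and E_(m+s,m+t). Together
   they span it. *)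
Definition Lxx i j f : A := qx i (px j f) - qx (swap j) (px (swap i) f).
Definition Lxt i s f : A := qx i (spdtheta s f) + eps s *: mulT (swap s) (px (swap i) f).
Definition Ltt s t f : A :=
  mulT s (spdtheta t f) - (eps s * eps t) *: mulT (swap t) (spdtheta (swap s) f).

(** The term - delta_(i,j) of the action is what turns - x_j d_i into the ordered product d_i (-
    x_j), so that q_i p_j covers all four cases. *)
Lemma act_unit_xx i j f : act_unit r (lshift _ i) (lshift _ j) f = qx i (px j f).
Proof.
rewrite /act_unit !(unsplitK (inl _)) /act_xx /qx /px !spmulX.
case: (ltnP i r) => ir; case: (ltnP j r) => jr //; rewrite linearN //=.
rewrite spdX_mulX; have [->|ij] := eqVneq i j; first by rewrite opprD addrC.
by rewrite !scale0r add0r subr0.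
Qed.

Lemma act_unit_xt i s f :
  act_unit r (lshift _ i) (rshift _ s) f = qx i (spdtheta s f).
Proof. by rewrite /act_unit (unsplitK (inl _)) (unsplitK (inr _)) /act_xtheta /qx spmulX. Qed.

Lemma act_unit_tx i s f :
  act_unit r (rshift _ s) (lshift _ i) f = mulT s (px i f).
Proof.
rewrite /act_unit (unsplitK (inl _)) (unsplitK (inr _)) /act_thetax /px !spmulT spmulX.
by case: ifP => _; rewrite ?linearN.
Qed.

Lemma act_unit_tt s t f :
  act_unit r (rshift _ s) (rshift _ t) f = mulT s (spdtheta t f).
Proof. by rewrite /act_unit !(unsplitK (inr _)) /act_thetatheta spmulT. Qed.

Lemma actE (M : 'M_(m + (n + n))) f : act r M f =
  \sum_i \sum_j M (lshift _ i) (lshift _ j) *: qx i (px j f) +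
  \sum_i \sum_s M (lshift _ i) (rshift _ s) *: qx i (spdtheta s f) +
  (\sum_i \sum_s M (rshift _ s) (lshift _ i) *: mulT s (px i f) +
   \sum_s \sum_t M (rshift _ s) (rshift _ t) *: mulT s (spdtheta t f)).
Proof.
rewrite /act big_split_ord /=; congr (_ + _).
  rewrite -big_split; apply: eq_bigr => i _; rewrite big_split_ord /=; congr (_ + _).
    by apply: eq_bigr => j _; rewrite act_unit_xx.
  by apply: eq_bigr => s _; rewrite act_unit_xt.
rewrite [X in _ = X + _]exchange_big -big_split /=; apply: eq_bigr => s _.
rewrite big_split_ord /=; congr (_ + _).
  by apply: eq_bigr => i _; rewrite act_unit_tx.
by apply: eq_bigr => t _; rewrite act_unit_tt.
Qed.

Lemma act_delta i j f : act r (delta_mx i j) f = act_unit r i j f.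
Proof.
rewrite /act (bigD1 i) //= (bigD1 j) //= mxE !eqxx scale1r.
rewrite !big1 ?addr0 // => [i' ii'|j' jj'].
  by rewrite big1 // => j' _; rewrite mxE (negPf ii') scale0r.
by rewrite mxE (negPf jj') andbF scale0r.
Qed.

Lemma act_linear (c : F) M M' f : act r (c *: M + M') f = c *: act r M f + act r M' f.
Proof.
rewrite /act scaler_sumr -big_split; apply: eq_bigr => i _ /=.
rewrite scaler_sumr -big_split; apply: eq_bigr => j _ /=.
by rewrite !mxE scalerDl scalerA.
Qed.

(** The block shape read entry by entry: up to signs, the matrix is invariant under (a, b) -> (swap
    b, swap a). *)
Definition osp_entries (M : 'M[F]_(m + (n + n))) : Prop :=
  [/\ forall i j, M (lshift _ (swap j)) (lshift _ (swap i)) = - M (lshift _ i) (lshift _ j),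
      forall i s, M (rshift _ s) (lshift _ i) =
                  - eps s * M (lshift _ (swap i)) (rshift _ (swap s)) &
      forall s t, M (rshift _ (swap t)) (rshift _ (swap s)) =
                  - (eps s * eps t) * M (rshift _ s) (rshift _ t)].

Lemma in_ospP M : in_osp M <-> osp_entries M.
Proof.
pose E := (swap_lshift, swap_rshift, eps_lshift, eps_rshift,
  block_mxEul, block_mxEur, block_mxEdl, block_mxEdr, opprK, mulrN1, mulN1r, mul1r, mulr1).
split.
  case=> a [b [c [d [e [f [h [h1 [k [k1 [eb ec ee ef ->]]]]]]]]]]; split.
  - elim/half_ind=> i; elim/half_ind=> j; rewrite !E ?mxE ?opprK ?mul1r ?mulN1r //.
    + by rewrite [in LHS]eb !mxE.
    + by rewrite [in LHS]ec !mxE.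
  - by elim/half_ind=> i; elim/half_ind=> j; rewrite !E ?mxE.
  - elim/half_ind=> i; elim/half_ind=> j; rewrite !E ?mxE ?opprK ?mul1r ?mulN1r //.
    + by rewrite [in LHS]ee !mxE.
    + by rewrite [in LHS]ef !mxE.
case=> Mxx Mxt Mtt.
exists (ulsubmx (ulsubmx M)), (ursubmx (ulsubmx M)), (dlsubmx (ulsubmx M)),
  (ulsubmx (drsubmx M)), (ursubmx (drsubmx M)), (dlsubmx (drsubmx M)),
  (ulsubmx (ursubmx M)), (ursubmx (ursubmx M)), (dlsubmx (ursubmx M)), (drsubmx (ursubmx M)).
have xx i j := Mxx i j; have xt i j := Mxt i j; have tt i j := Mtt i j.
split.
- by apply/matrixP => i j; move: (xx (lshift _ j) (rshift _ i)); rewrite !E !mxE ?opprK.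
- by apply/matrixP => i j; move: (xx (rshift _ j) (lshift _ i)); rewrite !E !mxE ?opprK.
- by apply/matrixP => i j; move: (tt (lshift _ j) (rshift _ i)); rewrite !E !mxE ?opprK.
- by apply/matrixP => i j; move: (tt (rshift _ j) (lshift _ i)); rewrite !E !mxE ?opprK.
rewrite -[LHS]submxK; congr block_mx.
- rewrite -[LHS]submxK; congr block_mx.
  by apply/matrixP => i j; move: (xx (lshift _ j) (lshift _ i)); rewrite !E !mxE ?opprK.
- by rewrite -[LHS]submxK.
- rewrite -[LHS]submxK; congr block_mx; apply/matrixP => i j; rewrite !mxE xt !E ?mxE //.
- rewrite -[LHS]submxK; congr block_mx.
  by apply/matrixP => i j; move: (tt (lshift _ j) (lshift _ i)); rewrite !E !mxE ?opprK.
Qed.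

(** Each even block is averaged with its image under (i, j) -> (swap j, swap i), whence the factors
    1/2. In the odd part the lower left entries are matched with the upper right ones, and no factor
    appears. *)
Lemma act_osp M f : osp_entries M -> act r M f =
  2%:R^-1 *: \sum_i \sum_j M (lshift _ i) (lshift _ j) *: Lxx i j f +
  \sum_i \sum_s M (lshift _ i) (rshift _ s) *: Lxt i s f +
  2%:R^-1 *: \sum_s \sum_t M (rshift _ s) (rshift _ t) *: Ltt s t f.
Proof.
have half (g : A) : 2%:R^-1 *: (g + g) = g.
  by rewrite -mulr2n -scaler_nat scalerA mulVf ?pnatr_eq0 // scale1r.
have reindex2 (k l : nat) (G : 'I_(k + k) -> 'I_(l + l) -> A) :
    \sum_i \sum_j G i j = \sum_i \sum_j G (swap i) (swap j).
  rewrite (reindex_inj (@swap_inj k)); apply: eq_bigr => i _.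
  by rewrite (reindex_inj (@swap_inj l)).
case=> Mxx Mxt Mtt; rewrite actE addrA; congr (_ + _).
  rewrite -addrA; congr (_ + _).
    rewrite -[LHS]half; congr (_ *: _).
    rewrite [X in _ + X = _]exchange_big [X in _ + X = _]reindex2 -big_split; apply: eq_bigr => i _ /=.
    rewrite -big_split; apply: eq_bigr => j _ /=.
    by rewrite Mxx scaleNr scalerBr.
  rewrite [X in _ + X]reindex2 -big_split; apply: eq_bigr => i _ /=.
  rewrite -big_split; apply: eq_bigr => s _ /=.
  by rewrite Mxt !swapK eps_swap opprK scalerDr scalerA mulrC.
rewrite -[LHS]half; congr (_ *: _).
rewrite [X in _ + X = _]exchange_big [X in _ + X = _]reindex2 -big_split; apply: eq_bigr => s _ /=.
rewrite -big_split; apply: eq_bigr => t _ /=.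
by rewrite Mtt scalerBr scalerA mulrC mulrN scaleNr.
Qed.

Lemma submoduleP W : is_submodule r W <-> [/\ is_subspace W,
  forall i j f, W f -> W (Lxx i j f), forall i s f, W f -> W (Lxt i s f) &
  forall s t f, W f -> W (Ltt s t f)].
Proof.
have sI (k : nat) : injective (@swap k) := @swap_inj k.
have sE (k : nat) (i j : 'I_(k + k)) : (swap i == j) = (i == swap j).
  by rewrite -(inj_eq (sI k)) swapK.
pose Z := (mulr0, addr0, add0r, oppr0).
split=> [[sW aW]|[sW xx xt tt]]; last first.
  split=> // M f /in_ospP oM Wf; rewrite act_osp //.
  by do 2?apply: subspaceD => //; rewrite ?(subspaceZ _ sW) //;
    do ?[apply: subspaceZ => //]; apply: subspace_sum => // i _;
    apply: subspace_sum => // j _; apply: subspaceZ => //; auto.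
split=> //.
- move=> i j f Wf.
  have -> : Lxx i j f = act r (-1 *: delta_mx (lshift _ (swap j)) (lshift _ (swap i))
      + delta_mx (lshift _ i) (lshift _ j)) f.
    by rewrite act_linear !act_delta !act_unit_xx scaleN1r addrC.
  apply: aW => //; apply/in_ospP; split=> a b;
    rewrite !mxE ?eq_lshift ?eq_lrshift ?eq_rlshift ?andbF /=; do ?[rewrite Z] => //.
  rewrite !(inj_eq (sI _)) !sE.
  by case: (a == i); case: (b == j); case: (a == _); case: (b == _) => /=; ring.
- move=> i s f Wf.
  have -> : Lxt i s f = act r (eps s *: delta_mx (rshift _ (swap s)) (lshift _ (swap i))
      + delta_mx (lshift _ i) (rshift _ s)) f.
    by rewrite act_linear !act_delta act_unit_tx act_unit_xt addrC.
  apply: aW => //; apply/in_ospP; split=> a b;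
    rewrite !mxE ?eq_lshift ?eq_rshift ?eq_lrshift ?eq_rlshift ?andbF /=; do ?[rewrite Z] => //.
  rewrite !sE [b == swap s]eq_sym -sE; have [<-|_] := eqVneq (swap s) b.
    by rewrite eps_swap opprK andbT.
  by rewrite andbF mulr0 mulr0.
- move=> s t f Wf.
  have -> : Ltt s t f = act r (- (eps s * eps t) *:
      delta_mx (rshift _ (swap t)) (rshift _ (swap s)) + delta_mx (rshift _ s) (rshift _ t)) f.
    by rewrite act_linear !act_delta !act_unit_tt scaleNr addrC.
  apply: aW => //; apply/in_ospP; split=> a b;
    rewrite !mxE ?eq_rshift ?eq_lrshift ?eq_rlshift ?andbF /=; do ?[rewrite Z] => //.
  rewrite !(inj_eq (sI _)) !sE.
  rewrite mulrDr addrC; congr (_ + _).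
    have [->|_] := eqVneq a (swap t); last by rewrite andbF !mulr0.
    have [->|_] := eqVneq b (swap s); last by rewrite !mulr0.
    rewrite !eps_swap /= !mulr1; have := eps_sq s; have := eps_sq t.
    by move: (eps s) (eps t) => x y y2 x2; ring: x2 y2.
  have [->|_] := eqVneq a s; last by rewrite andbF !mulr0.
  by have [->|_] := eqVneq b t; rewrite ?mulr0.
Qed.

(** * Levels and the spaces A_k *)

Definition lev : grading m (n + n) :=
  (fun i : 'I_m => if (i < r)%N then -1 else 1, fun _ => 1).

Lemma wdegE a (S : {set 'I_(n + n)}) : wdeg r a #|S| = grade lev S a.
Proof.
rewrite /wdeg /grade [RHS]addrC -addrA sumr_const natz; congr (_ + _).
rewrite [in RHS](bigID (fun i : 'I_m => (i < r)%N)) /= -sumrN; congr (_ + _).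
  by apply: eq_bigr => i ->; rewrite mulNrn natz.
apply: eq_big => [i|i ri]; first by rewrite -leqNgt.
by rewrite ltnNge ri natz.
Qed.

Lemma spword_bas w : uniq w ->
  exists2 c : F, c != 0 & spword F m w = c *: bas 0%MM [set s in w].
Proof.
elim: w => [|s w IH] /= => [_|/andP[sw /IH[c c0 ->]]].
  exists 1; rewrite ?oner_eq0 // scale1r; apply: superpolyP => S a.
  by rewrite !basE set_nil.
rewrite spmulT linearZ /= mulT_bas ?inE // scalerA set_cons.
by eexists; last by []; rewrite mulf_neq0 // koszul_neq0.
Qed.

Lemma ofdeg_bas w S a : ofdeg w (grade w S a) (bas a S : A).
Proof.
by move=> T b; rewrite basE pnatr_eq0 eqb0 negbK => /andP[/eqP -> /eqP ->].
Qed.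

Lemma spmul_spmonE a f : spmul (spmon F (n + n) a) f = [ffun S => 'X_[a] * f S].
Proof.
apply/ffunP => T; rewrite !ffunE (bigD1 set0) ?powersetE ?sub0set //= big1 ?addr0.
  rewrite ffunE eqxx setD0 /shuffle_sign.
  suff -> : [set u : 'I_(n + n) * 'I_(n + n) | [&& u.1 \in set0, u.2 \in T & (u.2 < u.1)%N]] = set0.
    by rewrite cards0 scale1r.
  by apply/setP => u; rewrite !inE.
by move=> S /andP[_ /negPf S0]; rewrite ffunE S0 mul0r scaler0.
Qed.

Lemma spmul_spmon_bas a (c : F) b S :
  spmul (spmon F (n + n) a) (c *: bas b S) = c *: bas (a + b) S.
Proof.
rewrite spmul_spmonE; apply/ffunP => T; rewrite !ffunE.
by case: eqP; rewrite ?scaler0 ?mulr0 // mpolyXD scalerAr.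
Qed.

Lemma spword_dup (w : seq 'I_(n + n)) : ~~ uniq w -> spword F m w = 0.
Proof.
elim: w => //= s w IH; rewrite negb_and negbK spmulT.
have [uw|/IH -> _] := boolP (uniq w); last by rewrite linear0.
rewrite orbF => sw; have [c _ ->] := spword_bas uw.
rewrite linearZ /=; suff -> : Th s (bas 0%MM [set t in w]) = 0 by rewrite scaler0.
apply: superpolyP => S a; rewrite mcoeff_mulT basE mcoeffsp0.
case: ifP => // _; case: eqP; rewrite ?mulr0 // => /setP/(_ s).
by rewrite !inE eqxx sw.
Qed.

Lemma spspan_subspace (X : A -> Prop) : is_subspace (spspan X).
Proof.
split=> [|c f g [l1 X1 ->] [l2 X2 ->]]; first by exists [::]; rewrite ?big_nil.
exists ([seq (c * cg.1, cg.2) | cg <- l1] ++ l2).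
  by move=> cg; rewrite mem_cat => /orP[/mapP[cg' /X1 ? ->]|/X2].
rewrite big_cat big_map scaler_sumr; congr (_ + _); apply: eq_bigr => cg _ /=.
by rewrite scalerA.
Qed.

Lemma spspan_gen (X : A -> Prop) f : X f -> spspan X f.
Proof.
move=> Xf; exists [:: (1, f)]; last by rewrite big_seq1 scale1r.
by move=> cg; rewrite inE => /eqP ->.
Qed.

Lemma AkP k f : Ak k f <-> ofdeg lev k f.
Proof.
split=> [[l lk ->]|fk].
  rewrite big_seq; apply: ofdeg_sum => cg /lk[a [w [_ wk ->]]].
  apply: ofdegZ.
  (* A word with a repeated theta gives 0. Otherwise its size is the cardinal of its set of
     letters. *)
  have [uw|/spword_dup ->] := boolP (uniq w); last first.
    rewrite (_ : spmul _ _ = 0); first exact: ofdeg0.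
    by rewrite spmul_spmonE; apply/ffunP => S; rewrite !ffunE mulr0.
  have [c _ ->] := spword_bas uw; rewrite spmul_spmon_bas addm0 -wk.
  apply: ofdegZ.
  rewrite (_ : size w = #|[set s in w]|) ?wdegE; first exact: ofdeg_bas.
  by rewrite cardsE; move/card_uniqP: uw.
apply: subspace_span => [|S a /fk wk]; first exact: spspan_subspace.
have uS : uniq (enum S) by exact: enum_uniq.
have [c c0 wE] := spword_bas uS.
rewrite set_enum in wE; have -> : bas a S = c^-1 *: spmul (spmon F _ a) (spword F m (enum S)).
  by rewrite wE spmul_spmon_bas addm0 scalerA mulVf // scale1r.
apply: subspaceZ; first exact: spspan_subspace.
apply: spspan_gen; exists a, (enum S); rewrite -cardE wdegE; split=> //.
by rewrite -[X in (_ <= X)%N]card_ord max_card.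
Qed.

(** * The operators Delta and eta and their commutators *)

Local Notation Delta := (@Delta_op F m1 n r).
Local Notation eta := (@eta_op F m1 n r).

Lemma Delta_opE f : Delta f = \sum_(i < m1) px (lshift m1 i) (px (rshift m1 i) f) +
  \sum_(j < n) D (lshift n j) (D (rshift n j) f).
Proof.
rewrite /Delta_op; congr (_ + _); rewrite [RHS](bigID (fun i : 'I_m1 => (i < r)%N)) /=.
rewrite -sumrN; congr (_ + _).
  apply: eq_bigr => i ir; rewrite /px /= ir ltnNge (leq_trans hr) ?leq_addr //=.
  by rewrite spmulX.
apply: eq_big => [i|i ri]; first by rewrite -leqNgt.
by rewrite /px /= !ltnNge ri (leq_trans hr) ?leq_addr.
Qed.

Lemma eta_opE f : eta f = \sum_(i < m1) qx (lshift m1 i) (qx (rshift m1 i) f) +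
  \sum_(j < n) Th (lshift n j) (Th (rshift n j) f).
Proof.
rewrite /eta_op; congr (_ + _); last by apply: eq_bigr => j _; rewrite !spmulT.
rewrite [RHS](bigID (fun i : 'I_m1 => (i < r)%N)) /=; congr (_ + _).
  apply: eq_bigr => i ir; rewrite /qx /= ir ltnNge (leq_trans hr) ?leq_addr //=.
  by rewrite spdX_mulX eq_lrshift scale0r add0r spmulX.
apply: eq_big => [i|i ri]; first by rewrite -leqNgt.
by rewrite /qx /= !ltnNge ri (leq_trans hr) ?leq_addr //= !spmulX.
Qed.

(* Locked, so that unification never unfolds them. *)
Definition lap : A -> A := locked (@Delta_op F m1 n r).
Definition rsq : A -> A := locked (@eta_op F m1 n r).

Lemma lapE f : lap f = \sum_(i < m1) px (lshift m1 i) (px (rshift m1 i) f) +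
  \sum_(j < n) D (lshift n j) (D (rshift n j) f).
Proof. by rewrite /lap -lock Delta_opE. Qed.

Lemma rsqE f : rsq f = \sum_(i < m1) qx (lshift m1 i) (qx (rshift m1 i) f) +
  \sum_(j < n) Th (lshift n j) (Th (rshift n j) f).
Proof. by rewrite /rsq -lock eta_opE. Qed.

Fact lap_linear : linear lap.
Proof.
move=> c f g; rewrite !lapE scalerDr !scaler_sumr addrACA -!big_split.
by congr (_ + _); apply: eq_bigr => i _; rewrite !(qx_lin, px_lin, mulT_lin, spdtheta_lin).
Qed.

Fact rsq_linear : linear rsq.
Proof.
move=> c f g; rewrite !rsqE scalerDr !scaler_sumr addrACA -!big_split.
by congr (_ + _); apply: eq_bigr => i _; rewrite !(qx_lin, px_lin, mulT_lin, spdtheta_lin).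
Qed.

Definition lap_lin : linear_rules lap := linear_rulesP lap_linear.
Definition rsq_lin : linear_rules rsq := linear_rulesP rsq_linear.

Lemma sum_delta_l (I : finType) (V : lmodType F) (i : I) (G : I -> V) :
  \sum_j (i == j)%:R *: G j = G i.
Proof.
rewrite (bigD1 i) //= eqxx scale1r big1 ?addr0 // => j ij.
by rewrite eq_sym (negPf ij) scale0r.
Qed.

Lemma sum_delta_r (I : finType) (V : lmodType F) (i : I) (G : I -> V) :
  \sum_j (j == i)%:R *: G j = G i.
Proof. by rewrite -[RHS]sum_delta_l; apply: eq_bigr => j _; rewrite eq_sym. Qed.

Lemma lap_qx a f : lap (qx a f) = qx a (lap f) + px (swap a) f.
Proof.
rewrite !lapE !qx_lin addrAC; congr (_ + _); last first.
  by apply: eq_bigr => j _; rewrite !spdtheta_qx.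
under eq_bigr => i _ do rewrite px_qx px_lin px_qx px_lin addrA addrC.
rewrite big_split /=; congr (_ + _); rewrite big_split /=.
elim/half_ind: a => a; rewrite ?swap_lshift ?swap_rshift.
  rewrite big1 => [|i _]; last by rewrite eq_rlshift scale0r.
  by under eq_bigr do rewrite eq_lshift; rewrite sum_delta_r add0r.
rewrite addrC big1 => [|i _]; last by rewrite eq_lrshift scale0r.
by under eq_bigr do rewrite eq_rshift; rewrite sum_delta_r add0r.
Qed.

Lemma lap_px a f : lap (px a f) = px a (lap f).
Proof.
rewrite !lapE !px_lin; congr (_ + _); apply: eq_bigr => i _.
  by rewrite ![px a (px _ _)]pxC.
by rewrite !spdtheta_px.
Qed.

Lemma lap_mulT s f : lap (Th s f) = Th s (lap f) + eps s *: D (swap s) f.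
Proof.
rewrite !lapE !mulT_lin -addrA; congr (_ + _).
  by apply: eq_bigr => i _; rewrite -!mulT_px.
under eq_bigr => j _ do
  rewrite spdtheta_mulT !spdtheta_lin spdtheta_mulT opprB addrCA.
rewrite big_split /=; congr (_ + _); rewrite sumrB.
elim/half_ind: s => s; rewrite ?swap_lshift ?swap_rshift ?eps_lshift ?eps_rshift.
  rewrite big1 => [|i _]; last by rewrite eq_rlshift scale0r.
  by under eq_bigr do rewrite eq_lshift; rewrite sum_delta_r scaleN1r add0r.
rewrite [X in _ - X]big1 => [|i _]; last by rewrite eq_lrshift scale0r.
by under eq_bigr do rewrite eq_rshift; rewrite sum_delta_r scale1r subr0.
Qed.

Lemma lap_spdtheta s f : lap (D s f) = D s (lap f).
Proof.
rewrite !lapE !spdtheta_lin; congr (_ + _); apply: eq_bigr => i _.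
  by rewrite !spdtheta_px.
by rewrite (spdthetaC _ s) ?spdtheta_lin ?mulT_lin (spdthetaC _ s) opprK.
Qed.

Lemma rsq_qx a f : rsq (qx a f) = qx a (rsq f).
Proof.
rewrite !rsqE !qx_lin; congr (_ + _); apply: eq_bigr => i _.
  by rewrite ![qx a (qx _ _)]qxC.
by rewrite !mulT_qx.
Qed.

Lemma rsq_px a f : rsq (px a f) = px a (rsq f) - qx (swap a) f.
Proof.
rewrite !rsqE !px_lin addrAC; congr (_ + _); last first.
  by apply: eq_bigr => j _; rewrite !mulT_px.
under [in RHS]eq_bigr => i _ do rewrite px_qx px_qx !qx_lin addrA.
rewrite big_split /= addrAC; rewrite -[LHS]add0r; congr (_ + _).
apply/eqP; rewrite eq_sym subr_eq0; apply/eqP; rewrite big_split /=.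
elim/half_ind: a => a; rewrite ?swap_lshift ?swap_rshift.
  rewrite [X in _ + X]big1 => [|i _]; last by rewrite eq_lrshift scale0r.
  by under eq_bigr do rewrite eq_lshift; rewrite sum_delta_l addr0.
rewrite big1 => [|i _]; last by rewrite eq_rlshift scale0r.
by under eq_bigr do rewrite eq_rshift; rewrite sum_delta_l add0r.
Qed.

Lemma rsq_mulT s f : rsq (Th s f) = Th s (rsq f).
Proof.
rewrite !rsqE !mulT_lin; congr (_ + _); apply: eq_bigr => i _.
  by rewrite !mulT_qx.
by rewrite (mulTC _ s) ?spdtheta_lin ?mulT_lin (mulTC _ s) opprK.
Qed.

Lemma rsq_spdtheta s f : rsq (D s f) = D s (rsq f) + eps s *: Th (swap s) f.
Proof.
rewrite !rsqE !spdtheta_lin -addrA; congr (_ + _).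
  by apply: eq_bigr => j _; rewrite !spdtheta_qx.
under [in RHS]eq_bigr => j _ do
  rewrite spdtheta_mulT spdtheta_mulT !mulT_lin opprB addrCA.
rewrite big_split /= -[LHS]addr0 -addrA; congr (_ + _).
rewrite sumrB.
elim/half_ind: s => s; rewrite ?swap_lshift ?swap_rshift ?eps_lshift ?eps_rshift.
  rewrite [X in _ - X]big1 => [|i _]; last by rewrite eq_lrshift scale0r.
  under eq_bigr do rewrite eq_lshift; rewrite sum_delta_l subr0 scaleN1r.
  by rewrite subrr.
rewrite [X in X - _]big1 => [|i _]; last by rewrite eq_rlshift scale0r.
under eq_bigr do rewrite eq_rshift; rewrite sum_delta_l scale1r add0r.
by rewrite addNr.
Qed.

(* [lap, rsq] acts on the level k by k + 1 - crit. *)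
Definition crit : int := n%:Z - m1%:Z + r%:Z + 1.

Local Notation N := crit.

(** The commutator receives 1 + q_i p_i + q_i* p_i* from each pair of x, and - 1 + theta_j d_j +
    theta_j* d_j* from each pair of thetas. The sum is the Euler operator of [lev] plus the constant
    m1 - n - r. *)
Lemma lap_rsq k f : ofdeg lev k f ->
  lap (rsq f) = rsq (lap f) + (k + 1 - crit)%:~R *: f.
Proof.
move=> fk; rewrite [in LHS]rsqE lap_lin !lap_lin.
have xE i : lap (qx (lshift m1 i) (qx (rshift m1 i) f)) =
    qx (lshift m1 i) (qx (rshift m1 i) (lap f)) +
    (1 *: f + (qx (lshift m1 i) (px (lshift m1 i) f) + qx (rshift m1 i) (px (rshift m1 i) f))).
  rewrite !lap_qx; move: (lap f) => g; rewrite qx_lin swap_lshift swap_rshift px_qx eqxx.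
  by rewrite -addrA; congr (_ + _); rewrite addrCA.
have tE j : lap (Th (lshift n j) (Th (rshift n j) f)) =
    Th (lshift n j) (Th (rshift n j) (lap f)) +
    ((-1) *: f + (Th (lshift n j) (D (lshift n j) f) + Th (rshift n j) (D (rshift n j) f))).
  rewrite !lap_mulT; move: (lap f) => g; rewrite mulT_lin swap_lshift swap_rshift.
  rewrite eps_lshift eps_rshift mulT_lin scale1r spdtheta_mulT eqxx !scaleN1r scale1r.
  by rewrite -addrA; congr (_ + _); rewrite opprB addrA [RHS]addrC.
under eq_bigr => i _ do rewrite xE.
under [X in _ + X]eq_bigr => j _ do rewrite tE.
rewrite !big_split /= addrACA -rsqE; congr (_ + _).
(* Reordering q_i p_i into x_i d_i costs 1 for each i < r: this is the term r of [crit]. *)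
have qp i : qx i (px i f) = (lev.1 i)%:~R *: mulX i (spdX i f) - (i < r)%N%:R *: f.
  rewrite /qx /px /lev /=; case: (i < r)%N; last by rewrite mulr1z scale1r scale0r subr0.
  by rewrite spdX_lin spdX_mulX eqxx mulrN1z scaleN1r scale1r opprD addrC.
have -> : (k + 1 - crit)%:~R *: f = k%:~R *: f + (m1%:R - n%:R - r%:R) *: f.
  rewrite -scalerDl; congr (_ *: f).
  have -> : k + 1 - crit = k + (m1%:Z - n%:Z - r%:Z) by rewrite /crit; ring.
  by rewrite rmorphD !rmorphB.
have -> : \sum_(i < m1) 1 *: f + (\sum_(i < m1) qx (lshift m1 i) (px (lshift m1 i) f) +
   \sum_(i < m1) qx (rshift m1 i) (px (rshift m1 i) f)) =
   m1%:R *: f + (\sum_i (lev.1 i)%:~R *: mulX i (spdX i f) - r%:R *: f).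
  congr (_ + _); first by rewrite sumr_const card_ord scale1r scaler_nat.
  rewrite -(big_split_ord _ predT (fun i => qx i (px i f))) /=.
  under eq_bigr do rewrite qp; rewrite sumrB; congr (_ - _).
  rewrite -scaler_suml -natr_sum; congr (_%:R *: f).
  have rm : (r <= m)%N by rewrite (leq_trans hr) ?leq_addr.
  rewrite (eq_bigr (fun i : 'I_m => if (i < r)%N then 1%N else 0%N)); last by move=> i; case: ifP.
  by rewrite -big_mkcond /= (big_ord_narrow rm) /= sum1_card card_ord.
have -> : \sum_(i < n) -1 *: f + (\sum_(i < n) Th (lshift n i) (D (lshift n i) f) +
    \sum_(i < n) Th (rshift n i) (D (rshift n i) f)) =
    - (n%:R *: f) + \sum_s (lev.2 s)%:~R *: Th s (D s f).
  congr (_ + _); first by rewrite sumr_const card_ord scaleN1r mulNrn scaler_nat.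
  rewrite big_split_ord /=; congr (_ + _);
    by apply: eq_bigr => j _; rewrite mulr1z scale1r.
rewrite -(euler_ofdeg fk) /euler !scalerBl.
by rewrite [LHS](AC ((1*2)*2) (2*5*(1*4*3))).
Qed.

(** * Degrees of the elements of osp *)

Definition qdeg (w : grading m (n + n)) (i : 'I_m) : int :=
  if (i < r)%N then - w.1 i else w.1 i.

Lemma ofdeg_qx w k i f : ofdeg w k f -> ofdeg w (k + qdeg w i) (qx i f).
Proof.
by rewrite /qx /qdeg; case: ifP => _ fk; [apply: ofdeg_spdX|apply: ofdeg_mulX].
Qed.

Lemma ofdeg_px w k i f : ofdeg w k f -> ofdeg w (k - qdeg w i) (px i f).
Proof.
rewrite /px /qdeg; case: ifP => _ fk; last exact: ofdeg_spdX.
by rewrite opprK; exact/ofdegN/ofdeg_mulX.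
Qed.

Lemma qdeg_lev i : qdeg lev i = 1.
Proof. by rewrite /qdeg /lev /=; case: (i < r)%N. Qed.

Lemma ofdegE w k l f : ofdeg w k f -> k = l -> ofdeg w l f.
Proof. by move=> fk <-. Qed.

(** Antisymmetry of the weights under [swap] gives both terms of [Lxx] the same degree. *)
Lemma ofdeg_Lxx w k i j f : qdeg w (swap i) = - qdeg w i -> qdeg w (swap j) = - qdeg w j ->
  ofdeg w k f -> ofdeg w (k + qdeg w i - qdeg w j) (Lxx i j f).
Proof.
move=> wi wj fk; rewrite /Lxx /Ltt; apply: ofdegB.
  by apply: ofdegE; [exact: (ofdeg_qx (ofdeg_px fk))|ring].
by apply: ofdegE; [exact: (ofdeg_qx (ofdeg_px fk))|rewrite wi wj; ring].
Qed.

Lemma ofdeg_Lxt w k i s f : qdeg w (swap i) = - qdeg w i -> w.2 (swap s) = - w.2 s ->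
  ofdeg w k f -> ofdeg w (k + qdeg w i - w.2 s) (Lxt i s f).
Proof.
move=> wi ws fk; rewrite /Lxt; apply: ofdegD.
  by apply: ofdegE; [exact: (ofdeg_qx (ofdeg_spdtheta fk))|ring].
by apply/ofdegZ/ofdegE; [exact: (ofdeg_mulT (ofdeg_px fk))|rewrite wi ws; ring].
Qed.

Lemma ofdeg_Ltt w k s t f : w.2 (swap s) = - w.2 s -> w.2 (swap t) = - w.2 t ->
  ofdeg w k f -> ofdeg w (k + w.2 s - w.2 t) (Ltt s t f).
Proof.
move=> ws wt fk; rewrite /Lxx /Ltt; apply: ofdegB.
  by apply: ofdegE; [exact: (ofdeg_mulT (ofdeg_spdtheta fk))|ring].
by apply/ofdegZ/ofdegE; [exact: (ofdeg_mulT (ofdeg_spdtheta fk))|rewrite ws wt; ring].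
Qed.

Lemma lev_qx k i f : ofdeg lev k f -> ofdeg lev (k + 1) (qx i f).
Proof. by move=> fk; rewrite -(qdeg_lev i); apply: ofdeg_qx. Qed.

Lemma lev_px k i f : ofdeg lev k f -> ofdeg lev (k - 1) (px i f).
Proof. by move=> fk; rewrite -(qdeg_lev i); apply: ofdeg_px. Qed.

Lemma lev_Lxx k i j f : ofdeg lev k f -> ofdeg lev k (Lxx i j f).
Proof.
move=> fk; rewrite /Lxx /Ltt; apply: ofdegB.
  by apply: ofdegE; [exact: (lev_qx (lev_px fk))|ring].
by apply: ofdegE; [exact: (lev_qx (lev_px fk))|ring].
Qed.

Lemma lev_Lxt k i s f : ofdeg lev k f -> ofdeg lev k (Lxt i s f).
Proof.
move=> fk; rewrite /Lxt; apply: ofdegD.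
  by apply: ofdegE; [exact: (lev_qx (ofdeg_spdtheta fk))|rewrite /=; ring].
by apply/ofdegZ/ofdegE; [exact: (ofdeg_mulT (lev_px fk))|rewrite /=; ring].
Qed.

Lemma lev_Ltt k s t f : ofdeg lev k f -> ofdeg lev k (Ltt s t f).
Proof.
move=> fk; rewrite /Lxx /Ltt; apply: ofdegB.
  by apply: ofdegE; [exact: (ofdeg_mulT (ofdeg_spdtheta fk))|rewrite /=; ring].
by apply/ofdegZ/ofdegE; [exact: (ofdeg_mulT (ofdeg_spdtheta fk))|rewrite /=; ring].
Qed.

Lemma lev_lap k f : ofdeg lev k f -> ofdeg lev (k - 2) (lap f).
Proof.
move=> fk; rewrite lapE; apply: ofdegD; apply: ofdeg_sum => i _.
  by apply: ofdegE; [exact: (lev_px (lev_px fk))|ring].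
by apply: ofdegE; [exact: (ofdeg_spdtheta (ofdeg_spdtheta fk))|rewrite /=; ring].
Qed.

Lemma lev_rsq k f : ofdeg lev k f -> ofdeg lev (k + 2) (rsq f).
Proof.
move=> fk; rewrite rsqE; apply: ofdegD; apply: ofdeg_sum => i _.
  by apply: ofdegE; [exact: (lev_qx (lev_qx fk))|ring].
by apply: ofdegE; [exact: (ofdeg_mulT (ofdeg_mulT fk))|rewrite /=; ring].
Qed.

Lemma lapDZ c f g : lap (f + c *: g) = lap f + c *: lap g.
Proof. by rewrite addrC lap_linear // addrC. Qed.

Lemma rsqDZ c f g : rsq (f + c *: g) = rsq f + c *: rsq g.
Proof. by rewrite addrC rsq_linear // addrC. Qed.

Lemma LxxE i j f : Lxx i j f = qx i (px j f) + (-1) *: qx (swap j) (px (swap i) f).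
Proof. by rewrite scaleN1r. Qed.

Lemma LttE s t f : Ltt s t f =
  Th s (D t f) + (- (eps s * eps t)) *: Th (swap t) (D (swap s) f).
Proof. by rewrite scaleNr. Qed.

Lemma lap_Lxx i j f : lap (Lxx i j f) = Lxx i j (lap f).
Proof.
rewrite !LxxE lapDZ !lap_qx !lap_px.
rewrite swapK [px (swap i) (px j f)]pxC scalerDr addrACA.
by rewrite !scaleN1r [X in _ + X]subrr addr0.
Qed.

Lemma lap_Lxt i s f : lap (Lxt i s f) = Lxt i s (lap f).
Proof.
rewrite [in LHS]/Lxt lapDZ lap_qx lap_mulT.
rewrite lap_px lap_spdtheta swapK eps_swap scalerDr addrACA.
by rewrite scalerA mulrN eps_sq scaleN1r spdtheta_px subrr addr0.
Qed.

Lemma lap_Ltt s t f : lap (Ltt s t f) = Ltt s t (lap f).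
Proof.
rewrite !LttE lapDZ !lap_mulT !lap_spdtheta swapK eps_swap scalerDr addrACA.
rewrite scalerA mulrNN -mulrA eps_sq mulr1 -scalerDr.
by rewrite [D t (D _ f)]spdthetaC subrr scaler0 addr0.
Qed.

Lemma rsq_Lxx i j f : rsq (Lxx i j f) = Lxx i j (rsq f).
Proof.
rewrite !LxxE rsqDZ !rsq_qx !rsq_px; move: (rsq f) => g.
rewrite !qx_lin swapK [qx i (qx _ f)]qxC scalerBr addrACA.
by rewrite !scaleN1r opprK addNr addr0.
Qed.

Lemma rsq_Lxt i s f : rsq (Lxt i s f) = Lxt i s (rsq f).
Proof.
rewrite [in LHS]/Lxt rsqDZ rsq_qx rsq_mulT.
rewrite rsq_px rsq_spdtheta /Lxt; move: (rsq f) => g.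
by rewrite !qx_lin !mulT_lin swapK mulT_qx scalerBr addrACA subrr addr0.
Qed.

Lemma rsq_Ltt s t f : rsq (Ltt s t f) = Ltt s t (rsq f).
Proof.
rewrite !LttE rsqDZ !rsq_mulT !rsq_spdtheta; move: (rsq f) => g.
rewrite !mulT_lin swapK eps_swap scalerDr addrACA scalerA mulrNN mulrAC eps_sq mul1r.
by rewrite -scalerDr [Th s (Th _ f)]mulTC addNr scaler0 addr0.
Qed.

Lemma Lxx_linear i j : linear (Lxx i j).
Proof. by move=> c f g; rewrite /Lxx !(qx_lin, px_lin) scalerBr opprD addrACA. Qed.
Lemma Lxt_linear i s : linear (Lxt i s).
Proof.
move=> c f g; rewrite /Lxt !(qx_lin, px_lin, spdtheta_lin, mulT_lin) !scalerDr addrACA.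
by rewrite !scalerA [c * _]mulrC.
Qed.
Lemma Ltt_linear s t : linear (Ltt s t).
Proof.
move=> c f g; rewrite /Ltt !(spdtheta_lin, mulT_lin) scalerBr !scalerDr opprD addrACA.
by rewrite !scalerA [c * _]mulrC.
Qed.
Definition Lxx_lin i j : linear_rules (Lxx i j) := linear_rulesP (Lxx_linear i j).
Definition Lxt_lin i s : linear_rules (Lxt i s) := linear_rulesP (Lxt_linear i s).
Definition Ltt_lin s t : linear_rules (Ltt s t) := linear_rulesP (Ltt_linear s t).

(** * Equivariant operators and submodules *)

Definition equivariant (u : A -> A) : Prop :=
  [/\ linear u, forall i j f, u (Lxx i j f) = Lxx i j (u f),
      forall i s f, u (Lxt i s f) = Lxt i s (u f) &
      forall s t f, u (Ltt s t f) = Ltt s t (u f)].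

Lemma equivariant_lap : equivariant lap.
Proof. by split; [exact: lap_linear|exact: lap_Lxx|exact: lap_Lxt|exact: lap_Ltt]. Qed.

Lemma equivariant_rsq : equivariant rsq.
Proof. by split; [exact: rsq_linear|exact: rsq_Lxx|exact: rsq_Lxt|exact: rsq_Ltt]. Qed.

Lemma equivariant_iter u d : equivariant u -> equivariant (iter d u).
Proof.
case=> lu uxx uxt utt; elim: d => [|d [IH1 IH2 IH3 IH4]].
  by split=> [c f g|i j f|i s f|s t f]; rewrite /iter.
split=> [c f g|i j f|i s f|s t f]; rewrite !iterS.
- by rewrite IH1 lu.
- by rewrite IH2 uxx.
- by rewrite IH3 uxt.
- by rewrite IH4 utt.
Qed.

Lemma submodule_image u W : equivariant u -> is_submodule r W -> is_submodule r (spimage u W).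
Proof.
case=> lu uxx uxt utt /submoduleP[[W0 sW] xx xt tt]; apply/submoduleP; split.
- split=> [|c f g [f' Wf ->] [g' Wg ->]]; first by exists 0; rewrite // (linear_rulesP lu).
  by exists (c *: f' + g'); rewrite ?lu //; apply: sW.
- by move=> i j f [f' Wf ->]; exists (Lxx i j f'); [exact: xx|rewrite uxx].
- by move=> i j f [f' Wf ->]; exists (Lxt i j f'); [exact: xt|rewrite uxt].
- by move=> i j f [f' Wf ->]; exists (Ltt i j f'); [exact: tt|rewrite utt].
Qed.

Lemma submodule_preim u W : equivariant u -> is_submodule r W ->
  is_submodule r (fun f => W (u f)).
Proof.
case=> lu uxx uxt utt /submoduleP[[W0 sW] xx xt tt]; apply/submoduleP; split.
- split=> [|c f g Wf Wg]; first by rewrite (linear_rulesP lu).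
  by rewrite lu; apply: sW.
- by move=> i j f Wf; rewrite uxx; exact: xx.
- by move=> i j f Wf; rewrite uxt; exact: xt.
- by move=> i j f Wf; rewrite utt; exact: tt.
Qed.

Lemma submodule0 : is_submodule r (@spzero F m (n + n)).
Proof.
rewrite /spzero; apply/submoduleP; split.
- by split=> // c f g -> ->; rewrite scaler0 addr0.
- by move=> i j f ->; rewrite Lxx_lin.
- by move=> i j f ->; rewrite Lxt_lin.
- by move=> i j f ->; rewrite Ltt_lin.
Qed.

Lemma submoduleI W1 W2 : is_submodule r W1 -> is_submodule r W2 ->
  is_submodule r (fun f => W1 f /\ W2 f).
Proof.
case=> [[W10 W1l] a1] [[W20 W2l] a2]; split; [split=> //|].
  by move=> c f g [Wf1 Wf2] [Wg1 Wg2]; split; auto.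
by move=> M f oM [Wf1 Wf2]; split; auto.
Qed.

Lemma submodule_Ak k : is_submodule r (Ak k).
Proof.
apply/submoduleP; split.
- exact: spspan_subspace.
- by move=> i j f /AkP fk; apply/AkP/lev_Lxx.
- by move=> i j f /AkP fk; apply/AkP/lev_Lxt.
- by move=> i j f /AkP fk; apply/AkP/lev_Ltt.
Qed.

Lemma HkP k f : Hk k f <-> ofdeg lev k f /\ lap f = 0.
Proof. by rewrite /Defs.Hk /lap -lock; split=> -[/AkP fk f0]. Qed.

Lemma submodule_Hk k : is_submodule r (Hk k).
Proof.
have [sW aW] : is_submodule r (fun f => Ak k f /\ spzero (lap f)).
  apply: submoduleI; first exact: submodule_Ak.
  exact: (submodule_preim equivariant_lap submodule0).
by move: sW aW; rewrite /lap -lock.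
Qed.

Implicit Types (i j : 'I_m) (s : 'I_(n + n)) (S : {set 'I_(n + n)}) (b : 'X_{1..m}).

Lemma qx_ge i f : (r <= i)%N -> qx i f = X i f.
Proof. by rewrite /qx ltnNge => ->. Qed.
Lemma px_ge i f : (r <= i)%N -> px i f = dX i f.
Proof. by rewrite /px ltnNge => ->. Qed.
Lemma qx_lt i f : (i < r)%N -> qx i f = dX i f.
Proof. by rewrite /qx => ->. Qed.
Lemma px_lt i f : (i < r)%N -> px i f = - X i f.
Proof. by rewrite /px => ->. Qed.

Lemma swap_ge (i : 'I_m) : (i < r)%N -> (r <= swap i)%N.
Proof.
elim/half_ind: i => j; rewrite ?swap_lshift ?swap_rshift /=.
  by move=> _; rewrite (leq_trans hr) ?leq_addr.
by move/leq_trans/(_ hr); rewrite ltnNge leq_addr.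
Qed.

(** * A conjugate pair of polynomial variables *)

Section Pair.

Variables (iu iv : 'I_m).
Hypotheses (ivE : iv = swap iu) (ru : (r <= iu)%N) (rv : (r <= iv)%N).

Let iuE : iu = swap iv. Proof. by rewrite ivE swapK. Qed.
Let uv : iu != iv. Proof. by rewrite ivE eq_sym swap_neq. Qed.
Let vu : (iv == iu) = false. Proof. by rewrite eq_sym (negPf uv). Qed.

Local Notation u := (X iu).
Local Notation v := (X iv).
Local Notation du := (dX iu).
Local Notation dv := (dX iv).

Let iterU a := iter_lin a (mulX_linear (F := F) (p := m) (q := n + n) iu).

Lemma rsq_u f : rsq (u f) = u (rsq f). Proof. by rewrite -!qx_ge // rsq_qx. Qed.
Lemma rsq_v f : rsq (v f) = v (rsq f). Proof. by rewrite -!qx_ge // rsq_qx. Qed.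
Lemma rsq_du f : rsq (du f) = du (rsq f) - v f.
Proof. by rewrite -!px_ge // rsq_px // -ivE qx_ge. Qed.
Lemma rsq_dv f : rsq (dv f) = dv (rsq f) - u f.
Proof. by rewrite -!px_ge // rsq_px // -iuE qx_ge. Qed.
Lemma lap_u f : lap (u f) = u (lap f) + dv f.
Proof. by rewrite -!qx_ge // lap_qx // -ivE px_ge. Qed.
Lemma lap_v f : lap (v f) = v (lap f) + du f.
Proof. by rewrite -!qx_ge // lap_qx // -iuE px_ge. Qed.

Lemma du_v f : du (v f) = v (du f). Proof. exact: spdX_mulX_neq. Qed.
Lemma dv_u f : dv (u f) = u (dv f). Proof. by apply: spdX_mulX_neq; rewrite eq_sym. Qed.

Definition wuv : grading m (n + n) :=
  (fun i : 'I_m => if i == iu then 1 else if i == iv then -1 else 0, fun _ => 0).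

Lemma grade_wuv S b : grade wuv S b = (b iu)%:Z - (b iv)%:Z.
Proof.
rewrite /grade /= sumr_const mul0rn addr0 (bigD1 iu) //= eqxx (bigD1 iv) ?vu //= eqxx.
rewrite big1 ?addr0 ?natz ?mulNrn ?natz // => i /andP[/negPf -> /negPf ->].
by rewrite mul0rn.
Qed.

(** This puts the weight inside osp: submodules contain the weight components of their elements
    ([component_wuv]). *)
Lemma euler_wuv f : euler wuv f = Lxx iu iu f.
Proof.
rewrite /Lxx -ivE !px_ge // !qx_ge //; apply: superpolyP => S b.
by rewrite mcoeff_euler grade_wuv mcoeffspD mcoeffspN !mcoeff_mulX_spdX rmorphB mulrBl.
Qed.

Lemma euler_wuvE f : euler wuv f = u (du f) - v (dv f).
Proof. by rewrite euler_wuv /Lxx -ivE !px_ge // !qx_ge. Qed.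

Lemma component_wuv U a f : is_submodule r U -> U f -> U (component wuv a f).
Proof.
move=> sU; case/submoduleP: (sU) => [sub Uxx _ _]; apply: component_in => // g Ug.
by rewrite euler_wuv; apply: Uxx.
Qed.

Lemma qdeg_wuv i : qdeg wuv i = wuv.1 i.
Proof.
rewrite /qdeg /=; case: ifP => // ir.
case: eqP => [ii|_]; first by rewrite ii ltnNge ru in ir.
by case: eqP => [ii|_ //]; rewrite ii ltnNge rv in ir.
Qed.

Lemma qdeg_wuv_swap i : qdeg wuv (swap i) = - qdeg wuv i.
Proof.
rewrite !qdeg_wuv /=; have [->|iu'] := eqVneq i iu.
  by rewrite -ivE eq_sym (negPf uv) eqxx.
have [->|iv'] := eqVneq i iv; first by rewrite -iuE eqxx opprK.
rewrite iuE ivE !(inj_eq (@swap_inj _)) -ivE.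
by rewrite (negPf iv') (negPf iu').
Qed.

Lemma wuv_rsq a f : ofdeg wuv a f -> ofdeg wuv a (rsq f).
Proof.
move=> fa; rewrite rsqE; apply: ofdegD; apply: ofdeg_sum => i _.
  apply: (ofdegE (ofdeg_qx (ofdeg_qx fa))).
  by rewrite -swap_lshift qdeg_wuv_swap; ring.
by apply: (ofdegE (ofdeg_mulT (ofdeg_mulT fa))); rewrite /=; ring.
Qed.

Lemma component_lev_rsq k f : component lev (k + 2) (rsq f) = rsq (component lev k f).
Proof. by apply: component_shift => [|l g]; [exact: rsq_linear|exact: lev_rsq]. Qed.

Lemma top_v f : f <> 0 -> exists d, iter d dv f <> 0 /\ dv (iter d dv f) = 0.
Proof.
move=> f0; pose P g := exists d, g = iter d dv f.
have low : lowers (fun _ b => b iv) dv.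
  by apply: lowers_spdX => S b; rewrite mnmDE mnm1E eqxx addn1.
have PT : forall (_ : unit) g, true -> P g -> P (dv g) by move=> _ g _ [d ->]; exists d.+1.
have Pf : P f by exists 0%N.
have [_ [[d ->] g0 /(_ tt isT) dg]] :=
  lowers_exhaust (C := xpredT) (T := fun _ : unit => dv) (fun _ _ => low) PT Pf f0.
by exists d.
Qed.

Lemma iter_dv_rsq d f :
  iter d.+1 dv (rsq f) = rsq (iter d.+1 dv f) + d.+1%:R *: u (iter d dv f).
Proof.
have dvr g : dv (rsq g) = rsq (dv g) + u g by rewrite rsq_dv subrK.
elim: d => [|d IH]; first by rewrite /= dvr scale1r.
rewrite iterS IH !spdX_lin dv_u -iterS dvr -iterS -addrA; congr (_ + _).
by rewrite -[X in X + _]scale1r -scalerDl nat1r.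
Qed.

(** rsq raises the degree in v by exactly one: if dv^d f is the last nonzero derivative, then
    dv^(d+1) (rsq f) = (d+1) u (dv^d f). *)
Lemma rsq_inj f : rsq f = 0 -> f = 0.
Proof.
move=> f0; apply: NNPP => /top_v[d [df ddf]]; apply: df.
have := iter_dv_rsq d f; rewrite f0 !iterS ddf rsq_lin add0r.
rewrite (iter_lin _ (spdX_linear iv)) spdX_lin => /esym/eqP.
by rewrite scaler_eq0 pnatr_eq0 /= => /eqP/mulX_inj.
Qed.

(** By the same count, a nonzero element of the image of rsq has positive degree in v. *)
Lemma notin_image f g : f <> 0 -> dv f = 0 -> f <> rsq g.
Proof.
move=> f0 df fg; have [g0|/eqP/top_v[d [dg ddg]]] := eqVneq g 0.
  by apply: f0; rewrite fg g0 rsq_lin.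
apply: dg; have := iter_dv_rsq d g; rewrite -fg [in RHS]iterS ddg rsq_lin add0r.
rewrite iterSr df (iter_lin _ (spdX_linear iv)) => /esym/eqP.
by rewrite scaler_eq0 pnatr_eq0 /= => /eqP/mulX_inj.
Qed.

Lemma lev_rsqK k g : ofdeg lev k (rsq g) -> ofdeg lev (k - 2) g.
Proof.
move=> gk; have : rsq (g - component lev (k - 2) g) = 0.
  by rewrite !rsq_lin -component_lev_rsq subrK component_id // subrr.
move/rsq_inj/eqP; rewrite subr_eq0 => /eqP ->; exact: component_ofdeg.
Qed.

Lemma du_rsq h : du h = 0 -> du (rsq h - u (v h)) = 0.
Proof.
move=> dh; have -> : du (rsq h - u (v h)) = du (rsq h) - (v h + u (v (du h))).
  by rewrite !spdX_lin spdX_mulX eqxx scale1r du_v.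
by rewrite -[du (rsq h)](subrK (v h)) -rsq_du dh rsq_lin add0r !mulX_lin addr0 subrr.
Qed.

Lemma dv_rsq h : dv h = 0 -> dv (rsq h - u (v h)) = 0.
Proof.
move=> dh; have -> : dv (rsq h - u (v h)) = dv (rsq h) - (u h + u (v (dv h))).
  by rewrite !spdX_lin dv_u spdX_mulX eqxx scale1r mulX_lin.
by rewrite -[dv (rsq h)](subrK (u h)) -rsq_dv dh rsq_lin add0r !mulX_lin addr0 subrr.
Qed.

Lemma iter_rsq_u a f : rsq (iter a u f) = iter a u (rsq f).
Proof. by apply: iter_comm => g; rewrite rsq_u. Qed.

(** Modulo the image of rsq, multiplication by u v is minus the contribution of the other pairs.
    Each factor u v of a monomial can thus be removed, by induction on the degree in v. *)
Lemma class_form (a : nat) f : ofdeg wuv a f ->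
  exists h g, [/\ du h = 0, dv h = 0 & f = iter a u h + rsq g].
Proof.
pose W f := exists h g, [/\ du h = 0, dv h = 0 & f = iter a u h + rsq g].
have sW : is_subspace W.
  split=> [|c f1 f2 [h1 [g1 [d1 d1' ->]]] [h2 [g2 [d2 d2' ->]]]].
    by exists 0, 0; rewrite !spdX_lin iterU rsq_lin addr0.
  exists (c *: h1 + h2), (c *: g1 + g2).
  rewrite !spdX_lin d1 d1' d2 d2' scaler0 addr0; split=> //.
  by rewrite !iterU !rsq_lin scalerDr addrACA.
move=> fa; apply: (subspace_span sW) => S b /fa; rewrite grade_wuv => ba.
have [j bj] : exists j : nat, b iv = j by exists (b iv).
elim: j b bj ba => [|j IH] b bj ba.
  have -> : b = (b - U_(iu) *+ a + U_(iu) *+ a)%MM.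
    apply/mnmP => i; rewrite mnmDE mnmBE mulmnE mnm1E.
    by case: eqP => [<-|_]; lia.
  set b' := (b - _)%MM; rewrite -iter_mulX_bas.
  exists (bas b' S), 0; rewrite rsq_lin addr0; split=> //; apply: spdX_bas0.
    by rewrite /b' mnmBE mulmnE mnm1E eqxx; lia.
  by rewrite /b' mnmBE bj.
have [[b1 bE]|] := mnmU_split iv b; last by rewrite bj.
have b1v : b1 iv = j by move: bj; rewrite bE mnmDE mnm1E eqxx; lia.
have b1u : b1 iu = b iu by rewrite bE mnmDE mnm1E vu addn0.
have [[b2 b1E]|] := mnmU_split iu b1; last by rewrite b1u; lia.
have b2v : b2 iv = j by move: b1v; rewrite b1E mnmDE mnm1E (negPf uv) addn0.
have b2u : (b2 iu).+1 = b iu by rewrite -b1u b1E mnmDE mnm1E eqxx addn1.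
have [||h [g [dh dh' bg]]] := IH b2; [by []|lia|].
(* With u v = rsq - T, where T is the contribution of the other pairs, u v (bas b2 S) = rsq (bas b2
   S) - T (u^a h) - T (rsq g), and T commutes with u and rsq. *)
exists (- (rsq h - u (v h))), (bas b2 S - (rsq g - u (v g))).
split; [by rewrite spdX_lin du_rsq ?oppr0|by rewrite spdX_lin dv_rsq ?oppr0|].
have -> : bas b S = u (v (bas b2 S)) by rewrite mulXC !mulX_bas -b1E -bE.
have iuv : iter a u (u (v h)) = u (v (iter a u h)).
  by rewrite -iterSr iterS; congr (u _); rewrite (iter_comm a (T := v)) // => f1; rewrite mulXC.
rewrite [in LHS]bg [in RHS]bg !(iterU, rsq_lin, mulX_lin) iuv iter_rsq_u rsq_u rsq_v.
move: (iter a u (rsq h)) (rsq (rsq g)) => y1 y2.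
by rewrite !opprB [y1 + y2 + _]addrACA subrr addr0 [RHS]addrA subrK.
Qed.

(** * From an element outside the image of rsq to a power of one variable *)

Section Reach.

Variables (k : int) (U : A -> Prop).
Hypothesis sU : is_submodule r U.

(* h is the leading coefficient of an element of U of (u, v)-weight a, modulo the
   image of rsq. *)
Definition cls (a : nat) h : Prop :=
  [/\ du h = 0, dv h = 0, ofdeg lev (k - a%:Z) h & exists g, U (iter a u h + rsq g)].

Lemma clsZ a c h : cls a h -> cls a (c *: h).
Proof.
case=> dh dh' hk [g Ug]; split; rewrite ?spdX_lin ?dh ?dh' ?scaler0 //; first exact: ofdegZ.
exists (c *: g); rewrite iterU rsq_lin -scalerDr; apply: subspaceZ => //.
by case: sU.
Qed.

Lemma clsZK a c h : c != 0 -> cls a (c *: h) -> cls a h.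
Proof. by move=> c0 /(clsZ c^-1); rewrite scalerA mulVf // scale1r. Qed.

Lemma px_u c f : c != iu -> px c (u f) = u (px c f).
Proof. by move=> /negPf ciu; rewrite -!qx_ge // px_qx ciu scale0r add0r. Qed.

Lemma px_iter_u c a f : c != iu -> px c (iter a u f) = iter a u (px c f).
Proof. by move=> ciu; apply: iter_comm => g; apply: px_u. Qed.

(** The other term of [Lxx iu c] contains dv and vanishes on elements free of v; what remains is
    multiplication by u composed with p_c. [cls_spdtheta] is the odd analogue. *)
Lemma cls_px a c h : c != iu -> c != iv -> cls a h -> cls a.+1 (px c h).
Proof.
move=> cu cv [dh dh' hk [g Ug]]; case/submoduleP: (sU) => _ Uxx _ _.
have dpx j : (r <= j)%N -> dX j (px c h) = px c (dX j h).
  by move=> rj; rewrite -!px_ge // pxC.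
split; first by rewrite dpx // dh px_lin.
- by rewrite dpx // dh' px_lin.
- by apply: (ofdegE (lev_px hk)); rewrite -addn1 PoszD; ring.
exists (Lxx iu c g); rewrite rsq_Lxx.
suff -> : iter a.+1 u (px c h) = Lxx iu c (iter a u h) by rewrite -Lxx_lin; exact: Uxx.
rewrite /Lxx px_iter_u // -ivE [px iv _]px_ge // (iter_comm a (T := dv) (T' := u)); last first.
  by move=> f; rewrite spdX_mulX_neq // vu.
by rewrite dh' iterU qx_lin subr0 qx_ge.
Qed.

Lemma cls_spdtheta a s h : cls a h -> cls a.+1 (D s h).
Proof.
move=> [dh dh' hk [g Ug]]; case/submoduleP: (sU) => _ _ Uxt _.
split; first by rewrite -spdtheta_spdX dh spdtheta_lin.
- by rewrite -spdtheta_spdX dh' spdtheta_lin.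
- by apply: (ofdegE (ofdeg_spdtheta hk)); rewrite -addn1 PoszD /=; ring.
exists (Lxt iu s g); rewrite rsq_Lxt.
suff -> : iter a.+1 u (D s h) = Lxt iu s (iter a u h) by rewrite -Lxt_lin; exact: Uxt.
rewrite /Lxt -ivE [px iv _]px_ge // (iter_comm a (T := dv) (T' := u)); last first.
  by move=> f; rewrite spdX_mulX_neq // vu.
rewrite dh' iterU mulT_lin scaler0 addr0 qx_ge // (iter_comm a (T := D s) (T' := u)) // => f.
by rewrite spdtheta_mulX.
Qed.

(** On u^(a+1) h the operator [Lxx iv (swap i)] reduces to - d_i du, since h is free of x_(swap i):
    one factor u is spent for one derivative of h. *)
Lemma cls_lower a i h : (i < r)%N -> dX (swap i) h = 0 -> cls a.+1 h -> cls a (dX i h).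
Proof.
move=> ir di [dh dh' hk [g Ug]]; case/submoduleP: (sU) => _ Uxx _ _.
have iiu : swap i != iu.
  by rewrite iuE (inj_eq (@swap_inj _)); apply: contraTneq ir => ->; rewrite -leqNgt.
have rsi := swap_ge ir.
apply: (@clsZK _ (- a.+1%:R)); first by rewrite oppr_eq0 pnatr_eq0.
split; rewrite ?spdX_lin.
- by rewrite spdXC dh spdX_lin scaler0.
- by rewrite spdXC dh' spdX_lin scaler0.
- apply/ofdegZ; rewrite -qx_lt //; apply: (ofdegE (lev_qx hk)).
  by rewrite -[in LHS]addn1 PoszD; ring.
exists (Lxx iv (swap i) g); rewrite rsq_Lxx.
suff -> : iter a u (- a.+1%:R *: dX i h) = Lxx iv (swap i) (iter a.+1 u h).
  by rewrite -Lxx_lin; exact: Uxx.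
rewrite /Lxx px_iter_u // [px (swap i) _]px_ge // di iterU qx_lin sub0r swapK -iuE [px iu _]px_ge //.
rewrite spdX_iter_mulX0 // qx_lin qx_lt // iterU scaleNr; congr (- (_ *: _)).
apply/esym/iter_comm => f; rewrite spdX_mulX_neq //.
by apply: contraTneq ir => ->; rewrite -leqNgt.
Qed.

(** On u^a h the operator [Lxx i j] reduces to - x_j d_i, which leaves the weight unchanged. *)
Lemma cls_move a i j h : (i < r)%N -> (j < r)%N -> i != j -> dX (swap i) h = 0 ->
  cls a h -> cls a (X j (dX i h)).
Proof.
move=> ir jr ij di [dh dh' hk [g Ug]]; case/submoduleP: (sU) => _ Uxx _ _.
have jP c : (r <= c)%N -> c != j by move=> rc; apply: contraTneq jr => <-; rewrite -leqNgt.
have iiu : i != iu by apply: contraTneq ir => ->; rewrite -leqNgt.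
have siu : swap i != iu.
  by rewrite iuE (inj_eq (@swap_inj _)); apply: contraTneq ir => ->; rewrite -leqNgt.
have rsi := swap_ge ir.
split.
- by rewrite spdX_mulX_neq ?jP // spdXC dh spdX_lin mulX_lin.
- by rewrite spdX_mulX_neq ?jP // spdXC dh' spdX_lin mulX_lin.
- rewrite -[X j _]opprK; apply: ofdegN; rewrite -px_lt // -qx_lt //.
  by apply: (ofdegE (lev_px (lev_qx hk))); ring.
exists (- Lxx i j g); rewrite rsq_lin rsq_Lxx.
suff -> : iter a u (X j (dX i h)) = - Lxx i j (iter a u h).
  rewrite -opprD -Lxx_lin; apply: subspaceN; [by case: sU|exact: Uxx].
rewrite /Lxx [px (swap i) _]px_iter_u // [px (swap i) h]px_ge // di iterU qx_lin subr0.
rewrite px_iter_u; last by rewrite eq_sym jP.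
rewrite px_lt // iterU qx_lin opprK qx_lt // (iter_comm a (T := dX i) (T' := u)); last first.
  by move=> f; rewrite spdX_mulX_neq.
by rewrite spdX_mulX_neq.
Qed.

(** The leading coefficients that neither [cls_px], for indices c >= r, nor [cls_spdtheta] can lower
    any further. *)
Definition inner h : Prop := (forall c : 'I_m, (r <= c)%N -> dX c h = 0) /\ (forall s, D s h = 0).

Lemma inner_supp h S b : inner h -> (h S)@_b != 0 ->
  S = set0 /\ (forall c : 'I_m, (r <= c)%N -> b c = 0%N).
Proof.
case=> dh Dh hS; split=> [|c /dh dc]; last exact: spdX_eq0 dc hS.
by apply/setP => s; rewrite inE; apply/negbTE; apply: spdtheta_eq0 (Dh s) hS.
Qed.

Lemma inner_lev l h S b : inner h -> ofdeg lev l h -> (h S)@_b != 0 -> l = - (mdeg b)%:Z.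
Proof.
move=> ih hl hS; have [S0 bc] := inner_supp ih hS; rewrite -(hl _ _ hS) /grade S0 big_set0 addr0.
rewrite mdegE -natz natr_sum -sumrN; apply: eq_bigr => i _ /=.
by case: ltnP => [_|/bc ->]; rewrite ?mulr0n ?oppr0 // mulNrn.
Qed.

Lemma inner_spdX i h : inner h -> inner (dX i h).
Proof.
by case=> dh Dh; split=> [c rc|s]; [rewrite spdXC dh // spdX_lin|rewrite spdtheta_spdX Dh spdX_lin].
Qed.

Lemma one_var_eq i0 e h : (forall i, i != i0 -> dX i h = 0) -> (forall s, D s h = 0) ->
  (forall S b, (h S)@_b != 0 -> b i0 = e) ->
  h = (h set0)@_(U_(i0) *+ e) *: bas (U_(i0) *+ e)%MM set0.
Proof.
move=> dh Dh he; apply: superpolyP => S b; rewrite mcoeffspZ basE.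
have [hS0|hS] := eqVneq (h S)@_b 0.
  case: andP => [[/eqP S0 /eqP b0]|_]; last by rewrite hS0 mulr0.
  by move: hS0; rewrite S0 b0 => ->; rewrite mul0r.
have S0 : S = set0.
  by apply/setP => s; rewrite inE; apply/negbTE; apply: spdtheta_eq0 (Dh s) hS.
have b0 : b = (U_(i0) *+ e)%MM.
  apply/mnmP => i; rewrite mulmnE mnm1E; have [<-|ii0] := eqVneq i0 i.
    by rewrite mul1n; apply: he hS.
  by rewrite mul0n; apply: spdX_eq0 hS; apply: dh; rewrite eq_sym.
by rewrite S0 b0 !eqxx mulr1.
Qed.

(** Derivatives of the leading coefficient are applied until none survives. Each raises the weight
    by one, so the final a' is not controlled here; it is recovered later from the level. *)
Lemma cls_inner f (a : nat) : U f -> ofdeg lev k f -> ofdeg wuv a f ->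
  (forall g, f <> rsq g) -> exists a' h, [/\ cls a' h, h <> 0 & inner h].
Proof.
move=> Uf fk fa fg; have [h [g [dh dh' fE]]] := class_form fa.
pose P h := exists a', cls a' h.
pose C (c : 'I_m + 'I_(n + n)) := if c is inl c then [&& (r <= c)%N, c != iu & c != iv] else true.
pose T (c : 'I_m + 'I_(n + n)) := match c with inl c => dX c | inr s => D s end.
pose w S b := (mdeg b + #|S|)%N.
have low c : C c -> lowers w (T c).
  case: c => [c|s] _ /=.
    by apply: lowers_spdX => S b; rewrite /w mdegD mdeg1 addn1 addSn.
  by apply: lowers_spdtheta => S b sS; rewrite /w cardsU1 sS add1n addnS.
have PT c h1 : C c -> P h1 -> P (T c h1).
  case: c => [c /and3P[rc cu cv]|s _] [a' h1a].
    by exists a'.+1; rewrite /= -px_ge //; apply: cls_px.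
  by exists a'.+1; apply: cls_spdtheta.
(* [class_form] does not give a homogeneous h, so h is replaced by its component of level k - a. *)
have ph : P (component lev (k - a%:Z) h).
  exists a; split.
  - by rewrite -component_spdX dh component_lin.
  - by rewrite -component_spdX dh' component_lin.
  - exact: component_ofdeg.
  exists (component lev (k - 2) g).
  rewrite -component_lev_rsq // subrK -component_iter_mulX.
  have -> : k - a%:Z + lev.1 iu *+ a = k.
    by rewrite /= ltnNge ru /= -mulr_natr mul1r natz subrK.
  by rewrite -component_lin -fE component_id.
(* If this component vanished, f would be in the image of rsq. *)
have h0 : component lev (k - a%:Z) h <> 0.
  move=> h0; apply: (fg (component lev (k - 2) g)).
  rewrite -component_lev_rsq // subrK -[f in LHS](component_id fk) fE component_lin.
  have -> : k = k - a%:Z + lev.1 iu *+ a.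
    by rewrite /= ltnNge ru /= -mulr_natr mul1r natz subrK.
  by rewrite component_iter_mulX h0 iterU add0r.
have [h' [[a' h'a] h'0 h'd]] := lowers_exhaust low PT ph h0.
exists a', h'; split=> //; split=> [c rc|s]; last exact: (h'd (inr s)).
have [-> |cu] := eqVneq c iu; first by case: h'a.
have [-> |cv] := eqVneq c iv; first by case: h'a.
by apply: (h'd (inl c)); rewrite /= rc cu cv.
Qed.

Lemma neq0_coef f : f <> 0 -> exists S b, (f S)@_b != 0.
Proof.
move=> f0; apply: NNPP => fS; apply: f0; apply: superpolyP => S b; rewrite mcoeffsp0.
by apply/eqP/negPn/negP => Sb; apply: fS; exists S, b.
Qed.

Lemma inner_swap h i : inner h -> (i < r)%N -> dX (swap i) h = 0.
Proof. by case=> dh _ /swap_ge /dh. Qed.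

Lemma cls_scalar a e h i0 : cls a h -> h <> 0 -> (forall i, i != i0 -> dX i h = 0) ->
  (forall s, D s h = 0) -> (forall S b, (h S)@_b != 0 -> b i0 = e) ->
  cls a (bas (U_(i0) *+ e)%MM set0).
Proof.
move=> ha h0 dh Dh /(one_var_eq dh Dh) hE; rewrite hE in ha; apply: clsZK ha.
by apply: contra_notN h0 => /eqP c0; rewrite hE c0 scale0r.
Qed.

(** The inner variables are differentiated away with [cls_lower] until h is a constant; the level
    then forces the weight to be k. *)
Lemma reach_pos f (a : nat) : 0 <= k -> U f -> ofdeg lev k f -> ofdeg wuv a f ->
  (forall g, f <> rsq g) -> exists g, U (iter (absz k) u one + rsq g).
Proof.
move=> k0 Uf fk fa fg; have [a1 [h1 [h1a h10 h1i]]] := cls_inner Uf fk fa fg.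
(* The case h = 0 is included because [cls_lower] needs a positive weight, which [inner_lev]
   provides only when the derivative is nonzero. *)
pose P h := h = 0 \/ (exists a', cls a' h) /\ inner h.
have low (i : 'I_m) : (i < r)%N -> lowers (fun _ b => mdeg b) (dX i).
  by move=> _; apply: lowers_spdX => S b; rewrite mdegD mdeg1 addn1.
have PT (i : 'I_m) h : (i < r)%N -> P h -> P (dX i h).
  move=> ir [->|[[a' ha] hi]]; first by left; rewrite spdX_lin.
  have [dh0|/eqP/neq0_coef[S [b Sb]]] := eqVneq (dX i h) 0; [by left|right].
  have hS : (h S)@_(b + U_(i)) != 0.
    by move: Sb; rewrite mcoeff_spdX; apply: contraNneq => ->; rewrite mul0rn.
  have [_ _ hk _] := ha; have := inner_lev hi hk hS; rewrite mdegD mdeg1 => kE.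
  case: a' ha kE {hk} => [|a'] ha kE; first lia.
  split; last exact: inner_spdX.
  by exists a'; apply: cls_lower => //; apply: inner_swap.
have Ph1 : P h1 by right; split=> //; exists a1.
have [h [[->//|[[a' ha] hi] h0 dh]]] := lowers_exhaust low PT Ph1 h10.
have dh' i : i != iu -> dX i h = 0.
  by move=> _; case: (ltnP i r) => [/dh//|/(proj1 hi)].
have he S b : (h S)@_b != 0 -> b iu = 0%N.
  by move=> Sb; have [_ bc] := inner_supp hi Sb; apply: bc.
have := cls_scalar ha h0 dh' (proj2 hi) he; rewrite mulm0n => -[_ _ onek [g Ug]].
exists g; suff -> : absz k = a' by [].
have : (one set0)@_0%MM != 0 by rewrite basE !eqxx oner_eq0.
move/onek; rewrite /grade big_set0 addr0 big1 => [|i _]; last by rewrite mnm0E.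
by lia.
Qed.

(** As k < 0, the leading coefficient has degree a - k > 0, so [cls_lower] can bring the weight down
    to 0. Then [cls_move] gathers all variables into x_i0. *)
Lemma reach_neg f (a : nat) i0 : k < 0 -> (i0 < r)%N -> U f -> ofdeg lev k f ->
  ofdeg wuv a f -> (forall g, f <> rsq g) -> exists g, U (iter (absz k) (X i0) one + rsq g).
Proof.
move=> k0 i0r Uf fk fa fg; have [a1 [h1 [h1a h10 h1i]]] := cls_inner Uf fk fa fg.
have [h2 [h2a h20 h2i]] : exists h, [/\ cls 0 h, h <> 0 & inner h].
  elim: a1 h1 h1a h10 h1i => [|a1 IH] h1 h1a h10 h1i; first by exists h1.
  have [S [b Sb]] := neq0_coef h10; have [_ _ hk _] := h1a.
  have := inner_lev h1i hk Sb => kE.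
  have [i bi] : exists i, (0 < b i)%N.
    apply: NNPP => bi; suff : mdeg b = 0%N by lia.
    rewrite mdegE big1 // => i _; apply/eqP; rewrite -leqn0 leqNgt; apply/negP => bi0.
    by apply: bi; exists i.
  have ir : (i < r)%N.
    by case: ltnP => // ri; have [_ /(_ i ri) bi0] := inner_supp h1i Sb; rewrite bi0 in bi.
  apply: (IH (dX i h1)); first by apply: cls_lower => //; apply: inner_swap.
    by move=> dh; have := spdX_eq0 dh Sb; lia.
  exact: inner_spdX.
(* The element of osp is x_i0 d_i, which preserves the degree. The factors x_i0 it creates are
   counted apart by l, so that on h only d_i acts and the degree drops. *)
pose P h := (exists l : nat, cls 0 (iter l (X i0) h)) /\ inner h.
pose C (i : 'I_m) := (i < r)%N && (i != i0).
have low i : C i -> lowers (fun _ b => mdeg b) (dX i).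
  by move=> _; apply: lowers_spdX => S b; rewrite mdegD mdeg1 addn1.
have comm_i0 (l : nat) c h : c != i0 -> dX c (iter l (X i0) h) = iter l (X i0) (dX c h).
  by move=> ci0; apply: iter_comm => g; rewrite spdX_mulX_neq.
have PT i h : C i -> P h -> P (dX i h).
  case/andP=> ir ii0 [[l hl] hi]; split; last exact: inner_spdX.
  exists l.+1; rewrite iterS -comm_i0 //; apply: cls_move => //.
  rewrite comm_i0 ?(inner_swap hi) ?(iter_lin _ (mulX_linear _)) //.
  by apply: contraTneq (swap_ge ir) => ->; rewrite -ltnNge.
have Ph2 : P h2 by split=> //; exists 0%N.
have [h [[[l hl] hi] h0 dh]] := lowers_exhaust low PT Ph2 h20.
have hl0 : iter l (X i0) h <> 0 by move/iter_mulX_inj.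
have dhl i : i != i0 -> dX i (iter l (X i0) h) = 0.
  move=> ii0; rewrite comm_i0 // (_ : dX i h = 0) ?(iter_lin _ (mulX_linear _)) //.
  by case: (ltnP i r) => [ir|/(proj1 hi)//]; apply: dh; rewrite /C ir ii0.
have Dhl s : D s (iter l (X i0) h) = 0.
  rewrite (iter_comm _ (T := D s) (T' := X i0)) => [|g]; last by rewrite spdtheta_mulX.
  by rewrite (proj2 hi) (iter_lin _ (mulX_linear _)).
have il : inner (iter l (X i0) h).
  split=> // c rc; apply: dhl; apply: contraTneq rc => ->; by rewrite -ltnNge.
have he S b : (iter l (X i0) h S)@_b != 0 -> b i0 = absz k.
  move=> Sb; have [_ _ hk _] := hl; have := inner_lev il hk Sb.
  rewrite mdegE (bigD1 i0) //= big1 => [|i ii0]; first by lia.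
  by apply: spdX_eq0 Sb; apply: dhl.
have [_ _ _ [g Ug]] := cls_scalar hl hl0 dhl Dhl he.
by exists g; rewrite iter_mulX_bas add0m.
Qed.

End Reach.

(** * From a power of one variable to all harmonic elements of weight at least 0 *)

Section Generate.

Variables (k : int) (U : A -> Prop).
Hypothesis sU : is_submodule r U.

Lemma iter_X_one i (e : nat) : iter e (X i) one = bas (U_(i) *+ e)%MM set0.
Proof. by rewrite iter_mulX_bas add0m. Qed.

(** On these monomials [Lxx i0 i] is - x_i d_i0 and moves one factor from x_i0 to x_i; the induction
    is on the degree in the variables other than x_i0. *)
Lemma gen_inner0 i0 b : k < 0 -> (i0 < r)%N -> U (iter (absz k) (X i0) one) ->
  grade lev set0 b = k -> (forall c : 'I_m, (r <= c)%N -> b c = 0%N) -> U (bas b set0).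
Proof.
move=> k0 i0r U0; case/submoduleP: (sU) => sub Uxx _ _.
have [e eE] : exists e, (\sum_(i | i != i0) b i = e)%N by eexists.
elim: e b eE => [|e IH] b eE bk bc.
  suff -> : b = (U_(i0) *+ absz k)%MM by rewrite -iter_X_one.
  have b0 i : i != i0 -> b i = 0%N.
    by move=> ii0; move/eqP: eE; rewrite sum_nat_eq0 => /forall_inP/(_ i ii0)/eqP.
  have : (b i0)%:Z = - k.
    rewrite -bk /grade big_set0 addr0 (bigD1 i0) //= i0r big1 ?addr0 ?mulNrn ?opprK ?natz //.
    by move=> i /b0 ->; rewrite mulr0n.
  move=> bi0; apply/mnmP => i; rewrite mulmnE mnm1E.
  have [<-|ii0] := eqVneq i0 i; first by rewrite mul1n; lia.
  by rewrite b0 // eq_sym.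
have [i /andP[ii0 bi]] : exists i, (i != i0) && (0 < b i)%N.
  apply/existsP; apply: contraT; rewrite negb_exists => /forallP bi.
  move: eE; rewrite big1 // => i ii0; have := bi i; rewrite ii0 /= -eqn0Ngt => /eqP //.
have ir : (i < r)%N by case: ltnP => // /bc bi0; rewrite bi0 in bi.
have [[b1 bE]|bi0] := mnmU_split i b; last by rewrite bi0 in bi.
have i0i : i0 != i by rewrite eq_sym.
have Ub1 : U (bas (b1 + U_(i0)) set0).
  apply: IH.
  - move: eE; rewrite bE (bigD1 i) //= [in X in _ -> X](bigD1 i) //= !mnmDE !mnm1E eqxx (negPf i0i).
    rewrite addn0 addn1 addSn => -[<-]; congr (_ + _)%N; apply: eq_bigr => j /andP[ji0 ji].
    by rewrite !mnmDE !mnm1E ![_ == j]eq_sym (negPf ji0) (negPf ji).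
  - by rewrite -bk bE !gradeX /= ir i0r.
  - move=> c rc; have := bc c rc; rewrite bE !mnmDE !mnm1E => /eqP.
    rewrite addn_eq0 => /andP[/eqP -> _]; rewrite add0n.
    by case: eqP => // i0c; move: rc; rewrite -i0c leqNgt i0r.
apply: (subspaceZK sub (_ : - (b1 i0).+1%:R != 0)); first by rewrite oppr_eq0 pnatr_eq0.
suff <- : Lxx i0 i (bas (b1 + U_(i0)) set0) = - (b1 i0).+1%:R *: bas b set0 by exact: Uxx.
rewrite /Lxx px_lt // [px (swap i0) _]px_ge ?swap_ge // [dX (swap i0) _]spdX_bas0; last first.
  have := bc _ (swap_ge i0r); rewrite bE !mnmDE !mnm1E => /eqP.
  rewrite addn_eq0 => /andP[/eqP -> _]; rewrite add0n; case: eqP => // i0s.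
  by move: (swap_ge i0r); rewrite -i0s leqNgt i0r.
rewrite !qx_lin subr0 qx_lt // spdX_mulX_neq // spdX_bas mulX_lin mulX_bas -bE.
by rewrite scaleNr.
Qed.

Hypothesis base : if 0 <= k then U (iter (absz k) u one) else
  exists2 i0 : 'I_m, (i0 < r)%N & U (iter (absz k) (X i0) one).

(** On monomials free of v the operator [Lxx iu i] is multiplication by - u x_i, which allows an
    induction on the degree in u. *)
Lemma gen_inner b : grade lev set0 b = k ->
  (forall c : 'I_m, (r <= c)%N -> c != iu -> b c = 0%N) -> U (bas b set0).
Proof.
case/submoduleP: (sU) => sub Uxx _ _.
have [t tE] : exists t : nat, b iu = t by eexists.
elim: t b tE => [|t IH] b tE bk bc.
  have bc' (c : 'I_m) : (r <= c)%N -> b c = 0%N.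
    by move=> rc; have [->|cu] := eqVneq c iu; [|exact: bc].
  move: base; case: ifP => k0 => [Uu|[i0 i0r Ui0]]; last first.
    by apply: (gen_inner0 _ i0r Ui0) => //; rewrite ltNge k0.
  have bk0 : k = (b iu)%:Z - (\sum_(i : 'I_m | (i < r)%N) b i)%:Z.
    rewrite -bk /grade big_set0 addr0 (bigID (fun i : 'I_m => (i < r)%N)) /= addrC.
    rewrite big1 => [|i]; last by rewrite -leqNgt => /bc' ->; rewrite mulr0n.
    rewrite tE sub0r add0r -natz natr_sum -sumrN; apply: eq_bigr => i ->.
    by rewrite mulNrn.
  have kn : k = 0 by move: bk0; rewrite tE; lia.
  suff -> : b = (U_(iu) *+ absz k)%MM by rewrite -iter_X_one.
  have bs : (\sum_(i : 'I_m | (i < r)%N) b i = 0)%N by move: bk0; rewrite tE kn; lia.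
  apply/mnmP => i; rewrite kn mulmnE muln0; case: (ltnP i r) => [ir|/bc' //].
  by move/eqP: bs; rewrite sum_nat_eq0 => /forall_inP/(_ i ir)/eqP.
case: (pickP (fun i : 'I_m => (i < r)%N && (0 < b i)%N)) => [i /andP[ir bi]|b0]; last first.
  have bE : b = (U_(iu) *+ t.+1)%MM.
    apply/mnmP => i; rewrite mulmnE mnm1E; have [<-|iui] := eqVneq iu i.
      by rewrite tE mul1n.
    rewrite mul0n; case: (ltnP i r) => [ir|ri]; last by apply: bc => //; rewrite eq_sym.
    by have := b0 i; rewrite ir /=; case: (b i).
  have kt : k = t.+1.
    rewrite -bk /grade big_set0 addr0 (bigD1 iu) //= ltnNge ru /= tE big1 ?addr0 ?natz // => i iui.
    by rewrite bE mulmnE mnm1E eq_sym (negPf iui) mulr0n.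
  by move: base; rewrite bE kt /= -iter_X_one.
have iiu : i != iu by apply: contraTneq ir => ->; rewrite -leqNgt.
have iui : iu != i by rewrite eq_sym.
have iiv : i != iv by apply: contraTneq ir => ->; rewrite -leqNgt.
have [[b1 bE]|bi0] := mnmU_split i b; last by rewrite bi0 in bi.
have b1u : b1 iu = t.+1 by rewrite -tE bE mnmDE mnm1E (negPf iiu) addn0.
have [[b2 b1E]|b10] := mnmU_split iu b1; last by rewrite b10 in b1u.
have b2u : b2 iu = t by move: b1u; rewrite b1E mnmDE mnm1E eqxx addn1 => -[].
have b2v : b2 iv = 0%N.
  have := bc iv rv; rewrite vu bE b1E !mnmDE => /(_ isT)/eqP; rewrite !addn_eq0.
  by case/andP => /andP[/eqP].
have Ub2 : U (bas b2 set0).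
  apply: IH => //.
    by rewrite -bk bE b1E !gradeX /= ir ltnNge ru /= addrK.
  move=> c rc cu; have := bc c rc cu; rewrite bE b1E !mnmDE => /eqP; rewrite !addn_eq0.
  by case/andP => /andP[/eqP].
suff -> : bas b set0 = - Lxx iu i (bas b2 set0) by apply: subspaceN => //; exact: Uxx.
rewrite /Lxx px_lt // -ivE [px iv _]px_ge // spdX_bas0 // !qx_lin subr0 opprK.
by rewrite qx_ge // mulXC !mulX_bas -b1E -bE.
Qed.

(** Modulo multiples of v, [Lxt iv (swap s)] and [Lxx iv (swap i)] act up to sign as theta_s du and
    x_i du. They turn a factor u into any other factor, and the multiples of v are dealt with by
    [harmonic_order]. *)
Lemma gen_lead S b : grade lev S b = k -> b iv = 0%N ->
  exists f g, [/\ U f, ofdeg wuv (b iu)%:Z f & f = bas b S + v g].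
Proof.
case/submoduleP: (sU) => sub Uxx Uxt _.
pose C (i : 'I_m) := [&& (r <= i)%N, i != iu & i != iv].
have [t tE] : exists t, (#|S| + \sum_(i | C i) b i = t)%N by eexists.
elim: t S b tE => [|t IH] S b tE bk bv.
  move/eqP: tE; rewrite addn_eq0 cards_eq0 => /andP[/eqP S0]; rewrite sum_nat_eq0 => /forall_inP bC.
  exists (bas b S), 0; rewrite mulX_lin addr0; split=> //.
    rewrite S0; apply: gen_inner => [|c rc cu]; first by rewrite -S0.
    by have [->|cv] := eqVneq c iv; [|apply/eqP/bC; rewrite /C rc cu].
  by rewrite -[X in ofdeg _ X](_ : grade wuv S b = _); [exact: ofdeg_bas|rewrite grade_wuv // bv subr0].
(* The factor to be produced is first traded for a factor u, which keeps the level and lowers t. *)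
have lift b1 S1 : (#|S1| + \sum_(i | C i) b1 i = t)%N -> grade lev S1 b1 = k - 1 ->
    b1 iv = 0%N -> exists f g, [/\ U f, ofdeg wuv (b1 iu).+1%:Z f &
      f = bas (b1 + U_(iu)) S1 + v g].
  move=> b1t b1k b1v; have [|||f [g [Uf fw fE]]] := IH S1 (b1 + U_(iu))%MM.
  - rewrite -b1t; congr (_ + _)%N; apply: eq_bigr => i /and3P[_ iiu _].
    by rewrite mnmDE mnm1E eq_sym (negPf iiu) addn0.
  - by rewrite gradeX b1k /= ltnNge ru /= subrK.
  - by rewrite mnmDE mnm1E (negPf uv) addn0.
  by exists f, g; split=> //; move: fw; rewrite mnmDE mnm1E eqxx addn1.
have finish (c : F) f g : c != 0 -> U f -> ofdeg wuv (b iu)%:Z f ->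
    f = c *: bas b S + v g ->
    exists f g, [/\ U f, ofdeg wuv (b iu)%:Z f & f = bas b S + v g].
  move=> c0 Uf fw fE; exists (c^-1 *: f), (c^-1 *: g); split.
  - exact: subspaceZ.
  - exact: ofdegZ.
  - by rewrite mulX_lin fE scalerDr scalerA mulVf // scale1r.
have [S0|[s sS]] := set_0Vmem S; last first.
  have sS1 : s \notin S :\ s by rewrite setD11.
  have [|||f [g [Uf fw fE]]] := lift b (S :\ s).
  - by move: tE; rewrite (cardsD1 s) sS addSn => -[].
  - by rewrite -bk -[in RHS](setD1K sS) gradeT //= addrK.
  - exact: bv.
  have duf : du f = (b iu).+1%:R *: bas b (S :\ s) + v (du g).
    by rewrite fE spdX_lin spdX_bas du_v.
  apply: (finish (eps (swap s) * (b iu).+1%:R * koszul F s (S :\ s)) (Lxt iv (swap s) f)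
    (D (swap s) f + eps (swap s) *: Th s (du g))).
  - rewrite !mulf_neq0 ?koszul_neq0 ?pnatr_eq0 // /eps.
    by case: ifP; rewrite ?oppr_eq0 oner_eq0.
  - exact: Uxt.
  - have qw := qdeg_wuv_swap; have qd := qdeg_wuv.
    apply: ofdegE; first by apply: (ofdeg_Lxt _ _ fw); rewrite ?qw //= oppr0.
    by rewrite qd /= eqxx vu; lia.
  rewrite /Lxt swapK -iuE qx_ge // px_ge // duf mulT_lin mulT_lin mulT_bas //.
  by rewrite setD1K // mulX_lin mulX_lin mulT_mulX !scalerDr !scalerA addrCA.
case: (pickP (fun i => C i && (0 < b i)%N)) => [i /andP[Ci bi]|b0]; last first.
  move: tE; rewrite S0 cards0 add0n big1 // => i Ci; have := b0 i.
  by rewrite Ci /=; case: (b i).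
have [[b1 bE]|bi0] := mnmU_split i b; last by rewrite bi0 in bi.
case/and3P: (Ci) => ri iu' iv'.
have b1u : b1 iu = b iu by rewrite bE mnmDE mnm1E (negPf iu') addn0.
have [|||f [g [Uf fw fE]]] := lift b1 S.
- move: tE; rewrite bE (bigD1 i) //= [in X in _ -> X](bigD1 i) //= mnmDE mnm1E eqxx addn1.
  rewrite addSn addnS => -[<-]; congr (_ + (_ + _))%N; apply: eq_bigr => j /andP[_ ji].
  by rewrite mnmDE mnm1E eq_sym (negPf ji) addn0.
- by rewrite -bk bE gradeX /= ltnNge ri addrK.
- by move: bv; rewrite bE mnmDE mnm1E (negPf iv') addn0.
have duf : du f = (b iu).+1%:R *: bas b1 S + v (du g).
  by rewrite fE spdX_lin spdX_bas du_v // -b1u.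
apply: (finish (- (b iu).+1%:R) (Lxx iv (swap i) f) (px (swap i) f - X i (du g))).
- by rewrite oppr_eq0 pnatr_eq0.
- exact: Uxx.
- have qw := qdeg_wuv_swap; have qd := qdeg_wuv.
  apply: ofdegE; first by apply: (ofdeg_Lxx _ _ fw); rewrite ?qw.
  by rewrite qw !qd /= eqxx vu (negPf iu') (negPf iv') -b1u; lia.
rewrite /Lxx swapK -iuE [qx iv _]qx_ge // [px iu f]px_ge // qx_ge // duf.
by rewrite !mulX_lin mulX_bas -bE scaleNr [X i (v _)]mulXC opprD addrCA.
Qed.

Lemma lap_iter_v (t : nat) f :
  lap (iter t.+1 v f) = iter t v (v (lap f) + t.+1%:R *: du f).
Proof.
have vL := iter_lin _ (mulX_linear (F := F) (p := m) (q := n + n) iv).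
elim: t => [|t IH]; first by rewrite /= lap_v scale1r.
rewrite iterS lap_v IH -iterS (iter_comm _ (T := du) (T' := v)); last first.
  by move=> g; rewrite du_v.
have vD x y : iter t.+1 v x + iter t.+1 v y = iter t.+1 v (x + y) by rewrite vL.
rewrite vD -addrA; congr (iter t.+1 v (_ + _)).
by rewrite -[X in _ + X]scale1r -scalerDl natr1.
Qed.

(* A harmonic f of weight a >= 0 that is divisible by v is divisible by every power of v. *)
Lemma harmonic_order (a : nat) f : ofdeg wuv a f -> lap f = 0 -> (exists g, f = v g) -> f = 0.
Proof.
move=> fa lf [g fg].
suff H (t : nat) : exists g, f = iter t.+1 v g.
  apply: superpolyP => S b; rewrite mcoeffsp0; have [h ->] := H (b iv).
  by rewrite mcoeff_iter_mulX.
elim: t => [|t [h fh]]; first by exists g.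
have wv : wuv.1 iv = -1 by rewrite /= vu eqxx.
pose h1 := component wuv (a%:Z + t.+1%:Z) h.
have fh1 : f = iter t.+1 v h1.
  rewrite /h1 -component_iter_mulX -fh wv mulNrn natz addrK component_id //.
have := euler_ofdeg (@component_ofdeg _ _ _ wuv (a%:Z + t.+1%:Z) h).
rewrite -/h1 euler_wuvE => h1w.
(* lap f = 0 makes du h1 divisible by v, hence also (a + t + 1) h1 = u (du h1) - v (dv h1), and the
   scalar is nonzero because a >= 0. *)
have dh1 : du h1 = - v (t.+1%:R^-1 *: lap h1).
  have : v (lap h1) + t.+1%:R *: du h1 = 0.
    by apply: (@iter_mulX_inj _ _ _ iv t); rewrite -lap_iter_v -fh1.
  rewrite addrC => /eqP; rewrite addr_eq0 => /eqP duE.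
  by rewrite mulX_lin -scalerN -duE scalerA mulVf ?scale1r // pnatr_eq0.
pose c : F := (a%:Z + t.+1%:Z)%:~R; have c0 : c != 0 by rewrite intr_eq0; lia.
exists (c^-1 *: - (u (t.+1%:R^-1 *: lap h1) + dv h1)).
rewrite [LHS]fh1 [RHS]iterSr; congr (iter t.+1 v _).
rewrite mulX_lin -[LHS](scalerK c0) -h1w dh1; congr (_ *: _).
by rewrite !mulX_lin mulXC opprD.
Qed.

Hypothesis UH : forall f, U f -> ofdeg lev k f /\ lap f = 0.

(** [gen_lead] gives an element f' of U with f - f' divisible by v; this difference is harmonic of
    weight a, hence 0. *)
Lemma generate (a : nat) f : ofdeg lev k f -> lap f = 0 -> ofdeg wuv a f -> U f.
Proof.
case: (sU) => sub _ fk lf fw.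
pose W f := exists f' g, [/\ U f', ofdeg wuv a f' & f = f' + v g].
have sW : is_subspace W.
  split=> [|c f1 f2 [f1' [g1 [U1 w1 ->]]] [f2' [g2 [U2 w2 ->]]]].
    by exists 0, 0; rewrite mulX_lin addr0; split=> //; [case: sub|exact: ofdeg0].
  exists (c *: f1' + f2'), (c *: g1 + g2); split.
  - by case: sub => _; apply.
  - by apply: ofdegD => //; apply: ofdegZ.
  - by rewrite !mulX_lin scalerDr addrACA.
have [f' [g [Uf' fw' fE]]] : W f.
  apply: (subspace_span sW) => S b Sb; have bk := fk _ _ Sb.
  have := fw _ _ Sb; rewrite grade_wuv // => bw.
  have [[b1 bE]|bv] := mnmU_split iv b.
    by exists 0, (bas b1 S); rewrite mulX_bas -bE add0r; split=> //; [case: sub|exact: ofdeg0].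
  have bu : b iu = a by move: bw; rewrite bv; lia.
  have [f' [g [Uf' fw' fE]]] := gen_lead bk bv.
  exists f', (- g); rewrite mulX_lin fE addrK -bu; split=> //; by rewrite -fE.
have [f'k lf'] := UH Uf'.
suff : f - f' = 0 by move/eqP; rewrite subr_eq0 => /eqP ->.
apply: (@harmonic_order a); first exact: ofdegB.
  by rewrite !lap_lin lf lf' subrr.
by exists g; rewrite fE addrC addKr.
Qed.

End Generate.

End Pair.

Lemma one_neq0 i (e : nat) : iter e (X i) one <> 0.
Proof. by move/iter_mulX_inj/bas_neq0. Qed.

Lemma spdX_iter_one i j (e : nat) : i != j -> dX i (iter e (X j) one) = 0.
Proof.
move=> ij; rewrite (iter_comm _ (T := dX i) (T' := X j)) => [|g].
  by rewrite spdX_bas0 ?mnm0E // (iter_lin _ (mulX_linear _)).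
by rewrite spdX_mulX_neq.
Qed.

Lemma lap_one : lap one = 0.
Proof.
rewrite lapE !big1 ?addr0 // => [j _|i _].
  rewrite (_ : D _ one = 0) ?spdtheta_lin //.
  apply: superpolyP => S b; rewrite mcoeff_spdtheta basE mcoeffsp0.
  case: ifP => // _; case: eqP => [/setP/(_ (rshift n j))|]; last by rewrite mulr0.
  by rewrite !inE eqxx.
rewrite (px_ge _ (_ : (r <= rshift m1 i)%N)); last by rewrite /= (leq_trans hr) ?leq_addr.
by rewrite spdX_bas0 ?mnm0E // px_lin.
Qed.

Lemma lev_one : ofdeg lev 0 one.
Proof.
have <- : grade lev set0 0%MM = 0; last exact: ofdeg_bas.
by rewrite /grade big_set0 addr0 big1 // => i _; rewrite mnm0E mulr0n.
Qed.

Lemma Hk_iter_X_ge (i : 'I_m) (e : nat) : (r <= i)%N -> (r <= swap i)%N ->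
  Hk e (iter e (X i) one).
Proof.
move=> ri rsi; apply/HkP => //; split.
  by have := ofdeg_iter_mulX (i := i) (s := e) lev_one; rewrite /= ltnNge ri /= add0r natz.
elim: e => [|e IH]; first exact: lap_one.
rewrite iterS -(qx_ge _ ri) lap_qx // IH qx_lin add0r.
by rewrite px_ge // spdX_iter_one // swap_neq.
Qed.

Lemma Hk_iter_X_lt (i : 'I_m) (e : nat) : (i < r)%N -> Hk (- e%:Z) (iter e (X i) one).
Proof.
move=> ir; apply/HkP => //; split.
  by have := ofdeg_iter_mulX (i := i) (s := e) lev_one; rewrite /= ir /= add0r mulNrn natz.
elim: e => [|e IH]; first exact: lap_one.
by rewrite iterS -[X i _]opprK -(px_lt _ ir) lap_lin lap_px // IH px_lin oppr0.
Qed.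

(** * Both steps for one ordering of the pair *)

Section OneSide.

Variables (iu iv : 'I_m).
Hypotheses (ivE : iv = swap iu) (ru : (r <= iu)%N) (rv : (r <= iv)%N).
Variables (k : int) (U : A -> Prop).
Hypotheses (sU : is_submodule r U) (UH : forall f, U f -> Hk k f).

Lemma one_side_generate (a : nat) :
  (if 0 <= k then U (iter (absz k) (X iu) one) else
   exists2 i0 : 'I_m, (i0 < r)%N & U (iter (absz k) (X i0) one)) ->
  forall f, Hk k f -> ofdeg (wuv iu iv) a f -> U f.
Proof.
move=> base f /HkP[fk lf] fa; apply: (generate ivE ru rv sU base _ fk lf fa).
by move=> g /UH /HkP.
Qed.

(** The reached element is known modulo the image of rsq. The error is harmonic, hence belongs to U
    by the hypothesis on the elements of H_k in the image. *)
Lemma one_side_reach (a : nat) f :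
  (forall f, Hk k f -> (exists g, f = rsq g) -> U f) -> (k < 0 -> (0 < r)%N) ->
  U f -> ofdeg (wuv iu iv) a f -> (forall g, f <> rsq g) ->
  if 0 <= k then U (iter (absz k) (X iu) one) else
    exists2 i0 : 'I_m, (i0 < r)%N & U (iter (absz k) (X i0) one).
Proof.
move=> RU k0r Uf fa fR; case: (sU) => sub _.
have /HkP[fk lf] := UH Uf.
have fin y : Hk k y -> (exists g, U (y + rsq g)) -> U y.
  move=> Hy [g Ug]; rewrite -[y](addrK (rsq g)); apply: subspaceB => //.
  apply: RU; last by exists g.
  have -> : rsq g = (y + rsq g) - y by rewrite addrC addKr.
  by apply: subspaceB => //; [case: (submodule_Hk k)|exact: UH].
case: ifP => k0.
  apply: fin; last exact: (reach_pos ivE ru rv sU k0 Uf fk fa fR).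
  by have := Hk_iter_X_ge (absz k) ru; rewrite -ivE gez0_abs //; apply.
have {}k0 : k < 0 by rewrite ltNge k0.
have r0 := k0r k0; have i0P : (0 < m)%N by rewrite (leq_trans r0) // (leq_trans hr) ?leq_addr.
exists (Ordinal i0P) => //; apply: fin.
  by have := Hk_iter_X_lt (absz k) (_ : (Ordinal i0P < r)%N); rewrite ltz0_abs ?opprK //; apply.
exact: (reach_neg ivE ru rv sU k0 _ Uf fk fa fR).
Qed.

End OneSide.

Lemma image_submodule : is_submodule r (fun f => exists g, f = rsq g).
Proof.
have sT : is_submodule r (fun _ : A => True) by split; [split|].
have [[[g _ g0] Rl] Ra] := submodule_image equivariant_rsq sT.
split; [split=> [|c f1 f2 [g1 ->] [g2 ->]]|move=> M f oM [g1 ->]].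
- by exists g.
- by case: (Rl c (rsq g1) (rsq g2)) => [||g3 _ E]; [exists g1|exists g2|exists g3].
- by case: (Ra M (rsq g1) oM) => [|g3 _ E]; [exists g1|exists g3].
Qed.

(** Each term of lap lowers [right_deg], which ignores the x_i that lap multiplies in for i < r. The
    terms of rsq with i < r or in the thetas lower [left_deg], where the thetas are counted by their
    absence. *)
Definition right_deg S b : nat := (\sum_(i < m1) b (rshift m1 i) + #|S|)%N.
Definition left_deg S b : nat := (\sum_(i < m1) b (lshift m1 i) + (n + n - #|S|))%N.

Lemma right_degU S b (j : 'I_m1) : right_deg S (b + U_(rshift m1 j))%MM = (right_deg S b).+1.
Proof.
rewrite /right_deg -addSn; congr (_ + _)%N.
rewrite (bigD1 j) //= [in RHS](bigD1 j) //= mnmDE mnm1E eqxx addn1 addSn; congr (_ + _).+1.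
by apply: eq_bigr => i ij; rewrite mnmDE mnm1E eq_rshift eq_sym (negPf ij) addn0.
Qed.

Lemma right_degU0 S b (j : 'I_m1) : right_deg S (b + U_(lshift m1 j))%MM = right_deg S b.
Proof.
rewrite /right_deg; congr (_ + _)%N.
by apply: eq_bigr => i _; rewrite mnmDE mnm1E eq_lrshift addn0.
Qed.

Lemma left_degU S b (j : 'I_m1) : left_deg S (b + U_(lshift m1 j))%MM = (left_deg S b).+1.
Proof.
rewrite /left_deg -addSn; congr (_ + _)%N.
rewrite (bigD1 j) //= [in RHS](bigD1 j) //= mnmDE mnm1E eqxx addn1 addSn; congr (_ + _).+1.
by apply: eq_bigr => i ij; rewrite mnmDE mnm1E eq_lshift eq_sym (negPf ij) addn0.
Qed.

Lemma left_degU0 S b (j : 'I_m1) : left_deg S (b + U_(rshift m1 j))%MM = left_deg S b.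
Proof.
rewrite /left_deg; congr (_ + _)%N.
by apply: eq_bigr => i _; rewrite mnmDE mnm1E eq_rlshift addn0.
Qed.

Lemma lowers_pxpx (i : 'I_m1) : lowers right_deg (fun f => px (lshift m1 i) (px (rshift m1 i) f)).
Proof.
move=> f S b; rewrite [px (rshift m1 i) f]px_ge; last by rewrite (leq_trans hr) ?leq_addr.
have dXr g S1 b1 : (dX (rshift m1 i) g S1)@_b1 != 0 -> (g S1)@_(b1 + U_(rshift m1 i)) != 0.
  by rewrite mcoeff_spdX; apply: contraNneq => ->; rewrite mul0rn.
have [ir|ri] := ltnP i r.
  rewrite px_lt // mcoeffspN oppr_eq0.
  have [[b1 ->]|bi] := mnmU_split (lshift m1 i) b; last by rewrite mcoeff_mulX bi eqxx.
  rewrite mcoeff_mulXU => /dXr fb; exists S, (b1 + U_(rshift m1 i))%MM.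
  by rewrite right_degU right_degU0.
rewrite px_ge // mcoeff_spdX => fb; exists S, (b + U_(lshift m1 i) + U_(rshift m1 i))%MM.
rewrite right_degU right_degU0; split=> //; apply: dXr.
by apply: contraNneq fb => ->; rewrite mul0rn.
Qed.

Lemma lowers_DD (j : 'I_n) : lowers right_deg (fun f => D (lshift n j) (D (rshift n j) f)).
Proof.
move=> f S b; rewrite mcoeff_spdtheta; case: ifP => [_|/negbT lS]; rewrite ?eqxx // => fb.
have : (D (rshift n j) f (lshift n j |: S))@_b != 0.
  by apply: contraNneq fb => ->; rewrite mulr0.
rewrite mcoeff_spdtheta; case: ifP => [_|/negbT rS]; rewrite ?eqxx // => {}fb.
exists (rshift n j |: (lshift n j |: S)), b; split.
  by apply: contraNneq fb => ->; rewrite mulr0.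
by rewrite /right_deg !cardsU1 lS rS; lia.
Qed.

Lemma lowers_lap : lowers right_deg lap.
Proof.
move=> f S b; rewrite lapE; apply: (lowersD (T1 := fun f => \sum_i _) (T2 := fun f => \sum_i _)).
  by apply: lowers_sum => i _; apply: lowers_pxpx.
by apply: lowers_sum => j _; apply: lowers_DD.
Qed.

Lemma lap_nilpotent f : exists t, iter t lap f = 0.
Proof. exact: (lowers_nilpotent lap_linear lowers_lap). Qed.

Lemma lowers_qxqx (i : 'I_m1) : (i < r)%N ->
  lowers left_deg (fun f => qx (lshift m1 i) (qx (rshift m1 i) f)).
Proof.
move=> ir f S b; rewrite [qx (rshift m1 i) f]qx_ge; last by rewrite (leq_trans hr) ?leq_addr.
rewrite qx_lt // spdX_mulX_neq ?eq_lrshift //.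
have [[b1 ->]|bi] := mnmU_split (rshift m1 i) b; last by rewrite mcoeff_mulX bi eqxx.
rewrite mcoeff_mulXU mcoeff_spdX => fb; exists S, (b1 + U_(lshift m1 i))%MM.
rewrite left_degU left_degU0; split=> //.
by apply: contraNneq fb => ->; rewrite mul0rn.
Qed.

Lemma lowers_ThTh (j : 'I_n) : lowers left_deg (fun f => Th (lshift n j) (Th (rshift n j) f)).
Proof.
move=> f S b; rewrite mcoeff_mulT; case: ifP => [lS|_]; rewrite ?eqxx // => fb.
have : (Th (rshift n j) f (S :\ lshift n j))@_b != 0.
  by apply: contraNneq fb => ->; rewrite mulr0.
rewrite mcoeff_mulT; case: ifP => [rS|_]; rewrite ?eqxx // => {}fb.
exists (S :\ lshift n j :\ rshift n j), b; split.
  by apply: contraNneq fb => ->; rewrite mulr0.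
rewrite /left_deg; have := max_card S; rewrite card_ord.
rewrite (cardsD1 (lshift n j) S) lS (cardsD1 (rshift n j) (S :\ _)) rS !add1n.
by move: #|S :\ _ :\ _| (\sum_(i < m1) _)%N => c d; lia.
Qed.

(* For r = m1 - 1, the pair of index l is the only one on which rsq is not nilpotent. *)
Lemma rsq_rest_nilpotent (l : 'I_m1) : (forall i : 'I_m1, i != l -> (i < r)%N) ->
  forall f, exists t, iter t (fun f => rsq f - qx (lshift m1 l) (qx (rshift m1 l) f)) f = 0.
Proof.
move=> lr; apply: (lowers_nilpotent (stat := left_deg)).
  by move=> c f g; rewrite rsq_linear // !qx_lin scalerBr opprD addrACA.
move=> f S b; rewrite rsqE (bigD1 l) //= -(addrA (qx _ _)) addrAC subrr add0r.
apply: (lowersD (T1 := fun f => \sum_(i | _) _) (T2 := fun f => \sum_i _)).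
  by apply: lowers_sum => i /lr; apply: lowers_qxqx.
by apply: lowers_sum => j _; apply: lowers_ThTh.
Qed.

Lemma rsq_nilpotent : r = m1 -> forall f, exists t, iter t rsq f = 0.
Proof.
move=> rm; apply: (lowers_nilpotent (stat := left_deg)); first exact: rsq_linear.
move=> f S b; rewrite rsqE.
apply: (lowersD (T1 := fun f => \sum_i _) (T2 := fun f => \sum_i _)).
  by apply: lowers_sum => i _; apply: lowers_qxqx; rewrite rm.
by apply: lowers_sum => j _; apply: lowers_ThTh.
Qed.

(** * Direct sum decompositions *)

Let levP k (c : F) f g : ofdeg lev k f -> ofdeg lev k g -> ofdeg lev k (c *: f + g).
Proof. by move=> fk gk; apply: ofdegD => //; apply: ofdegZ. Qed.

Lemma split_lev k (t : nat) f : ofdeg lev k f -> iter t lap f = 0 ->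
  (forall e : nat, (0 < e < t)%N -> k - N <> e%:Z) ->
  exists2 g, ofdeg lev (k - 2) g & lap (f - rsq g) = 0.
Proof. exact: (split_harmonic lap_linear rsq_linear levP lev_lap lev_rsq lap_rsq). Qed.

Lemma Hk_image_below k f g : k <= N -> Hk k f -> ofdeg lev (k - 2) g -> f = rsq g -> f = 0.
Proof.
move=> kN /HkP[fk lf] gk fg; have [t gt] := lap_nilpotent g.
suff g0 : g = 0 by rewrite fg g0 rsq_lin.
rewrite fg in lf; apply: (injective_below lap_linear rsq_linear lev_lap lap_rsq gk _ lf gt).
by rewrite lerD2r.
Qed.

Lemma decomposition k :
  (forall f, ofdeg lev k f -> exists2 g, ofdeg lev (k - 2) g & lap (f - rsq g) = 0) ->
  (forall f g, Hk k f -> ofdeg lev (k - 2) g -> f = rsq g -> f = 0) ->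
  direct_sum (Ak k) (Hk k) (spimage rsq (Ak (k - 2))).
Proof.
move=> ex un; split=> [f|f Hf [g /AkP gk]]; last exact: un.
have rk g : ofdeg lev (k - 2) g -> ofdeg lev k (rsq g).
  by move=> gk; apply: (ofdegE (lev_rsq gk)); ring.
split=> [/AkP fk|[g [h [/HkP[gk _] [h' /AkP hk ->] ->]]]]; last first.
  by apply/AkP/ofdegD => //; apply: rk.
have [g gk fg] := ex f fk; exists (f - rsq g), (rsq g); split.
- by apply/HkP; split=> //; apply: ofdegB => //; apply: rk.
- by exists g => //; apply/AkP.
- by rewrite subrK.
Qed.

Lemma decomposition_below k : k <= N ->
  direct_sum (Ak k) (Hk k) (spimage rsq (Ak (k - 2))).
Proof.
move=> kN; apply: decomposition => [f fk|f g]; last exact: Hk_image_below.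
have [t ft] := lap_nilpotent f; apply: (split_lev fk ft) => e /andP[e0 _]; lia.
Qed.

Lemma lev_negative k f : r = 0%N -> k < 0 -> ofdeg lev k f -> f = 0.
Proof.
move=> r0 k0 fk; apply: superpolyP => S b; rewrite mcoeffsp0; apply/eqP/negPn/negP => /fk.
rewrite /grade => kE; suff : 0 <= k by rewrite leNgt k0.
rewrite -kE addr_ge0 ?sumr_ge0 // => i _; rewrite /= r0 ltn0.
exact: mulrn_wge0.
Qed.

(** For r = 0 negative levels are zero. So lap^(k - N) f = 0, and [split_lev] only has to avoid
    exponents below k - N; and a harmonic element of the image would come from H_(2N - k) = 0. *)
Lemma decomposition_above k : r = 0%N -> (0 < m1)%N -> 0 <= k -> 2 * N < k ->
  direct_sum (Ak k) (Hk k) (spimage rsq (Ak (k - 2))).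
Proof.
move=> r0 m0 k0 kN; have Nk : N < k by lia.
have neg f : ofdeg lev (2 * N - k) f -> f = 0 by apply: lev_negative => //; lia.
apply: decomposition => [f fk|f g /HkP[fk lf] gk fg].
  apply: (split_lev (t := absz (k - N)) fk) => [|e]; last by lia.
  apply: neg; apply: (ofdegE (lvl_iter_d lev_lap _ fk)); lia.
have ru : (r <= lshift m1 (Ordinal m0))%N by rewrite r0.
have rv : (r <= rshift m1 (Ordinal m0))%N by rewrite r0.
have ivE : rshift m1 (Ordinal m0) = swap (lshift m1 (Ordinal m0)) by rewrite swap_lshift.
have inj : injective rsq.
  move=> f1 f2 f12; apply/eqP; rewrite -subr_eq0; apply/eqP/(rsq_inj ivE ru rv).
  by rewrite !rsq_lin f12 subrr.
have [h [hk _ ->]] := harmonic_image rsq_linear levP lev_lap lev_rsq lap_rsq inj Nk gk fg lf.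
by rewrite (neg _ hk) (iter_lin _ rsq_linear).
Qed.

Lemma Hk_zero_above k f : r = m1 -> n%:Z < k -> Hk k f -> f = 0.
Proof.
move=> rm kn /HkP[fk lf]; have [t ft] := rsq_nilpotent rm f.
apply: (no_harmonic_above lap_linear rsq_linear lev_rsq lap_rsq fk _ lf ft).
by rewrite /crit rm; lia.
Qed.

(** Above N the nilpotency of rsq makes H_k vanish and every f lie in the image of rsq. *)
Lemma decomposition_all k : r = m1 -> direct_sum (Ak k) (Hk k) (spimage rsq (Ak (k - 2))).
Proof.
move=> rm; have [kN|Nk] := leP k N; first exact: decomposition_below.
apply: decomposition => [f fk|f g Hf _ _]; last first.
  by apply: Hk_zero_above Hf => //; move: Nk; rewrite /crit rm; lia.
have [t ft] := rsq_nilpotent rm f.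
have [g gk fg] := image_above lap_linear rsq_linear levP lev_lap lev_rsq lap_rsq fk (ltW Nk) ft.
by exists g => //; rewrite fg subrr lap_lin.
Qed.

Lemma irreducible_image u W : equivariant u -> (forall f, W f -> u f = 0 -> f = 0) ->
  irreducible_submodule r W -> irreducible_submodule r (spimage u W).
Proof.
move=> eu inj [sW [f0 Wf0 f00] irr]; split; first exact: submodule_image.
  by exists (u f0); [exists f0|move/(inj _ Wf0)].
move=> U sU UW; case: (irr (fun f => W f /\ U (u f))).
- exact: submoduleI (submodule_preim eu sU).
- by move=> f [].
- move=> U0; left=> f Uf; have [g Wg fg] := UW f Uf.
  rewrite fg (U0 g) ?(linear_rulesP (let: And4 lu _ _ _ := eu in lu)) //.
  by rewrite -fg.
by move=> UW'; right=> f [g Wg ->]; case: (UW' g Wg).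
Qed.

Lemma generated_submodule (X : A -> Prop) : is_submodule r (generated r X).
Proof.
split; first split=> [W [[W0 _] _] _ //|c f g Xf Xg W sW XW].
  by case: (sW) => -[_ Wl] _; apply: Wl; [exact: Xf|exact: Xg].
by move=> M f oM Xf W sW XW; case: (sW) => _; apply=> //; apply: Xf.
Qed.

Lemma generated_gen (X : A -> Prop) f : X f -> generated r X f.
Proof. by move=> Xf W _; apply. Qed.

(** * Submodules of H_k when r < m1 *)

Section LastPair.

Variable l : 'I_m1.
Hypothesis rl : (r <= l)%N.
Local Notation iu := (lshift m1 l).
Local Notation iv := (rshift m1 l).
Local Notation u := (X iu).
Local Notation v := (X iv).
Local Notation du := (dX iu).
Local Notation dv := (dX iv).
Local Notation wt := (wuv iu iv).

Let ivE : iv = swap iu. Proof. by rewrite swap_lshift. Qed.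
Let iuE : iu = swap iv. Proof. by rewrite swap_rshift. Qed.
Let ru : (r <= iu)%N. Proof. by []. Qed.
Let rv : (r <= iv)%N. Proof. by rewrite (leq_trans hr) ?leq_addr. Qed.
Let uv : iu != iv. Proof. by rewrite eq_lrshift. Qed.

Lemma ofdeg_wuv_swap a f : ofdeg wt a f -> ofdeg (wuv iv iu) (- a) f.
Proof.
by move=> fa S b /fa; rewrite !grade_wuv ?eq_sym // ?(grade_wuv rv) // => <-; rewrite opprB.
Qed.

Lemma weight_cases (U : A -> Prop) f : is_submodule r U ->
  (forall a : nat, U (component wt a f)) ->
  (forall a : nat, U (component wt (- a%:Z) f)) -> U f.
Proof.
case=> sub _ Up Un; apply: (subspace_components (w := wuv iu iv) sub) => a.
by have [a0|a0] := leP 0 a; [rewrite -(gez0_abs a0)|rewrite -[a]opprK -(ltz0_abs a0)].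
Qed.

(** For k < 0 the condition does not mention the pair, and for k = 0 both powers are the constant 1.
    Thus for k <= 0 the two signs of the weight are linked at once. *)
Lemma base_swap k (U : A -> Prop) i j : (k <= 0 ->
  (if 0 <= k then U (iter (absz k) (X i) one) else
   exists2 i0 : 'I_m, (i0 < r)%N & U (iter (absz k) (X i0) one)) ->
  (if 0 <= k then U (iter (absz k) (X j) one) else
   exists2 i0 : 'I_m, (i0 < r)%N & U (iter (absz k) (X i0) one)))%R.
Proof.
by move=> k0; case: ifP => // k0'; have -> : k = 0 by lia.
Qed.

Lemma weight0 f : dX iu f = 0 -> dX iv f = 0 -> ofdeg wt 0 f.
Proof.
move=> du0 dv0 S b fS; rewrite grade_wuv //.
by rewrite (spdX_eq0 du0 fS) (spdX_eq0 dv0 fS).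
Qed.

Lemma quotient_irreducible k (U : A -> Prop) :
  is_submodule r U -> (forall f, U f -> Hk k f) ->
  (forall f, Hk k f -> (exists g, f = rsq g) -> U f) -> (k < 0 -> (0 < r)%N) ->
  k <= 0 \/ (exists f0, [/\ f0 <> 0, Hk k f0, dX iu f0 = 0 & dX iv f0 = 0]) ->
  (exists2 f, U f & forall g, f <> rsq g) -> forall f, Hk k f -> U f.
Proof.
move=> sU UH RU k0r cond [f Uf fR].
pose wu := wuv iu iv; pose wv := wuv iv iu.
pose Bu := if 0 <= k then U (iter (absz k) (X iu) one) else
   exists2 i0 : 'I_m, (i0 < r)%N & U (iter (absz k) (X i0) one).
pose Bv := if 0 <= k then U (iter (absz k) (X iv) one) else
   exists2 i0 : 'I_m, (i0 < r)%N & U (iter (absz k) (X i0) one).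
have reach_u (a : nat) g : U g -> ofdeg wu a g -> (forall h, g <> rsq h) -> Bu.
  by move=> Ug ga gR; apply: (one_side_reach ivE ru rv sU UH RU k0r Ug ga gR).
have reach_v (a : nat) g : U g -> ofdeg wv a g -> (forall h, g <> rsq h) -> Bv.
  by move=> Ug ga gR; apply: (one_side_reach iuE rv ru sU UH RU k0r Ug ga gR).
have gen_u (a : nat) g : Bu -> Hk k g -> ofdeg wu a g -> U g.
  by move=> b Hg ga; apply: (one_side_generate ivE ru rv sU UH b Hg ga).
have gen_v (a : nat) g : Bv -> Hk k g -> ofdeg wv a g -> U g.
  by move=> b Hg ga; apply: (one_side_generate iuE rv ru sU UH b Hg ga).
have BB : Bu /\ Bv.
  (* If neither side were reached, all weight components of f would be in the image of rsq, and so
     would f. *)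
  have [Bu0|Bv0] : Bu \/ Bv.
    apply: NNPP => nB; have [im0 im1] := image_submodule.
    case: (weight_cases (f := f) image_submodule) => [a|a|g]; last exact: fR.
      apply: NNPP => nR; apply: nB; left; apply: (reach_u a (component wu a f)).
      - exact: (component_wuv ivE ru rv _ sU Uf).
      - exact: component_ofdeg.
      by move=> h hE; apply: nR; exists h.
    apply: NNPP => nR; apply: nB; right.
    apply: (reach_v a (component wu (- a%:Z) f)); first exact: (component_wuv ivE ru rv _ sU Uf).
      by have := ofdeg_wuv_swap (@component_ofdeg _ _ _ wu (- a%:Z) f); rewrite opprK.
    by move=> h hE; apply: nR; exists h.
  (* [f0] has weight 0 for both orderings of the pair. It is in U by the side already reached, and,
     being free of v, it is outside the image, so the other side is reached from it. *)
  - split=> //; case: cond => [k0|[f0 [f00 Hf0 du0 dv0]]]; first exact: (base_swap _ k0 Bu0).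
    apply: (reach_v 0%N f0) => [||g].
    + by apply: (gen_u 0%N) => //; apply: weight0.
    + by move: (ofdeg_wuv_swap (weight0 du0 dv0)); rewrite oppr0.
    + exact: (notin_image ivE ru rv f00 dv0).
  split=> //; case: cond => [k0|[f0 [f00 Hf0 du0 dv0]]]; first exact: (base_swap _ k0 Bv0).
  apply: (reach_u 0%N f0) => [||g].
  - apply: (gen_v 0%N) => //.
    by move: (ofdeg_wuv_swap (weight0 du0 dv0)); rewrite oppr0.
  - exact: weight0.
  - exact: (notin_image ivE ru rv f00 dv0).
move=> g Hg; have sH := submodule_Hk k.
apply: weight_cases => // a.
  by apply: (gen_u a) => //; [case: BB|exact: (component_wuv ivE ru rv _ sH Hg)|exact: component_ofdeg].
apply: (gen_v a) => //; [by case: BB|exact: (component_wuv ivE ru rv _ sH Hg)|].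
by have := ofdeg_wuv_swap (@component_ofdeg _ _ _ wu (- a%:Z) g); rewrite opprK.
Qed.

Lemma rsq_injective : injective rsq.
Proof.
move=> f1 f2 f12; apply/eqP; rewrite -subr_eq0; apply/eqP/(rsq_inj ivE ru rv).
by rewrite !rsq_lin f12 subrr.
Qed.

Definition Rk k : A -> Prop := spimage (iter (absz (k - N)) rsq) (Hk (2 * N - k)).

Lemma RkP k f : N < k -> Rk k f <-> Hk k f /\ exists g, f = rsq g.
Proof.
move=> Nk; split=> [[h /HkP[hk lh] ->]|[/HkP[fk lf] [g fg]]].
  case tE: (absz (k - N)) => [|t]; first by lia.
  split; last by exists (iter t rsq h).
  apply/HkP; split; first by apply: (ofdegE (lvl_iter_e lev_rsq _ hk)); lia.
  rewrite (d_iter_e rsq_linear lev_rsq lap_rsq t hk) lh.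
  rewrite (iter_lin _ rsq_linear) add0r (_ : 2 * N - k - N + _ = 0) ?mulr0 ?scale0r //; lia.
have gk : ofdeg lev (k - 2) g by apply: (lev_rsqK ivE ru rv); rewrite -fg.
have [h [hk lh fh]] :=
  harmonic_image rsq_linear levP lev_lap lev_rsq lap_rsq rsq_injective Nk gk fg lf.
by exists h => //; apply/HkP.
Qed.

Lemma submodule_Rk k : is_submodule r (Rk k).
Proof.
apply: submodule_image; last exact: submodule_Hk.
exact/equivariant_iter/equivariant_rsq.
Qed.

(* Being of weight 0, such an f0 lets a submodule pass from weights of one sign to weights
   of the other; for k <= 0 a monomial in the x_i, i < r, does it. *)
Definition spare k : Prop :=
  k <= 0 \/ exists f0, [/\ f0 <> 0, Hk k f0, dX iu f0 = 0 & dX iv f0 = 0].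

Lemma spare_var (c : 'I_m1) k : 0 <= k -> (r <= c)%N -> c != l -> spare k.
Proof.
move=> k0 rc cl; right; exists (iter (absz k) (X (lshift m1 c)) one); split.
- exact: one_neq0.
- have := @Hk_iter_X_ge (lshift m1 c) (absz k) rc.
  by rewrite swap_lshift gez0_abs //; apply; rewrite (leq_trans hr) ?leq_addr.
- by rewrite spdX_iter_one // eq_lshift eq_sym.
- by rewrite spdX_iter_one // eq_rlshift.
Qed.

(** The product theta_1 ... theta_k with k <= n contains no conjugate pair, hence is harmonic. *)
Lemma spare_theta (k : nat) : (k <= n)%N -> spare k.
Proof.
move=> kn; right; pose S := [set s : 'I_(n + n) | (s < k)%N].
have cS : #|S| = k.
  have kn2 : (k <= n + n)%N by rewrite (leq_trans kn) ?leq_addr.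
  rewrite -sum1_card (eq_bigl (fun s : 'I_(n + n) => (s < k)%N)) => [|s]; last by rewrite inE.
  by rewrite (big_ord_narrow kn2) sum1_card card_ord.
exists (bas 0%MM S); split; try by rewrite spdX_bas0 ?mnm0E.
  exact: bas_neq0.
apply/HkP; split.
  have <- : grade lev S 0%MM = k; last exact: ofdeg_bas.
  rewrite /grade big1 => [|i _]; last by rewrite mnm0E mulr0n.
  by rewrite add0r sumr_const cS natz.
rewrite lapE !big1 ?addr0 // => [j _|i _].
  by rewrite [D (rshift n j) _]spdtheta_bas0 ?spdtheta_lin // inE /= -leqNgt (leq_trans kn) ?leq_addr.
rewrite [px (rshift m1 i) _]px_ge; last by rewrite /= (leq_trans hr) ?leq_addr.
by rewrite spdX_bas0 ?mnm0E // px_lin.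
Qed.

Lemma Hk_notin_image k : (k < 0 -> (0 < r)%N) -> exists2 f, Hk k f & forall g, f <> rsq g.
Proof.
move=> k0r; have notin (i : 'I_m) (e : nat) : i != iv -> forall g, iter e (X i) one <> rsq g.
  move=> ii g; apply: (notin_image ivE ru rv); first exact: one_neq0.
  by rewrite spdX_iter_one // eq_sym.
have [k0|k0] := leP 0 k.
  exists (iter (absz k) (X iu) one); last by apply: notin; rewrite eq_lrshift.
  by have := Hk_iter_X_ge (absz k) ru; rewrite -ivE gez0_abs //; apply.
have r0 := k0r k0; have i0P : (0 < m)%N by rewrite (leq_trans r0) // (leq_trans hr) ?leq_addr.
exists (iter (absz k) (X (Ordinal i0P)) one); last first.
  by apply: notin; apply: contraTneq (rv) => <-; rewrite -ltnNge.
have := Hk_iter_X_lt (absz k) (_ : (Ordinal i0P < r)%N).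
by rewrite ltz0_abs ?opprK //; apply.
Qed.

(** V is abstract so that the lemma covers both R_k and, when the intersection is trivial, the zero
    submodule. *)
Lemma Hk_factor k V : (k < 0 -> (0 < r)%N) -> spare k -> is_submodule r V ->
  (forall f, V f <-> Hk k f /\ exists g, f = rsq g) -> irreducible_factor r (Hk k) V.
Proof.
move=> k0r sp sV VP; split=> //.
- exact: submodule_Hk.
- by move=> f /VP[].
- by have [f Hf fR] := Hk_notin_image k0r; exists f => // /VP[_ [g]]; apply: fR.
move=> U sU VU UH; have [UV|nUV] := classic (forall f, U f -> V f); [by left|right].
have [f nf] := not_all_ex_not _ _ nUV.
have [Uf Vf] := imply_to_and _ _ nf.
apply: (quotient_irreducible sU UH _ k0r sp) => [g Hg imG|].
  by apply/VU/VP.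
exists f => // g fg; apply: Vf; apply/VP; split; first exact: UH.
by exists g.
Qed.

Lemma Hk_irreducible k : (k < 0 -> (0 < r)%N) -> spare k ->
  (forall f g, Hk k f -> f = rsq g -> f = 0) -> irreducible_submodule r (Hk k).
Proof.
move=> k0r sp R0.
have [//|sH _ _ [f Hf f0] irr] := @Hk_factor k (@spzero F m (n + n)) k0r sp (submodule0).
  move=> f; split=> [->|[Hf [g fg]]]; last exact: R0 Hf fg.
  by split; [case: (submodule_Hk k) => -[]|exists 0; rewrite rsq_lin].
split=> //; first by exists f.
move=> U sU UH; apply: irr => // g ->; by case: sU => -[].
Qed.

Lemma Hk_irreducible_below k : k <= N -> (k < 0 -> (0 < r)%N) -> spare k ->
  irreducible_submodule r (Hk k).
Proof.
move=> kN k0r sp; apply: Hk_irreducible => // f g Hf fg.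
apply: (Hk_image_below kN Hf _ fg); apply: (lev_rsqK ivE ru rv).
by case/HkP: Hf => fk _; rewrite -fg.
Qed.

Lemma Hk_irreducible_above k : r = 0%N -> 0 <= k -> 2 * N < k -> spare k ->
  irreducible_submodule r (Hk k).
Proof.
move=> r0 k0 kN sp; apply: Hk_irreducible => // [|f g Hf fg]; first by rewrite ltNge k0.
have Nk : N < k by lia.
have /(RkP _ Nk) [h /HkP[hk _] ->] : Hk k f /\ exists g, f = rsq g by split=> //; exists g.
rewrite (lev_negative r0 _ hk) ?(iter_lin _ rsq_linear) //; lia.
Qed.

Lemma Rk_irreducible k : N < k -> (2 * N - k < 0 -> (0 < r)%N) -> spare (2 * N - k) ->
  irreducible_submodule r (Rk k).
Proof.
move=> Nk k0r sp; apply: irreducible_image.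
- exact/equivariant_iter/equivariant_rsq.
- move=> f _; elim: (absz _) => //= t IH /(rsq_inj ivE ru rv); exact: IH.
- by apply: Hk_irreducible_below => //; lia.
Qed.

Lemma irreducible_factor0 W : irreducible_submodule r W ->
  irreducible_factor r W (@spzero F m (n + n)).
Proof.
case=> sW [f Wf f0] irr; split=> //; first exact: submodule0.
- by move=> g ->; case: sW => -[].
- by exists f.
- by move=> U sU _ UW; apply: irr.
Qed.

Lemma series2 k : N < k -> (k < 0 -> (0 < r)%N) -> (2 * N - k < 0 -> (0 < r)%N) ->
  spare k -> spare (2 * N - k) ->
  composition_series r [:: Hk k; Rk k; @spzero F m (n + n)].
Proof.
move=> Nk k0r k0r' sp sp'; split; last split=> //.
  by apply: Hk_factor => // [|f]; [exact: submodule_Rk|exact: RkP].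
exact/irreducible_factor0/Rk_irreducible.
Qed.

(** * The last pair when r = m1 - 1 *)

Definition puv f : A := u (v f).

Lemma puv_linear : linear puv.
Proof. by move=> c f g; rewrite /puv !mulX_lin. Qed.
Definition puv_lin := linear_rulesP puv_linear.

Definition pairfree f : Prop := du f = 0 /\ dv f = 0.

Lemma pairfree_lap f : pairfree f -> pairfree (lap f).
Proof.
move=> [duf dvf].
split.
  by rewrite -(px_ge _ ru) -lap_px px_ge // duf lap_lin.
by rewrite -(px_ge _ rv) -lap_px px_ge // dvf lap_lin.
Qed.

Lemma u_du_puv f : u (du (puv f)) = puv (u (du f)) + puv f.
Proof.
rewrite /puv spdX_mulX eqxx scale1r (du_v ivE) mulX_lin addrC.
by congr (_ + _); rewrite [v (u _)]mulXC.
Qed.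

Lemma v_dv_puv f : v (dv (puv f)) = puv (v (dv f)) + puv f.
Proof.
rewrite /puv (dv_u ivE) spdX_mulX eqxx scale1r !mulX_lin addrC.
by congr (_ + _); rewrite mulXC // mulXC [v (u _)]mulXC.
Qed.

Lemma u_du_iter (j : nat) f : pairfree f -> u (du (iter j puv f)) = j%:R *: iter j puv f.
Proof.
move=> [duf _]; elim: j => [|j IH]; first by rewrite /= duf mulX_lin scale0r.
by rewrite iterS u_du_puv IH puv_lin -{2}[puv _]scale1r -scalerDl natr1.
Qed.

Lemma v_dv_iter (j : nat) f : pairfree f -> v (dv (iter j puv f)) = j%:R *: iter j puv f.
Proof.
move=> [_ dvf]; elim: j => [|j IH]; first by rewrite /= dvf mulX_lin scale0r.
by rewrite iterS v_dv_puv IH puv_lin -{2}[puv _]scale1r -scalerDl natr1.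
Qed.

Lemma lap_puv f : lap (puv f) = puv (lap f) + (u (du f) + v (dv f) + f).
Proof.
rewrite /puv (lap_u ivE ru rv) (lap_v ivE ru rv) mulX_lin -!addrA.
by congr (_ + (_ + _)); rewrite spdX_mulX eqxx scale1r addrC.
Qed.

Lemma lap_iter_puv (j : nat) f : pairfree f ->
  lap (iter j.+1 puv f) = iter j.+1 puv (lap f) + (j.+1 ^ 2)%:R *: iter j puv f.
Proof.
move=> Bf; elim: j => [|j IH].
  by case: (Bf) => duf dvf; rewrite /= lap_puv duf dvf !mulX_lin !add0r scale1r.
rewrite iterS lap_puv IH puv_lin puv_lin -addrA; congr (_ + _).
rewrite u_du_iter // v_dv_iter // -iterS -[X in _ + (_ + X)]scale1r -!scalerDl -!natrD.
by rewrite natr1 -natrD; congr (_%:R *: _); lia.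
Qed.

(* y is the Bessel-type sum of the (-uv)^j lap^j x / (j!)^2. *)
Lemma harmonic_lift k x : pairfree x -> ofdeg lev k x ->
  exists y g, [/\ Hk k y, ofdeg wt 0 y & y = x + v g].
Proof.
move=> Bx xk; pose c (j : nat) : F := (-1) ^+ j / (j`! ^ 2)%:R.
pose T (j : nat) := c j *: iter j puv (iter j lap x).
have B (j : nat) : pairfree (iter j lap x) by elim: j => //= j; apply: pairfree_lap.
have Tk (j : nat) : ofdeg lev k (T j).
  apply: ofdegZ; have -> : k = (k - j%:Z * 2) + j%:Z * 2 by ring.
  have := lvl_iter_d (fun k f => @lev_lap k f) j xk.
  move: (iter j lap x) => y yk; apply: (lvl_iter_e (lvl := ofdeg lev)) => // k' f fk.
  rewrite /puv; apply: (ofdegE (ofdeg_mulX (ofdeg_mulX fk))).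
  by rewrite /= !ltnNge ru rv /=; ring.
have Tw (j : nat) : ofdeg wt 0 (T j).
  apply: ofdegZ; case: (B j) => /weight0/[apply].
  move: (iter j lap x) => y y0; elim: (j) => //= {}j IH.
  rewrite /puv; apply: (ofdegE (ofdeg_mulX (ofdeg_mulX IH))).
  by rewrite /= !eqxx eq_sym (negPf uv).
(* The coefficients make the sum telescope: by [lap_iter_puv], the second term of lap (T_(j+1))
   cancels the first term of lap (T_j). The last remainder vanishes for J large. *)
have lapT J : lap (\sum_(j < J.+1) T j) = c J *: iter J puv (iter J.+1 lap x).
  elim: J => [|J IH]; first by rewrite big_ord1 /T lap_lin.
  rewrite big_ord_recr /= lap_lin IH /T lap_lin lap_iter_puv //.
  rewrite scalerDr addrCA -[RHS]addr0; congr (_ + _).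
  rewrite scalerA -scalerDl; suff -> : c J + c J.+1 * (J.+1 ^ 2)%:R = 0 by rewrite scale0r.
  have a0 : (J.+1 ^ 2)%:R != 0 :> F by rewrite pnatr_eq0 expn_eq0.
  have b0 : (J`! ^ 2)%:R != 0 :> F by rewrite pnatr_eq0 expn_eq0 andbT -lt0n fact_gt0.
  rewrite /c factS expnMn natrM exprS.
  move: (_ ^ 2)%:R a0 (_ ^ 2)%:R b0 (_ ^+ _) => a a0 b b0 d.
  by field; apply/andP.
have [J Jx] := lap_nilpotent x.
exists (\sum_(j < J.+1) T j), (\sum_(j < J) c j.+1 *: u (iter j puv (iter j.+1 lap x))); split.
- apply/HkP; split; first by apply: ofdeg_sum.
  by rewrite lapT iterS Jx lap_lin (iter_lin _ puv_linear) scaler0.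
- exact: ofdeg_sum.
rewrite big_ord_recl /T /c /= divr1 scale1r mulX_lin; congr (_ + _).
by apply: eq_bigr => j _; rewrite mulX_lin /puv mulXC.
Qed.

Hypotheses (lE : l = r :> nat) (rE : r.+1 = m1).
Let lr (i : 'I_m1) : i != l -> (i < r)%N.
Proof. by rewrite -(inj_eq val_inj) /= lE => il; have := ltn_ord i; lia. Qed.

(** On elements free of the pair, [e] = rsq - uv is locally nilpotent by [rsq_rest_nilpotent] and
    forms with lap an sl(2) whose constant is N + 1, one pair being removed. As k = (N + 1) - 1 + t,
    [iter_e_onto] applies, and e agrees with rsq modulo v. *)
Lemma pairfree_onto (t : nat) k h : k = N + t%:Z -> pairfree h -> ofdeg lev k h ->
  exists h', [/\ pairfree h', ofdeg lev (k - t%:Z * 2) h' &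
    exists g, h = iter t rsq h' + v g].
Proof.
move=> kE Bh hk.
pose e f := rsq f - puv f.
have e_lin : linear e.
  by move=> c f g; rewrite /e !rsq_lin !puv_lin scalerBr opprD addrACA.
pose lvl k f := ofdeg lev k f /\ pairfree f.
have lvlP k' c f g : lvl k' f -> lvl k' g -> lvl k' (c *: f + g).
  move=> [fk [f1 f2]] [gk [g1 g2]]; split; first by apply: ofdegD => //; apply: ofdegZ.
  by split; rewrite !spdX_lin ?f1 ?f2 ?g1 ?g2 scaler0 addr0.
have lvl_d k' f : lvl k' f -> lvl (k' - 2) (lap f).
  by move=> [fk Bf]; split; [exact: lev_lap|exact: pairfree_lap].
have lvl_e k' f : lvl k' f -> lvl (k' + 2) (e f).
  move=> [fk [f1 f2]]; split.
    apply: ofdegB; first exact: lev_rsq.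
    apply: (ofdegE (ofdeg_mulX (ofdeg_mulX fk))).
    by rewrite /= !ltnNge ru rv /=; ring.
  by split; [exact: (du_rsq ivE ru rv)|exact: (dv_rsq ivE ru rv)].
have de k' f : lvl k' f -> lap (e f) = e (lap f) + (k' + 1 - (N + 1))%:~R *: f.
  move=> [fk [f1 f2]]; rewrite /e !lap_lin (lap_rsq fk) lap_puv f1 f2 !mulX_lin !add0r.
  rewrite [- (puv _ + _)]opprD [LHS]addrACA; congr (_ + _); rewrite -[X in _ *: _ - X]scale1r -scalerBl.
  by congr (_ *: _); ring.
have e_nil f : exists s : nat, iter s e f = 0.
  have [s sf] := rsq_rest_nilpotent lr f; exists s; rewrite -sf.
  by apply: eq_iter => g; rewrite /e /puv !qx_ge.
have [|h' [h'k Bh'] hE] := iter_e_onto (t := t) (f := h)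
  lap_linear e_lin lvlP lvl_d lvl_e de lap_nilpotent e_nil.
  by split=> //; apply: (ofdegE hk); rewrite kE; ring.
exists h'; split=> //; first by apply: (ofdegE h'k); rewrite kE; ring.
rewrite hE; elim: (t) => [|s [g IH]]; first by exists 0; rewrite mulX_lin addr0.
exists (rsq g - u (iter s e h')).
rewrite !iterS {1}/e {1}IH rsq_lin (rsq_v rv) mulX_lin mulX_lin addrA.
by congr (_ - _); rewrite /puv mulXC.
Qed.

(** Modulo v, f is an element h free of the pair, h is rsq^t h' by [pairfree_onto], and h' is a
    harmonic y of weight 0 by [harmonic_lift]. So f - rsq^t y is harmonic, of weight 0 and divisible
    by v, hence 0. *)
Lemma Hk_weight0 k f : N < k -> Hk k f -> ofdeg wt 0 f -> Rk k f.
Proof.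
move=> Nk Hf fw; have /HkP[fk lf] := Hf.
have [h [g [Bh hk fE]]] : exists h g, [/\ pairfree h, ofdeg lev k h & f = h + v g].
  pose W f := exists h g, [/\ pairfree h, ofdeg lev k h & f = h + v g].
  have sW : is_subspace W.
    split=> [|c f1 f2 [h1 [g1 [[d1 d1'] w1 ->]]] [h2 [g2 [[d2 d2'] w2 ->]]]].
      by exists 0, 0; rewrite /pairfree !spdX_lin mulX_lin addr0; split=> //; exact: ofdeg0.
    exists (c *: h1 + h2), (c *: g1 + g2).
    rewrite /pairfree !spdX_lin d1 d1' d2 d2' scaler0 addr0; split=> //.
      by apply: ofdegD => //; apply: ofdegZ.
    by rewrite !mulX_lin scalerDr addrACA.
  apply: (subspace_span sW) => S b Sb; have bk := fk _ _ Sb.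
  have := fw _ _ Sb; rewrite grade_wuv // => bw.
  have [[b1 bE]|bv] := mnmU_split iv b.
    exists 0, (bas b1 S); rewrite /pairfree !spdX_lin mulX_bas -bE add0r; split=> //; exact: ofdeg0.
  exists (bas b S), 0; rewrite mulX_lin addr0 /pairfree; split=> //.
    by split; apply: spdX_bas0 => //; lia.
  by rewrite -bk; exact: ofdeg_bas.
have [t tE] : exists t : nat, k = N + t%:Z by exists (absz (k - N)); lia.
have [h' [Bh' h'k [g1 hE]]] := pairfree_onto tE Bh hk.
have [y [g2 [Hy yw yE]]] := harmonic_lift Bh' h'k.
have Rf : Rk k (iter t rsq y).
  exists y; last by congr (iter _ _ _); lia.
  by move: Hy; rewrite (_ : k - _ = 2 * N - k) //; lia.
have /(RkP _ Nk)[/HkP[yk ly] _] := Rf.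
suff -> : f = iter t rsq y by [].
apply/eqP; rewrite -subr_eq0; apply/eqP; apply: (harmonic_order ivE ru rv (a := 0%N) _).
- apply: ofdegB => //; elim: (t) => //= s IH; exact: (wuv_rsq ivE ru rv).
- by rewrite !lap_lin lf ly subrr.
exists (g + g1 - iter t rsq g2).
have rv' (s : nat) (x : A) : iter s rsq (v x) = v (iter s rsq x).
  by elim: s => //= s ->; rewrite (rsq_v rv).
rewrite yE (iter_lin _ rsq_linear) rv' fE hE !mulX_lin.
by rewrite -(addrA _ (v g1)) opprD addrACA subrr add0r [v g1 + _]addrC.
Qed.

Hypothesis r0 : (0 < r)%N.
Let NE : N = n%:Z. Proof. by rewrite /crit; lia. Qed.

Variable k : int.
Hypothesis nk : n%:Z < k.
Let Nk : N < k. Proof. by rewrite NE. Qed.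
Let k0 : 0 <= k. Proof. by rewrite ltW // (le_lt_trans _ nk). Qed.

Local Notation gen := (generated r (fun f => f = iter (absz k) u one)).

Lemma Hk_iter_u : Hk k (iter (absz k) u one).
Proof. by have := Hk_iter_X_ge (absz k) ru; rewrite -ivE gez0_abs //; apply. Qed.

Lemma Hk_iter_v : Hk k (iter (absz k) v one).
Proof. by have := Hk_iter_X_ge (absz k) rv; rewrite -iuE gez0_abs //; apply. Qed.

Lemma wuv_iter_u (e : nat) : ofdeg wt e (iter e u one).
Proof.
have one0 : ofdeg wt 0 one by apply: weight0 => //; rewrite spdX_bas0 ?mnm0E.
by apply: (ofdegE (ofdeg_iter_mulX one0)); rewrite /= eqxx add0r natz.
Qed.

Lemma wuv_iter_v (e : nat) : ofdeg wt (- e%:Z) (iter e v one).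
Proof.
have one0 : ofdeg wt 0 one by apply: weight0 => //; rewrite spdX_bas0 ?mnm0E.
apply: (ofdegE (ofdeg_iter_mulX one0)).
by rewrite /= eq_sym (negPf uv) eqxx add0r mulNrn natz.
Qed.

Lemma gen_Hk f : gen f -> Hk k f.
Proof. by apply; [exact: submodule_Hk|move=> g ->; exact: Hk_iter_u]. Qed.

Lemma gen_weight_ge0 (a : nat) f : Hk k f -> ofdeg wt a f -> gen f.
Proof.
apply: (one_side_generate ivE ru rv (generated_submodule _) gen_Hk).
by rewrite k0; apply: generated_gen.
Qed.

Lemma low_spare : spare (2 * N - k).
Proof.
have [nk0|nk0] := leP (2 * N - k) 0; first by left.
rewrite -(gez0_abs (ltW nk0)); apply: spare_theta => //; rewrite NE in nk0 *; lia.
Qed.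

Lemma low_Hk : exists f0, [/\ f0 <> 0, Hk (2 * N - k) f0, du f0 = 0 & dv f0 = 0].
Proof.
have [nk0|//] := low_spare.
have i0P : (0 < m)%N by rewrite (leq_trans r0) // (leq_trans hr) ?leq_addr.
exists (iter (absz (2 * N - k)%R) (X (Ordinal i0P)) one).
have iu0 : iu != Ordinal i0P by rewrite -(inj_eq val_inj) /= lE -lt0n.
have iv0 : iv != Ordinal i0P by rewrite -(inj_eq val_inj) /= -lt0n addn_gt0 (leq_trans r0 hr).
split; first exact: one_neq0.
- have := Hk_iter_X_lt (absz (2 * N - k)%R) (r0 : (Ordinal i0P < r)%N).
  by rewrite lez0_abs // opprK.
- by rewrite spdX_iter_one.
- by rewrite spdX_iter_one.
Qed.

Lemma Rk_irr : irreducible_submodule r (Rk k).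
Proof. by apply: (Rk_irreducible Nk) => //; exact: low_spare. Qed.

(** R_k being irreducible, one common nonzero element suffices: rsq^(k - N) f0 with f0 from [low_Hk]
    has weight 0, and all elements of H_k of weight >= 0 are generated. *)
Lemma Rk_gen f : Rk k f -> gen f.
Proof.
have [sR _ irr] := Rk_irr.
have [||U0|UR] := irr (fun f => Rk k f /\ gen f).
- by apply: submoduleI => //; apply: generated_submodule.
- by move=> g [].
- have [f0 [f00 Hf0 duf dvf]] := low_Hk.
  pose f1 := iter (absz (k - N)%R) rsq f0.
  have Rf1 : Rk k f1 by exists f0.
  case: f00; have : f1 = 0.
    apply: U0; split=> //; apply: (@gen_weight_ge0 0%N).
      by case/(RkP _ Nk): Rf1.
    rewrite /f1; elim: (absz _) => [|s IH]; first exact: weight0.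
    exact: (wuv_rsq ivE ru rv).
  rewrite /f1; elim: (absz _) => //= s IH /(rsq_inj ivE ru rv); exact: IH.
by case/UR.
Qed.

(* Excludes v^k but contains u^k, and the component of weight 0 imposes no condition. *)
Definition positive_mod f : Prop :=
  Hk k f /\ forall a : nat, Rk k (component wt (- a%:Z) f).

(** T shifts the weight by c >= -1, so a component of T f of negative weight comes from one of f of
    weight at most 0, which lies in R_k. The component of weight 0 of T f lies in R_k by
    [Hk_weight0]. *)
Lemma positive_mod_closed (T : A -> A) (c : int) : linear T -> -1 <= c ->
  (forall a g, ofdeg wt a g -> ofdeg wt (a + c) (T g)) ->
  (forall g, Hk k g -> Hk k (T g)) -> (forall g, Rk k g -> Rk k (T g)) ->
  forall f, positive_mod f -> positive_mod (T f).
Proof.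
move=> lT c1 Tw TH TR f [Hf Rf]; split=> [|[|a]]; first exact: TH.
  apply: (Hk_weight0 Nk); last exact: component_ofdeg.
  exact: (component_wuv ivE ru rv _ (submodule_Hk k) (TH _ Hf)).
rewrite -(subrK c (- a.+1%:Z)) (component_shift _ _ lT Tw); apply: TR.
rewrite (_ : _ - _ = - (absz (- a.+1%:Z - c))%:Z); first exact: Rf.
by lia.
Qed.

Lemma wuv_le1 i : -1 <= wt.1 i <= 1.
Proof. by rewrite /=; case: ifP => // _; case: ifP. Qed.

Lemma submodule_positive_mod : is_submodule r positive_mod.
Proof.
have /submoduleP[subH Hxx Hxt Htt] := submodule_Hk k.
have /submoduleP[subR Rxx Rxt Rtt] := submodule_Rk k.
have qw := qdeg_wuv_swap ivE ru rv; have qd := qdeg_wuv ru rv.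
apply/submoduleP; split.
- split=> [|c f g [Hf Rf] [Hg Rg]].
    by split=> [|a]; [case: subH|rewrite component_lin; case: subR].
  split=> [|a]; first by case: subH => _; apply.
  by rewrite !component_lin; case: subR => _; apply.
(* The only generator lowering the weight by 2 is [Lxx iv iu], and it is v du - v du = 0. *)
- move=> i j; have [ij|ij] := boolP ((i == iv) && (j == iu)).
    case/andP: ij => /eqP -> /eqP -> f Wf.
    rewrite /Lxx -iuE -ivE subrr; split=> [|a]; first by case: subH.
    by rewrite component_lin; case: subR.
  apply: (positive_mod_closed (c := wt.1 i - wt.1 j)); auto.
  + exact: Lxx_linear.
  + move: ij (wuv_le1 i) (wuv_le1 j); rewrite negb_and => /orP[/negPf|/negPf] ij; rewrite /= ij.
      by case: (i == iu); lia.
    by case: (j == iv); lia.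
  + move=> a g ga; apply: ofdegE; first by apply: (ofdeg_Lxx _ _ ga); rewrite qw.
    by rewrite !qd; ring.
- move=> i s; apply: (positive_mod_closed (c := wt.1 i)); auto.
  + exact: Lxt_linear.
  + by case/andP: (wuv_le1 i).
  + move=> a g ga; apply: ofdegE; first by apply: (ofdeg_Lxt _ _ ga); rewrite ?qw //= oppr0.
    by rewrite !qd /=; ring.
- move=> s t; apply: (positive_mod_closed (c := 0)); auto.
  + exact: Ltt_linear.
  + move=> a g ga; apply: ofdegE; first by apply: (ofdeg_Ltt _ _ ga); rewrite /= oppr0.
    by rewrite /=; ring.
Qed.

Lemma gen_positive_mod f : gen f -> positive_mod f.
Proof.
apply; first exact: submodule_positive_mod.
move=> g ->; split=> [|a]; first exact: Hk_iter_u.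
rewrite (component_neq (@wuv_iter_u _)); last by lia.
by case: (submodule_Rk k) => -[].
Qed.

Lemma gen_not_iter_v : ~ gen (iter (absz k) v one).
Proof.
move/gen_positive_mod => [_ /(_ (absz k))]; rewrite component_id; last exact: wuv_iter_v.
case/(RkP _ Nk) => _ [g]; apply: (notin_image iuE rv ru); first exact: one_neq0.
by rewrite spdX_iter_one.
Qed.

Lemma series3 : composition_series r [:: Hk k; gen; Rk k; @spzero F m (n + n)].
Proof.
have sH := submodule_Hk k; have sR := submodule_Rk k.
have sG := generated_submodule (fun f => f = iter (absz k) u one).
have k0r : k < 0 -> (0 < r)%N by [].
split; last split; last split=> //.
- split=> //; first exact: gen_Hk.
    by exists (iter (absz k) v one); [exact: Hk_iter_v|exact: gen_not_iter_v].
  move=> U sU GU UH; have [UG|nUG] := classic (forall f, U f -> gen f); [by left|right].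
  have [f nf] := not_all_ex_not _ _ nUG; have [Uf Gf] := imply_to_and _ _ nf.
  (* All components of weight >= 0 are already generated by u^k, so one of weight at most 0 is not;
     it leads to v^k. *)
  have [a Ga] : exists a : nat, ~ gen (component wt (- a%:Z) f).
    apply: NNPP => na; apply: Gf; apply: (weight_cases sG) => a.
      apply: gen_weight_ge0; last exact: component_ofdeg.
      exact: (component_wuv ivE ru rv _ sH (UH _ Uf)).
    by apply: NNPP => Ga; apply: na; exists a.
  have Uc : U (component wt (- a%:Z) f) := component_wuv ivE ru rv _ sU Uf.
  have RU g : Hk k g -> (exists h, g = rsq h) -> U g.
    by move=> Hg gh; apply: (GU); apply: Rk_gen; apply/(RkP _ Nk).
  have cw : ofdeg (wuv iv iu) a (component wt (- a%:Z) f).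
    have := ofdeg_wuv_swap (@component_ofdeg _ _ _ wt (- a%:Z) f).
    by rewrite opprK.
  have bv := one_side_reach iuE rv ru sU UH RU k0r Uc cw.
  have {}bv := bv (fun g fg => Ga (Rk_gen (let: conj _ H := RkP _ Nk in
    H (conj (UH _ Uc) (ex_intro _ g fg))))).
  move=> g Hg; apply: (weight_cases sU) => b.
    apply: (GU); apply: gen_weight_ge0; last exact: component_ofdeg.
    exact: (component_wuv ivE ru rv _ sH Hg).
  apply: (one_side_generate iuE rv ru sU UH bv (a := b)).
    exact: (component_wuv ivE ru rv _ sH Hg).
  have := ofdeg_wuv_swap (@component_ofdeg _ _ _ wt (- b%:Z) g).
  by rewrite opprK.
- split=> //; first exact: Rk_gen.
    exists (iter (absz k) u one); first exact: generated_gen.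
    case/(RkP _ Nk) => _ [g]; apply: (notin_image ivE ru rv); first exact: one_neq0.
    by rewrite spdX_iter_one // eq_sym.
  move=> U sU RU UG; have [UR|nUR] := classic (forall f, U f -> Rk k f); [by left|right].
  have UH f : U f -> Hk k f by move/UG/gen_Hk.
  have [f nf] := not_all_ex_not _ _ nUR; have [Uf Rf] := imply_to_and _ _ nf.
  (* By [gen_positive_mod] the components of weight <= 0 lie in R_k, so one of weight >= 0 does not;
     it leads back to u^k. *)
  have [a Ra] : exists a : nat, ~ Rk k (component wt a f).
    apply: NNPP => na; apply: Rf; apply: (weight_cases sR) => a.
      by apply: NNPP => Ra; apply: na; exists a.
    by case: (gen_positive_mod (UG _ Uf)).
  have Uc : U (component wt a f) := component_wuv ivE ru rv _ sU Uf.
  have RU' g : Hk k g -> (exists h, g = rsq h) -> U g.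
    by move=> Hg gh; apply/RU/(RkP _ Nk).
  have := one_side_reach ivE ru rv sU UH RU' k0r Uc (@component_ofdeg _ _ _ _ _ _).
  rewrite k0 => bu g; apply=> // h ->; apply: bu => h' fh.
  by apply: Ra; apply/(RkP _ Nk); split; [exact: UH|exists h'].
exact: (irreducible_factor0 Rk_irr).
Qed.

End LastPair.

End Oscillator.

(** * The case r = m1 *)

Section Top.

Variables (F : numFieldType) (m1 n : nat).

Local Notation m := (m1 + m1)%N.
Local Notation A := (superpoly F m (n + n)).
Implicit Types (f g h : A) (W U : A -> Prop) (k l : int).
Implicit Types (i j : 'I_m1) (s t : 'I_n) (S : {set 'I_(n + n)}) (b : 'X_{1..m}).
Local Notation qx := (@qx F m1 n m1).
Local Notation px := (@px F m1 n m1).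
Local Notation lap := (@lap F m1 n m1).
Local Notation rsq := (@rsq F m1 n m1).
Local Notation Xl i := (@mulX F m (n + n) (lshift m1 i)).
Local Notation Xr i := (@mulX F m (n + n) (rshift m1 i)).
Local Notation dl i := (@spdX F m (n + n) (lshift m1 i)).
Local Notation dr i := (@spdX F m (n + n) (rshift m1 i)).
Local Notation Tl s := (@mulT F m (n + n) (lshift n s)).
Local Notation Tr s := (@mulT F m (n + n) (rshift n s)).
Local Notation Dl s := (@spdtheta F m (n + n) (lshift n s)).
Local Notation Dr s := (@spdtheta F m (n + n) (rshift n s)).
Local Notation lev := (lev m1 n m1).
Local Notation Lxx := (@Lxx F m1 n m1).
Local Notation Lxt := (@Lxt F m1 n m1).
Local Notation Ltt := (@Ltt F m1 n).
Local Notation bas := (@bas F m (n + n)).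
Local Notation xl := (lshift m1).
Local Notation xr := (@rshift m1 m1).
Local Notation tl := (lshift n).
Local Notation tr := (@rshift n n).

Local Notation Hk k := (@Hk F m1 n m1 k).
Let hr := leqnn m1.

Lemma qx_l i f : qx (xl i) f = dl i f. Proof. exact: (qx_lt f (ltn_ord i : (xl i < m1)%N)). Qed.
Lemma px_l i f : px (xl i) f = - Xl i f. Proof. exact: (px_lt f (ltn_ord i : (xl i < m1)%N)). Qed.
Lemma qx_r i f : qx (xr i) f = Xr i f. Proof. exact: (qx_ge f (leq_addr i m1 : (m1 <= xr i)%N)). Qed.
Lemma px_r i f : px (xr i) f = dr i f. Proof. exact: (px_ge f (leq_addr i m1 : (m1 <= xr i)%N)). Qed.

Let lrE := (qx_l, px_l, qx_r, px_r, swap_lshift, swap_rshift, eps_lshift, eps_rshift).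

Lemma rsq_top f : rsq f = \sum_i Xr i (dl i f) + \sum_s Tl s (Tr s f).
Proof.
rewrite (rsqE hr); congr (_ + _); apply: eq_bigr => i _.
by rewrite !lrE spdX_mulX_neq // eq_lrshift.
Qed.

Lemma lap_top f : lap f = - (\sum_i Xl i (dr i f)) + \sum_s Dl s (Dr s f).
Proof.
by rewrite (lapE hr); congr (_ + _); rewrite -sumrN; apply: eq_bigr => i _; rewrite !lrE.
Qed.

Lemma Lxx_lr i j f : Lxx (xl i) (xr j) f = dl i (dr j f) - dl j (dr i f).
Proof. by rewrite /Lxx !lrE. Qed.
Lemma Lxx_ll i j f : Lxx (xl i) (xl j) f = - dl i (Xl j f) - Xr j (dr i f).
Proof. by rewrite /Lxx !lrE spdX_lin. Qed.
Lemma Lxx_rl i j f : Lxx (xr i) (xl j) f = - Xr i (Xl j f) + Xr j (Xl i f).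
Proof. by rewrite /Lxx !lrE !mulX_lin opprK. Qed.
Lemma Lxt_ll i s f : Lxt (xl i) (tl s) f = dl i (Dl s f) - Tr s (dr i f).
Proof. by rewrite /Lxt !lrE scaleN1r. Qed.
Lemma Lxt_lr i s f : Lxt (xl i) (tr s) f = dl i (Dr s f) + Tl s (dr i f).
Proof. by rewrite /Lxt !lrE scale1r. Qed.
Lemma Lxt_rl i s f : Lxt (xr i) (tl s) f = Xr i (Dl s f) + Tr s (Xl i f).
Proof. by rewrite /Lxt !lrE scaleN1r mulT_lin opprK. Qed.
Lemma Lxt_rr i s f : Lxt (xr i) (tr s) f = Xr i (Dr s f) - Tl s (Xl i f).
Proof. by rewrite /Lxt !lrE scale1r mulT_lin. Qed.
Lemma Ltt_rl s t f : Ltt (tr s) (tl t) f = Tr s (Dl t f) + Tr t (Dl s f).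
Proof. by rewrite /Ltt !lrE mul1r scaleN1r opprK. Qed.
Lemma Ltt_lr s t f : Ltt (tl s) (tr t) f = Tl s (Dr t f) + Tl t (Dr s f).
Proof. by rewrite /Ltt !lrE mulr1 scaleN1r opprK. Qed.

(** The theta_(n+s) are counted by their absence, so that d_(n+s) acts as a creation operator. The
    eigenvalues of [hole_euler] are these natural numbers, which makes [hole_euler] + 1
    injective. *)
Definition holes S b : nat := (\sum_i b (xl i) + \sum_s (tr s \notin S))%N.
Definition hole_euler f : A := \sum_i Xl i (dl i f) + \sum_s Dr s (Tr s f).

Lemma mcoeff_hole_euler f S b : (hole_euler f S)@_b = (holes S b)%:R * (f S)@_b.
Proof.
rewrite mcoeffspD !mcoeffsp_sum natrD !natr_sum mulrDl !mulr_suml; congr (_ + _).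
  by apply: eq_bigr => i _; rewrite mcoeff_mulX_spdX.
apply: eq_bigr => s _; rewrite spdtheta_mulT eqxx scale1r mcoeffspD mcoeffspN.
rewrite mcoeff_mulT_spdtheta; case: (_ \in S); rewrite ?mul1r ?subrr ?mul0r ?subr0 ?mul1r //.
Qed.

Lemma hole_euler_inj f : hole_euler f + f = 0 -> f = 0.
Proof.
move=> f0; apply: superpolyP => S b; move/(congr1 (fun g : A => (g S)@_b)): f0.
rewrite mcoeffspD mcoeff_hole_euler mcoeffsp0 -{2}[(f S)@_b]mul1r -mulrDl natr1 => /eqP.
by rewrite mulf_eq0 pnatr_eq0 => /eqP.
Qed.

Definition bfree f : Prop := (forall i, dr i f = 0) /\ (forall s, Dl s f = 0).

(** For g = [dr j f] or [Dl t f], the hypotheses turn the first sum of [hole_euler g] into - g minus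
    the second one, so ([hole_euler] + 1) g = 0. *)
Lemma lower_bfree f : lap f = 0 -> (forall i j, Lxx (xl i) (xr j) f = 0) ->
  (forall i s, Lxt (xl i) (tl s) f = 0) -> (forall s t, Ltt (tr s) (tl t) f = 0) -> bfree f.
Proof.
rewrite lap_top addrC => /eqP; rewrite subr_eq0 => /eqP lf xx xt tt; split=> [j|t].
  apply: hole_euler_inj.
  have e1 : \sum_i Xl i (dl i (dr j f)) = dl j (\sum_s Dl s (Dr s f)) - dr j f.
    rewrite lf spdX_lin -[X in _ = _ - X](sum_delta_l j (fun i => dr i f)) -sumrB.
    apply: eq_bigr => i _; rewrite spdX_mulX eq_lshift addrAC subrr add0r.
    by have := xx i j; rewrite Lxx_lr => /eqP; rewrite subr_eq0 => /eqP ->.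
  have e2 : dl j (\sum_s Dl s (Dr s f)) = - \sum_s Dr s (Tr s (dr j f)).
    rewrite spdX_lin -sumrN; apply: eq_bigr => s _.
    have := xt j s; rewrite Lxt_ll => /eqP; rewrite subr_eq0 => /eqP <-.
    by rewrite spdtheta_spdX spdthetaC spdX_lin.
  by rewrite /hole_euler e1 e2 addrAC subrK addNr.
apply: hole_euler_inj.
have e1 : \sum_i Xl i (dl i (Dl t f)) = Tr t (\sum_s Dl s (Dr s f)).
  rewrite lf mulT_lin; apply: eq_bigr => i _; rewrite mulT_mulX.
  by have := xt i t; rewrite Lxt_ll => /eqP; rewrite subr_eq0 => /eqP ->.
have e2 : \sum_s Dr s (Tr s (Dl t f)) = - Tr t (\sum_s Dl s (Dr s f)) - Dl t f.
  rewrite mulT_lin -[X in _ = _ - X](sum_delta_l t (fun s => Dl s f)) -!sumrN -big_split.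
  apply: eq_bigr => s _ /=; have := tt s t; rewrite Ltt_rl => /eqP; rewrite addr_eq0 => /eqP ->.
  rewrite spdtheta_lin spdtheta_mulT eq_rshift opprB spdthetaC mulT_lin.
  by rewrite [t == s]eq_sym.
by rewrite /hole_euler e1 e2 addrA subrr add0r addNr.
Qed.

(** Chosen so that the three families of operators in [lower_bfree] all have degree -2. *)
Definition lower_weight : grading m (n + n) :=
  (fun _ => 1, fun s : 'I_(n + n) => if (s < n)%N then 1 else -1).

(** x_i0 has weight 0, so that x_i0 d_i for i <> i0 and theta_(n+s) x_i0 both have degree -1. *)
Definition fill_weight (i0 : 'I_m) : grading m (n + n) :=
  (fun i : 'I_m => if i == i0 then 0 else 1, fun s : 'I_(n + n) => if (s < n)%N then 0 else -1).

Lemma grade_bound (w : grading m (n + n)) S b : (forall i : 'I_m, 0 <= w.1 i) ->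
  (forall s : 'I_(n + n), -1 <= w.2 s) -> 0 <= grade w S b + (n + n)%:Z.
Proof.
move=> w1 w2; rewrite /grade -addrA addr_ge0 //.
  by apply: sumr_ge0 => i _; apply: mulrn_wge0.
have : - #|S|%:Z <= \sum_(s in S) w.2 s.
  by rewrite -natz -sumr_const -sumrN; apply: ler_sum => s _; apply: w2.
have := max_card S; rewrite card_ord; lia.
Qed.

Lemma zmod_cancel (V : zmodType) (x y z a b : V) :
  z + a + b - (- x + a) + (y - b) = x + y + z.
Proof.
rewrite opprD opprK; rewrite [LHS](AC (3*2*2) ((4*6*1)*(2*5)*(3*7))) /=.
by rewrite !subrr !addr0.
Qed.

(* X_i and theta_i (1 + hole_euler) factor through rsq and osp, as hole_euler is the Euler
   operator of the x_j and of the holes among the theta_(n+s). *)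
Lemma Xr_hole_euler i f : Xr i (hole_euler f + f) =
  rsq (Xl i f) - \sum_j Lxx (xr i) (xl j) (dl j f) + \sum_s Lxt (xr i) (tr s) (Tr s f).
Proof.
under [X in _ = _ - X + _]eq_bigr do rewrite Lxx_rl.
under [X in _ = _ + X]eq_bigr do rewrite Lxt_rr.
rewrite !big_split /= !sumrN rsq_top.
have -> : \sum_j Xr j (dl j (Xl i f)) = Xr i f + \sum_j Xr j (Xl i (dl j f)).
  rewrite -(sum_delta_r i (fun j => Xr j f)) -big_split; apply: eq_bigr => j _ /=.
  by rewrite spdX_mulX eq_lshift mulX_lin mulX_lin.
under [X in _ + X - _]eq_bigr do rewrite mulT_mulX.
by rewrite zmod_cancel !mulX_lin.
Qed.

Lemma Tl_hole_euler t f : Tl t (hole_euler f + f) =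
  rsq (Dr t f) - \sum_j Lxt (xr j) (tr t) (dl j f) + \sum_s Ltt (tl t) (tr s) (Tr s f).
Proof.
under [X in _ = _ - X + _]eq_bigr do rewrite Lxt_rr.
under [X in _ = _ + X]eq_bigr do rewrite Ltt_lr.
rewrite !big_split /= sumrN rsq_top.
have -> : \sum_s Tl s (Dr t (Tr s f)) = Tl t f - \sum_s Tl s (Tr s (Dr t f)).
  rewrite -(sum_delta_r t (fun s => Tl s f)) -sumrB; apply: eq_bigr => s _ /=.
  by rewrite spdtheta_mulT eq_rshift !mulT_lin [t == s]eq_sym.
under [X in X + _ - _]eq_bigr do rewrite -spdtheta_spdX.
set a := \sum_i _; set b := \sum_s Tl s (Tr s _); set x := \sum_j Tl _ _; set y := \sum_s Tl t _.
rewrite opprD opprK [LHS](_ : _ = x + y + Tl t f); last by rewrite !mulT_lin.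
rewrite [RHS](AC (2*2*(1*2)) ((4*5*6)*(1*3)*(2*7))) /=.
by rewrite !subrr !addr0.
Qed.

(** * Submodules of H_k when r = m1 *)

Section Submodule.

Variables (k : int) (U : A -> Prop).
Hypothesis sU : is_submodule m1 U.
Hypothesis UH : forall f, U f -> Hk k f.

Lemma exists_bfree f : U f -> f <> 0 -> exists g, [/\ U g, g <> 0 & bfree g].
Proof.
case/submoduleP: (sU) => sub Uxx Uxt Utt Uf f0.
pose T (c : 'I_m1 * 'I_m1 + ('I_m1 * 'I_n + 'I_n * 'I_n)) : A -> A := match c with
  | inl (i, j) => Lxx (xl i) (xr j)
  | inr (inl (i, s)) => Lxt (xl i) (tl s)
  | inr (inr (s, t)) => Ltt (tr s) (tl t) end.
have w1 (i : 'I_m) : qdeg m1 lower_weight (swap i) = - qdeg m1 lower_weight i.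
  by elim/half_ind: i => i; rewrite !(swap_lshift, swap_rshift) /qdeg /= ltn_ord ltnNge leq_addr.
have w2 (s : 'I_(n + n)) : lower_weight.2 (swap s) = - lower_weight.2 s.
  by elim/half_ind: s => s; rewrite !(swap_lshift, swap_rshift) /= ltn_ord ltnNge leq_addr.
have low c : lowers (fun S b => absz (grade lower_weight S b + (n + n)%:Z)%R) (T c).
  apply: (lowers_ofdeg (c := 2)) => //.
  - move=> S b; apply: grade_bound => //= s; case: ifP => //.
  - by case: c => [[i j]|[[i s]|[s t]]]; [exact: Lxx_linear|exact: Lxt_linear|exact: Ltt_linear].
  move=> a g ga; case: c => [[i j]|[[i s]|[s t]]] /=.
  - apply: ofdegE; first exact: (ofdeg_Lxx (w1 _) (w1 _) ga).
    by rewrite /qdeg /= ltn_ord ltnNge leq_addr /=; ring.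
  - apply: ofdegE; first exact: (ofdeg_Lxt (w1 _) (w2 _) ga).
    by rewrite /qdeg /= !ltn_ord /=; ring.
  - apply: ofdegE; first exact: (ofdeg_Ltt (w2 _) (w2 _) ga).
    by rewrite /= ltn_ord ltnNge leq_addr /=; ring.
have PT c g : true -> U g -> U (T c g).
  by move=> _ Ug; case: c => [[i j]|[[i s]|[s t]]]; [exact: Uxx|exact: Uxt|exact: Utt].
have [g [Ug g0 gT]] := lowers_exhaust (C := xpredT) (fun c _ => low c) PT Uf f0.
exists g; split=> //; apply: lower_bfree.
- by case/HkP: (UH Ug).
- by move=> i j; apply: (gT (inl (i, j))).
- by move=> i s; apply: (gT (inr (inl (i, s)))).
- by move=> s t; apply: (gT (inr (inr (s, t)))).
Qed.

Lemma bfree_dl i f : bfree f -> bfree (dl i f).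
Proof.
by move=> [f1 f2]; split=> [j|s]; rewrite 1?spdXC ?spdtheta_spdX ?f1 ?f2 spdX_lin.
Qed.

Lemma bfree_Xl i f : bfree f -> bfree (Xl i f).
Proof.
move=> [f1 f2]; split=> [j|s]; last by rewrite spdtheta_mulX f2 mulX_lin.
by rewrite spdX_mulX_neq ?eq_rlshift // f1 mulX_lin.
Qed.

Lemma bfree_Tr s f : bfree f -> bfree (Tr s f).
Proof.
move=> [f1 f2]; split=> [j|t]; first by rewrite -mulT_spdX f1 mulT_lin.
by rewrite spdtheta_mulT eq_lrshift f2 mulT_lin scale0r subrr.
Qed.

Lemma U_Xl_dl i j f : i != j -> bfree f -> U f -> U (Xl j (dl i f)).
Proof.
move=> ij [f1 _] Uf; case/submoduleP: (sU) => sub Uxx _ _.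
have := Uxx (xl i) (xl j) _ Uf; rewrite Lxx_ll f1 mulX_lin subr0.
by rewrite spdX_mulX_neq ?eq_lshift // => /(subspaceN sub); rewrite opprK.
Qed.

Lemma U_dl_Xl i j f : bfree f -> U f -> U (dl i (Xl j f)).
Proof.
move=> [f1 _] Uf; case/submoduleP: (sU) => sub Uxx _ _.
have := Uxx (xl i) (xl j) _ Uf; rewrite Lxx_ll f1 mulX_lin subr0.
by move=> /(subspaceN sub); rewrite opprK.
Qed.

Lemma U_Tr_Xl i s f : bfree f -> U f -> U (Tr s (Xl i f)).
Proof.
move=> [_ f2] Uf; case/submoduleP: (sU) => sub _ Uxt _.
by have := Uxt (xr i) (tl s) _ Uf; rewrite Lxt_rl f2 mulX_lin add0r.
Qed.

Lemma U_dl_Dr i s f : bfree f -> U f -> U (dl i (Dr s f)).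
Proof.
move=> [f1 _] Uf; case/submoduleP: (sU) => sub _ Uxt _.
by have := Uxt (xl i) (tr s) _ Uf; rewrite Lxt_lr f1 mulT_lin addr0.
Qed.

Definition top : {set 'I_(n + n)} := [set s : 'I_(n + n) | (n <= s)%N].

Lemma grade_top (D : nat) (i0 : 'I_m1) : grade lev top (U_(xl i0) *+ D) = n%:Z - D%:Z.
Proof.
rewrite /grade (bigD1 (xl i0)) //= ltn_ord mulmnE mnm1E eqxx mul1n big1 => [|i ii0].
  rewrite addr0 sumr_const (_ : #|top| = n) ?mulNrn ?natz 1?addrC //.
  rewrite -sum1_card big_split_ord /= big_pred0 => [|s]; last by rewrite inE /= leqNgt ltn_ord.
  rewrite (eq_bigl xpredT) => [|s]; last by rewrite inE /= leq_addr.
  by rewrite sum1_card card_ord.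
by rewrite mulmnE mnm1E eq_sym (negPf ii0) mulr0n.
Qed.

Lemma bfreeP f : bfree f -> forall S b, (f S)@_b != 0 ->
  (forall i, b (xr i) = 0%N) /\ (forall s, tl s \notin S).
Proof.
by move=> [f1 f2] S b fb; split=> [i|s]; [exact: spdX_eq0 (f1 i) fb|exact: spdtheta_eq0 (f2 s) fb].
Qed.

Lemma bfree_bas S b : (forall i, b (xr i) = 0%N) -> (forall s, tl s \notin S) ->
  bfree (bas b S).
Proof. by move=> b0 S0; split=> [i|s]; [exact: spdX_bas0|exact: spdtheta_bas0]. Qed.

(** On elements free of the x_(m1+i) and theta_s, s < n, osp provides x_i0 d_i and theta_(n+s) x_i0.
    They gather all the x into x_i0 and fill in all the theta_(n+s). *)
Lemma reach_top (i0 : 'I_m1) f : U f -> f <> 0 -> exists D : nat,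
  k = n%:Z - D%:Z /\ U (bas (U_(xl i0) *+ D)%MM top).
Proof.
move=> Uf f0; have [f1 [Uf1 f10 Bf1]] := exists_bfree Uf f0.
pose P g := U g /\ bfree g.
pose T (c : 'I_m1 + 'I_n) : A -> A := match c with
  | inl i => fun g => Xl i0 (dl i g) | inr s => fun g => Tr s (Xl i0 g) end.
pose C (c : 'I_m1 + 'I_n) := match c with inl i => i != i0 | inr _ => true end.
have low c : C c ->
    lowers (fun S b => absz (grade (fill_weight (xl i0)) S b + (n + n)%:Z)%R) (T c).
  move=> Cc; apply: (lowers_ofdeg (c := 1)) => //.
  - by move=> S b; apply: grade_bound => [i|s] /=; case: ifP.
  - by case: c Cc => [i|s] _ c g h; rewrite /T /= !(mulX_lin, mulT_lin, spdX_lin).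
  move=> a g ga; case: c Cc => [i ii0|s _] /=.
    apply: (ofdegE (ofdeg_mulX (ofdeg_spdX ga))).
    by rewrite /= eqxx eq_lshift (negPf ii0); ring.
  apply: (ofdegE (ofdeg_mulT (ofdeg_mulX ga))).
  by rewrite /= eqxx ltnNge leq_addr /=; ring.
have PT c g : C c -> P g -> P (T c g).
  case: c => [i ii0|s _] [Ug Bg]; split.
  - exact: U_Xl_dl.
  - exact/bfree_Xl/bfree_dl.
  - exact: U_Tr_Xl.
  - exact/bfree_Tr/bfree_Xl.
have [g [[Ug Bg] g0 gT]] := lowers_exhaust low PT (conj Uf1 Bf1 : P f1) f10.
have [S1 [b1 gb1]] := neq0_mcoeff g0.
(* Killed by x_i0 d_i, g does not involve x_i; killed by theta_(n+s) x_i0, each of its monomials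
   contains theta_(n+s). *)
have supp S b : (g S)@_b != 0 -> S = top /\ b = (U_(xl i0) *+ b (xl i0))%MM.
  move=> gb; have [bx bt] := bfreeP Bg gb; split.
    apply/setP; elim/half_ind => s; rewrite inE /=; first by rewrite (negPf (bt s)) leqNgt ltn_ord.
    have := gT (inr s) isT; rewrite /T /= mulT_mulX => /mulX_inj/mulT_eq0/(_ gb) ->.
    by rewrite leq_addr.
  apply/mnmP; elim/half_ind => i; rewrite mulmnE mnm1E; last by rewrite bx eq_lrshift.
  rewrite eq_lshift; have [->|ii0] := eqVneq i i0; first by rewrite mul1n.
  by rewrite (spdX_eq0 (mulX_inj (gT (inl i) ii0)) gb).
have [gk _] : ofdeg lev k g /\ lap g = 0 by apply/HkP/UH.
have kE S b : (g S)@_b != 0 -> k = n%:Z - (b (xl i0))%:Z.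
  by move=> gb; case: (supp _ _ gb) (gk _ _ gb) => -> -> <-; rewrite grade_top mulmnE mnm1E eqxx mul1n.
exists (b1 (xl i0)); split; first exact: kE gb1.
have [sub _] := sU; apply: (subspaceZK sub gb1).
suff <- : g = (g S1)@_b1 *: bas (U_(xl i0) *+ b1 (xl i0))%MM top by [].
apply: superpolyP => S b; rewrite mcoeffspZ basE; case: (supp _ _ gb1) => S1E b1E.
have [/andP[/eqP -> /eqP <-]|nb] := boolP ((S == top) && ((U_(xl i0) *+ b1 (xl i0))%MM == b)).
  by rewrite mulr1 -S1E -b1E.
rewrite mulr0; apply/eqP/negPn/negP => gb; case/negP: nb.
have [-> ->] := supp _ _ gb; rewrite eqxx /=.
suff -> : b (xl i0) = b1 (xl i0) by [].
by have := kE _ _ gb; rewrite (kE _ _ gb1); lia.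
Qed.

(** The way back from the top monomial, by induction on the degree in the x_i other than x_i0 plus
    the number of missing theta_(n+s). *)
Lemma gen_bfree (i0 : 'I_m1) (D : nat) : k = n%:Z - D%:Z ->
  U (bas (U_(xl i0) *+ D)%MM top) ->
  forall S b, grade lev S b = k -> bfree (bas b S) -> U (bas b S).
Proof.
move=> kD UD; case: (sU) => sub _ S b bk Bb.
have [e eE] : exists e, (\sum_(i | i != i0) b (xl i) + \sum_s (tr s \notin S) = e)%N.
  by eexists.
elim: e => [|e IH] in S b bk Bb eE *.
  have sup : ((bas b S) S)@_b != 0 by rewrite basE !eqxx oner_eq0.
  have [bx bt] := bfreeP Bb sup.
  move/eqP: eE; rewrite addn_eq0 !sum_nat_eq0 => /andP[/forall_inP bl /forallP St].
  have SE : S = top.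
    apply/setP; elim/half_ind => s; rewrite inE /=; first by rewrite (negPf (bt s)) leqNgt ltn_ord.
    by have := St s; rewrite eqb0 negbK leq_addr /= => ->.
  have bE : b = (U_(xl i0) *+ b (xl i0))%MM.
    apply/mnmP; elim/half_ind => i; rewrite mulmnE mnm1E; last by rewrite bx eq_lrshift.
    rewrite eq_lshift; have [->|ii0] := eqVneq i i0; first by rewrite mul1n.
    by rewrite (eqP (bl i ii0)).
  rewrite SE bE (_ : b (xl i0) = D) //.
  by move: bk; rewrite SE bE grade_top kD mulmnE mnm1E eqxx mul1n; lia.
have sup : ((bas b S) S)@_b != 0 by rewrite basE !eqxx oner_eq0.
have [bx bt] := bfreeP Bb sup.
case: (pickP (fun s => tr s \notin S)) => [s sS|St].
  (* The monomial with theta_(n+s) and one more x_i0 has the same level; d_i0 d_(n+s) removes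
     both. *)
  pose b' := (b + U_(xl i0))%MM.
  have U1 : U (bas b' (tr s |: S)).
    apply: IH.
    - by rewrite gradeT // gradeX /= ltn_ord -bk; ring.
    - apply: bfree_bas => [i|t]; first by rewrite mnmDE bx mnm1E eq_lrshift.
      by rewrite !inE eq_lrshift bt.
    move: eE; rewrite [in X in X -> _](bigD1 s) //= sS [in X in _ -> X](bigD1 s) //= !inE eqxx /=.
    rewrite addnCA add1n => -[<-]; rewrite add0n; congr (_ + _)%N.
      by apply: eq_bigr => i ii0; rewrite mnmDE mnm1E eq_lshift eq_sym (negPf ii0) addn0.
    by apply: eq_bigr => t ts; rewrite !inE eq_rshift (negPf ts).
  have B1 : bfree (bas b' S).
    apply: bfree_bas => [i|t]; first by rewrite mnmDE bx mnm1E eq_lrshift.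
    exact: bt.
  have U2 : U (Tr s (bas b' S)) by rewrite mulT_bas //; apply: subspaceZ.
  have := U_dl_Dr i0 s (bfree_Tr s B1) U2.
  rewrite spdtheta_mulT eqxx scale1r [Dr s (bas _ _)]spdtheta_bas0 // mulT_lin subr0 spdX_bas.
  by apply: subspaceZK => //; rewrite pnatr_eq0.
have [i /andP[ii0 bi]] : exists i, (i != i0) && (0 < b (xl i))%N.
  apply/existsP; apply: contraT; rewrite negb_exists => /forallP bi.
  move: eE; rewrite !big1 // => [s _|i ii0]; first by rewrite St.
  by have := bi i; rewrite ii0 /= -eqn0Ngt => /eqP.
have [[b1 bE]|bi0] := mnmU_split (xl i) b; last by rewrite bi0 in bi.
have B1 : bfree (bas (b1 + U_(xl i0)) S).
  apply: bfree_bas => [j|t]; last exact: bt.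
  have /eqP := bx j.
  by rewrite bE !mnmDE !mnm1E !eq_lrshift !addn0 => /eqP ->.
have U1 : U (bas (b1 + U_(xl i0)) S).
  apply: IH => //; first by rewrite -bk bE !gradeX /= !ltn_ord.
  move: eE; rewrite bE (bigD1 i) //= [in X in _ -> X](bigD1 i) //= !mnmDE !mnm1E eqxx.
  rewrite eq_lshift [i0 == i]eq_sym (negPf ii0) addn0 addn1 !addSn => -[<-].
  congr (_ + _ + _)%N; apply: eq_bigr => j /andP[ji0 ji].
  by rewrite !mnmDE !mnm1E !eq_lshift ![_ == j]eq_sym (negPf ji0) (negPf ji).
have := U_dl_Xl i0 i B1 U1; rewrite spdX_mulX_neq ?eq_lshift 1?eq_sym // spdX_bas mulX_lin mulX_bas -bE.
by apply: subspaceZK => //; rewrite pnatr_eq0.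
Qed.

Definition bdeg : grading m (n + n) :=
  (fun i : 'I_m => if (i < m1)%N then 0 else 1, fun s : 'I_(n + n) => if (s < n)%N then 1 else 0).

Lemma grade_bdeg_ge0 S b : 0 <= grade bdeg S b.
Proof.
rewrite addr_ge0 ?sumr_ge0 // => [i _|s _] /=; last by case: ifP.
by apply: mulrn_wge0; case: ifP.
Qed.

(** The level of g is recorded because [Hk_image_below] asks for it in the end. *)
Definition mod_rsq f : Prop :=
  exists f1 g, [/\ U f1, ofdeg lev (k - 2) g & f = f1 + rsq g].

Lemma submodule_mod_rsq : is_submodule m1 mod_rsq.
Proof.
case/submoduleP: (sU) => sub Uxx Uxt Utt; apply/submoduleP; split.
- split=> [|c f1 f2 [g1 [h1 [U1 l1 ->]]] [g2 [h2 [U2 l2 ->]]]].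
    by exists 0, 0; rewrite (rsq_lin _ _ hr) addr0; split=> //; [case: sub|exact: ofdeg0].
  exists (c *: g1 + g2), (c *: h1 + h2); split.
  + by case: sub => _; apply.
  + by apply: ofdegD => //; apply: ofdegZ.
  + by rewrite !(rsq_lin _ _ hr) scalerDr addrACA.
- move=> i j f [f1 [g [Uf1 gk ->]]]; exists (Lxx i j f1), (Lxx i j g); split.
  + exact: Uxx.
  + exact: lev_Lxx.
  + by rewrite Lxx_lin (rsq_Lxx hr).
- move=> i s f [f1 [g [Uf1 gk ->]]]; exists (Lxt i s f1), (Lxt i s g); split.
  + exact: Uxt.
  + exact: lev_Lxt.
  + by rewrite Lxt_lin (rsq_Lxt hr).
- move=> s t f [f1 [g [Uf1 gk ->]]]; exists (Ltt s t f1), (Ltt s t g); split.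
  + exact: Utt.
  + exact: lev_Ltt.
  + by rewrite Ltt_lin (rsq_Ltt hr).
Qed.

Lemma hole_euler_bas S b : hole_euler (bas b S) + bas b S = (holes S b).+1%:R *: bas b S.
Proof.
apply: superpolyP => S' b'; rewrite mcoeffspD mcoeffspZ mcoeff_hole_euler basE.
case: andP => [[/eqP -> /eqP ->]|_]; last by rewrite !mulr0 addr0.
by rewrite !mulr1 natr1.
Qed.

(** Induction on the number d of factors x_(m1+i) and theta_s, s < n. By [Xr_hole_euler] and
    [Tl_hole_euler], a monomial with such a factor is, up to a nonzero scalar, in the image of rsq
    plus osp applied to elements of smaller d. *)
Lemma generate_top (i0 : 'I_m1) (D : nat) : k = n%:Z - D%:Z ->
  U (bas (U_(xl i0) *+ D)%MM top) -> forall f, ofdeg lev k f -> mod_rsq f.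
Proof.
move=> kD UD; have [subU _] := sU.
have /submoduleP[sub Wxx Wxt Wtt] := submodule_mod_rsq.
have Wr g : ofdeg lev (k - 2) g -> mod_rsq (rsq g).
  by move=> gk; exists 0, g; rewrite add0r; split=> //; case: subU.
suff H (d : nat) : forall S b, grade lev S b = k -> grade bdeg S b = d -> mod_rsq (bas b S).
  move=> f fk; apply: (subspace_span sub) => S b /fk bk.
  by apply: (H (absz (grade bdeg S b))) => //; rewrite gez0_abs ?grade_bdeg_ge0.
elim: d => [|d IH] S b bk bd.
(* The cases d = 0 and d + 1 run in parallel; for d = 0, the presence of such a factor contradicts
   the degree. *)
all: case: (pickP (fun i => 0 < b (xr i))%N) => [i bi|bx].
1,3: have [[b1 bE]|bi0] := mnmU_split (xr i) b; last by rewrite bi0 in bi.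
1,2: have := grade_bdeg_ge0 S b1; move: bd; rewrite bE gradeX /= ltnNge leq_addr /= => bd.
- by lia.
- move=> _; have {}bd : grade bdeg S b1 = d by lia.
  have {}IH f : ofdeg lev k f -> ofdeg bdeg d f -> mod_rsq f.
    by move=> fk fd; apply: (subspace_span sub) => S' b' b'f; apply: IH; [exact: fk|exact: fd].
  have lev1 : ofdeg lev (k - 1) (bas b1 S).
    apply: (ofdegE (@ofdeg_bas F m1 n lev S b1)).
    by rewrite -bk bE gradeX /= ltnNge leq_addr /= addrK.
  have bdeg1 : ofdeg bdeg d (bas b1 S) by apply: (ofdegE (@ofdeg_bas F m1 n bdeg S b1)).
  rewrite -mulX_bas; apply: (subspaceZK sub (_ : (holes S b1).+1%:R != 0)); first by rewrite pnatr_eq0.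
  rewrite -mulX_lin -hole_euler_bas Xr_hole_euler; apply: subspaceD => //; first apply: subspaceB => //.
  + apply: Wr; apply: (ofdegE (ofdeg_mulX lev1)); rewrite /= ltn_ord; ring.
  + apply: subspace_sum => // j _; apply: Wxx; apply: IH.
      by apply: (ofdegE (ofdeg_spdX lev1)); rewrite /= ltn_ord; ring.
    by apply: (ofdegE (ofdeg_spdX bdeg1)); rewrite /= ltn_ord; ring.
  + apply: subspace_sum => // s _; apply: Wxt; apply: IH.
      by apply: (ofdegE (ofdeg_mulT lev1)); rewrite /=; ring.
    by apply: (ofdegE (ofdeg_mulT bdeg1)); rewrite /= ltnNge leq_addr /=; ring.
all: case: (pickP (fun s => tl s \in S)) => [s sS|St].
1,3: have sS1 : tl s \notin S :\ tl s by rewrite setD11.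
1,2: have := grade_bdeg_ge0 (S :\ tl s) b; move: bd; rewrite -{1}(setD1K sS) gradeT //= ltn_ord => bd.
1,2: have {}bd := canRL (addrK 1) bd; rewrite bd.
- by [].
- move=> _; have {}bd : grade bdeg (S :\ tl s) b = d by rewrite bd; lia.
  have {}IH f : ofdeg lev k f -> ofdeg bdeg d f -> mod_rsq f.
    by move=> fk fd; apply: (subspace_span sub) => S' b' b'f; apply: IH; [exact: fk|exact: fd].
  set S1 := S :\ tl s in sS1 bd.
  have lev1 : ofdeg lev (k - 1) (bas b S1).
    apply: (ofdegE (@ofdeg_bas F m1 n lev S1 b)).
    by rewrite -bk -[in RHS](setD1K sS) gradeT //= addrK.
  have bdeg1 : ofdeg bdeg d (bas b S1) by apply: (ofdegE (@ofdeg_bas F m1 n bdeg S1 b)).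
  apply: (subspaceZK sub (koszul_neq0 F (tl s) S1)).
  have -> : koszul F (tl s) S1 *: bas b S = Tl s (bas b S1) by rewrite mulT_bas // setD1K.
  apply: (subspaceZK sub (_ : (holes S1 b).+1%:R != 0)); first by rewrite pnatr_eq0.
  rewrite -mulT_lin -hole_euler_bas Tl_hole_euler; apply: subspaceD => //; first apply: subspaceB => //.
  + apply: Wr; apply: (ofdegE (ofdeg_spdtheta lev1)); rewrite /=; ring.
  + apply: subspace_sum => // j _; apply: Wxt; apply: IH.
      by apply: (ofdegE (ofdeg_spdX lev1)); rewrite /= ltn_ord; ring.
    by apply: (ofdegE (ofdeg_spdX bdeg1)); rewrite /= ltn_ord; ring.
  + apply: subspace_sum => // t _; apply: Wtt; apply: IH.
      by apply: (ofdegE (ofdeg_mulT lev1)); rewrite /=; ring.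
    by apply: (ofdegE (ofdeg_mulT bdeg1)); rewrite /= ltnNge leq_addr /=; ring.
all: exists (bas b S), 0; rewrite (rsq_lin _ _ hr) addr0; split=> //; last exact: ofdeg0.
all: apply: (gen_bfree kD UD) => //; apply: bfree_bas => [i|s]; last by rewrite St.
all: by have := bx i; rewrite lt0n => /negbFE/eqP.
Qed.

End Submodule.

(** A nonzero submodule U contains every h of H_k modulo the image of rsq. The difference with an
    element of U is harmonic and in the image at a level k <= n < N = n + 1, hence 0. *)
Lemma irreducible_top k : (0 < m1)%N -> k <= n%:Z -> irreducible_submodule m1 (Hk k).
Proof.
move=> m0 kn; have sH := submodule_Hk F n hr k; pose i0 := Ordinal m0.
split=> //.
  exists (bas (U_(xl i0) *+ absz (n%:Z - k)) top); last exact: bas_neq0.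
  apply/HkP; split.
    apply: (ofdegE (@ofdeg_bas F m1 n lev _ _)); rewrite grade_top; lia.
  have [Bx Bt] : bfree (bas (U_(xl i0) *+ absz (n%:Z - k)) top).
    apply: bfree_bas => [i|s]; first by rewrite mulmnE mnm1E eq_lrshift mul0n.
    by rewrite inE /= leqNgt ltn_ord.
  rewrite lap_top !big1 ?oppr0 ?addr0 // => [s _|i _].
    by rewrite spdthetaC Bt spdtheta_lin oppr0.
  by rewrite Bx mulX_lin.
move=> U sU UH; have [U0|nU] := classic (forall f, U f -> f = 0); [by left|right].
have [f nf] := not_all_ex_not _ _ nU; have [Uf f0] := imply_to_and _ _ nf.
have [D [kD UD]] := reach_top sU UH i0 Uf f0.
move=> h Hh; have /HkP[hk _] := Hh.
have [f1 [g [Uf1 gk hE]]] := generate_top sU kD UD hk.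
suff -> : h = f1 by [].
apply/eqP; rewrite -subr_eq0; apply/eqP; apply: (Hk_image_below hr _ _ gk).
- by apply: (le_trans kn); rewrite /crit; lia.
- by case: sH => sub _; apply: subspaceB => //; apply: UH.
- by rewrite hE addrC addKr.
Qed.

End Top.

(** * Assembling the cases *)

Lemma eta_op_rsq (F : numFieldType) m1 n r : @eta_op F m1 n r = rsq r.
Proof. exact: lock. Qed.

Lemma xpowE (F : numFieldType) m1 n (i : 'I_m1) (e : nat) :
  xpow F n i e = iter e (mulX (lshift m1 i)) (bas F 0%MM set0).
Proof. by rewrite iter_X_one. Qed.

(** For r = 0 and m1 = 1 the only pair of variables is also the last one: r = m1 - 1 and N = n. By
    [Hk_weight0] the part of weight 0 of H_k lies in R_k as soon as k > n, and the submodule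
    generated by u^k does not contain v^k. Hence the conditions on m1 and k in the case r = 0. *)
Theorem theorem1 (R : realType) (m1 n r : nat) (k : int)
    (hm1 : (0 < m1)%N) (hn : (0 < n)%N) (hr : (r <= m1)%N)
    (hk : r = 0%N -> 0 <= k) :
  let A := @Ak R[i] m1 n r in
  let H := @Hk R[i] m1 n r in
  let eta := @eta_op R[i] m1 n r in
  let decomposes :=
    direct_sum (A k) (H k) (spimage eta (A (k - 2))) in
  let N : int := n%:Z - m1%:Z + r%:Z + 1 in
  [/\ r = 0%N ->
        ((2 * N < k \/ k <= N) ->
           decomposes /\
           ((m1 = 1%N -> k <= n%:Z) -> irreducible_submodule r (H k))) /\
        (N < k -> k <= 2 * N -> (1 < m1)%N ->
           composition_series r
             [:: H k;
                 spimage (iter (absz (k - N)) eta) (H (2 * N - k));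
                 @spzero _ _ _]),
      r = m1 ->
        [/\ decomposes,
            n%:Z < k -> forall f, H k f <-> f = 0
          & k <= n%:Z -> irreducible_submodule r (H k)]
    & (0 < r)%N -> (r < m1)%N ->
        [/\ k <= N -> decomposes /\ irreducible_submodule r (H k),
            N < k -> (r < m1 - 1)%N ->
              composition_series r
                [:: H k;
                    spimage (iter (absz (k - N)) eta) (H (2 * N - k));
                    @spzero _ _ _]
          & N < k -> r = (m1 - 1)%N -> forall l : 'I_m1, l = (m1 - 1)%N :> nat ->
              composition_series r
                [:: H k;
                    generated r (fun f => f = xpow R[i] n l (absz k));
                    spimage (iter (absz (k - n%:Z)) eta) (H (2 * n%:Z - k));
                    @spzero _ _ _]]].
Proof.
move=> A H eta; rewrite /eta (eta_op_rsq R[i]).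
set N := n%:Z - m1%:Z + r%:Z + 1.
(* The two sources of elements free of the chosen pair p: a power of a variable from another pair,
   or, at a level at most n, a product of thetas. *)
have two (p : 'I_m1) (c : 'I_m1) j : (r <= c)%N -> c != p -> spare R[i] n r p j.
  move=> rc cp; have [j0|j0] := leP 0 j; first exact: (spare_var _ _ hr j0 rc cp).
  by left; apply: ltW.
have few (p : 'I_m1) j : j <= n%:Z -> spare R[i] n r p j.
  move=> jn; have [j0|j0] := leP 0 j; last by left; apply: ltW.
  by rewrite -(gez0_abs j0); apply: spare_theta => //; lia.
split.
- move=> r0; have k0 := hk r0.
  have rl (p : 'I_m1) : (r <= p)%N by rewrite r0.
  have other (p : 'I_m1) : (1 < m1)%N -> exists c : 'I_m1, c != p.
    move=> m1_gt1; have [p0|p0] := eqVneq (p : nat) 0%N.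
      by exists (Ordinal m1_gt1); rewrite -(inj_eq val_inj) /= p0.
    by exists (Ordinal hm1); rewrite -(inj_eq val_inj) /= eq_sym.
  split=> [kN|Nk kN m1_gt1].
    split.
      by case: kN => kN; [apply: decomposition_above|apply: decomposition_below].
    move=> kn; have sp : spare R[i] n r (Ordinal hm1) k.
      have [m11|m1_gt1] := leqP m1 1; first by apply/few/kn; lia.
      by have [c cl] := other (Ordinal hm1) m1_gt1; apply: (two _ c).
    case: kN => kN; first by apply: (Hk_irreducible_above hr (rl _) r0 k0 kN sp).
    apply: (Hk_irreducible_below hr (rl _) kN _ sp); lia.
  have [c cl] := other (Ordinal hm1) m1_gt1.
  apply: (series2 hr (rl (Ordinal hm1)) Nk); [by rewrite ltNge k0| |exact: (two _ c)|exact: (two _ c)].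
  by rewrite /crit ltNge subr_ge0 kN.
- move=> rm; split.
  + exact: decomposition_all.
  + move=> nk f; split; first exact: (Hk_zero_above hr rm nk).
    by move=> ->; case: (submodule_Hk R[i] n hr k) => -[].
  + by move=> kn; rewrite /H rm; apply: irreducible_top.
move=> r0 rm; have m1P : (m1.-1 < m1)%N by rewrite ltn_predL.
pose p := Ordinal m1P; have rp : (r <= p)%N by rewrite /= -ltnS prednK.
have two' j : (r < m1 - 1)%N -> spare R[i] n r p j.
  move=> rm'; apply: (two p (Ordinal rm)) => //.
  by rewrite -(inj_eq val_inj) /=; lia.
split.
- move=> kN; split; first exact: decomposition_below.
  apply: (Hk_irreducible_below hr rp kN) => //.
  have [rm'|rm'] := ltnP r (m1 - 1); first exact: two'.
  (* Here r = m1 - 1, so N = n. *)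
  by apply: few; move: kN; rewrite /crit; lia.
- by move=> Nk rm'; apply: (series2 hr rp Nk) => //; apply: two'.
move=> Nk rE l lE; rewrite xpowE.
have NE : N = n%:Z by rewrite /N; lia.
have lr : l = r :> nat by rewrite lE.
have rE' : r.+1 = m1 by lia.
have nk : n%:Z < k by rewrite -NE.
have := series3 R[i] hr (eq_leq (esym lr)) lr rE' r0 nk.
by rewrite /Rk (_ : crit m1 n r = n%:Z).
Qed.
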